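(* Consider the control-affine system $\dot x=f_0(x)+u f_1(x)$ on $\mathbb{R}^d$, where $f_0,f_1$ are vector fields real-analytic on a neighborhood of $0$ with $f_0(0)=0$. If this system is $W^{-1,\infty}$-STLC, then $$\forall k\in\mathbb{N}^*,\qquad \mathrm{ad}_{f_1}^{2k}(f_0)(0)\in S_{\{1,\dots,2k-1\}}(f)(0).$$
   Context: System. $d\ge1$, $x(t)\in\mathbb{R}^d$, and the control $u(t)\in\mathbb{R}$ is scalar. For $t>0$ and $u\in L^1((0,t);\mathbb{R})$, $x(\cdot;u)$ is the unique maximal mild solution with $x(0)=0$; only times and controls small enough for it to be defined up to time $t$ are considered. Norm. For $u\in L^1((0,t);\mathbb{R})$ let $u_1(s):=\int_0^s u$ and $\|u\|_{W^{-1,\infty}}:=\|u_1\|_{L^\infty(0,t)}$. STLC. The system is $W^{-1,\infty}$-STLC when for every $t,\rho>0$ there exists $\delta>0$ such that for every $x^\star\in B(0,\delta)$ there exists $u\in L^1((0,t);\mathbb{R})$ with $\|u\|_{W^{-1,\infty}}\le\rho$ and $x(t;u)=x^\star$. Brackets. For vector fields, $[f,g]:=(Dg)f-(Df)g$ and $\mathrm{ad}_f(g):=[f,g]$. $\mathrm{Br}(X)$ is the free magma over $X=\{X_0,X_1\}$ (formal iterated brackets), $n_1(b)$ is the number of occurrences of $X_1$ in $b$, and $f_b$ is the vector field obtained from $b\in\mathrm{Br}(X)$ by replacing $X_i$ by $f_i$ and formal brackets by Lie brackets of vector fields. For $A\subset\mathbb{N}$, $S_A(f)(0):=\mathrm{span}\{f_b(0):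 b\in\mathrm{Br}(X),\ n_1(b)\in A\}\subset\mathbb{R}^d$. *)

(* Defs.v *)
From HB Require Import structures.
From mathcomp Require Import all_boot all_order all_algebra.
From mathcomp Require Import all_classical all_reals all_analysis.

Set Implicit Arguments.
Unset Strict Implicit.
Unset Printing Implicit Defensive.

Import Order.TTheory GRing.Theory Num.Theory.
Import numFieldNormedType.Exports.

Local Open Scope classical_set_scope.
Local Open Scope ring_scope.

(* R^d is 'rV[R]_d, with the library's (maximum) norm. A vector field defined
   on an open set U is a total function whose values outside U are irrelevant. *)

Section real_analytic.
Context {R : realType} {d : nat}.
Implicit Types (h : 'rV[R]_d -> R) (a x : 'rV[R]_d).

Definition monomial (x : 'rV[R]_d) (alpha : {ffun 'I_d -> nat}) : R :=
  \prod_(i < d) x 0 i ^+ alpha i.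

(* h is near a the sum of an absolutely convergent power series. Since the
   family is absolutely summable, its sum is the limit of its partial sums over
   the multi-indices with all entries < N. *)
Definition real_analytic_at h a : Prop :=
  exists (c : {ffun 'I_d -> nat} -> R) (r : R), 0 < r /\
    forall x, `|x - a| < r ->
      summable [set: {ffun 'I_d -> nat}]
        (fun alpha => (c alpha * monomial (x - a) alpha)%:E) /\
      (fun N : nat => \sum_(beta : {ffun 'I_d -> 'I_N})
          let alpha := [ffun i => nat_of_ord (beta i)] in
          c alpha * monomial (x - a) alpha) @ \oo --> h x.

Definition real_analytic_on (U : set 'rV[R]_d) (f : 'rV[R]_d -> 'rV[R]_d) :=
  forall a, U a -> forall i : 'I_d, real_analytic_at (fun x => f x 0 i) a.

End real_analytic.

Section brackets.
Context {R : realType} {d : nat}.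
Implicit Types f g : 'rV[R]_d -> 'rV[R]_d.

Definition lie_bracket f g : 'rV[R]_d -> 'rV[R]_d :=
  fun x => 'd g x (f x) - 'd f x (g x).

Definition ad f (k : nat) g := iter k (lie_bracket f) g.

End brackets.

(* The free magma over {X0, X1}. *)
Inductive Br : Type := X0 | X1 | Bracket of Br & Br.

Fixpoint n1 (b : Br) : nat :=
  match b with
  | X0 => 0
  | X1 => 1
  | Bracket b1 b2 => n1 b1 + n1 b2
  end.

Section control_system.
Context {R : realType} {d : nat}.
Implicit Types (U : set 'rV[R]_d) (u : R -> R).

Local Notation mu := (@lebesgue_measure R).

Fixpoint eval_bracket (f0 f1 : 'rV[R]_d -> 'rV[R]_d) (b : Br) : 'rV[R]_d -> 'rV[R]_d :=
  match b with
  | X0 => f0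
  | X1 => f1
  | Bracket b1 b2 => lie_bracket (eval_bracket f0 f1 b1) (eval_bracket f0 f1 b2)
  end.

(* S_A(f)(0): the linear combinations of finitely many f_b(0), n1 b \in A. *)
Definition S_ (A : pred nat) (f0 f1 : 'rV[R]_d -> 'rV[R]_d) : set 'rV[R]_d :=
  [set v | exists2 bs : seq Br, all (fun b => A (n1 b)) bs &
     v \in <<[seq eval_bracket f0 f1 b 0 | b <- bs]>>%VS].

Definition primitive u (s : R) : R := \int[mu]_(y in `[0, s]) u y.

(* The norm of L^oo(0, t) is computed on the extension by 0 outside ]0, t[. *)
Definition Wm1oo_norm (t : R) u : \bar R :=
  'N[mu]_+oo[EFin \o (primitive u \_ `]0, t[)%R]%E.

Definition mild_solution (f0 f1 : 'rV[R]_d -> 'rV[R]_d) U (t : R) u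
    (x : R -> 'rV[R]_d) : Prop :=
  [/\ {within `[0, t], continuous x},
      forall s, 0 <= s <= t -> U (x s) &
      forall s, 0 <= s <= t -> forall i : 'I_d,
        x s 0 i =
          \int[mu]_(y in `[0, s]) (f0 (x y) 0 i + u y * f1 (x y) 0 i)].

(* Mild solutions on [0, t] being unique when f0 and f1 are analytic on U,
   "x(t; u) = xs" is the existence of one which is defined up to time t and
   takes the value xs there. *)
Definition Wm1oo_STLC (f0 f1 : 'rV[R]_d -> 'rV[R]_d) U : Prop :=
  forall t rho : R, 0 < t -> 0 < rho ->
  exists2 delta : R, 0 < delta &
  forall xs : 'rV[R]_d, ball 0 delta xs ->
  exists u : R -> R,
    [/\ mu.-integrable `]0, t[ (EFin \o u),
        (Wm1oo_norm t u <= rho%:E)%E &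
        exists2 x : R -> 'rV[R]_d, mild_solution f0 f1 U t u x & x t = xs].

End control_system.

(* Main.v *)
Require Import Defs.
From HB Require Import structures.
From mathcomp Require Import all_boot all_order all_algebra.
From mathcomp Require Import all_classical all_reals all_analysis.
From mathcomp Require Import measurable_realfun ess_sup_inf.
From mathcomp Require Import ring lra zify.
Import Order.TTheory GRing.Theory Num.Theory.
Import numFieldNormedType.Exports.
Local Open Scope classical_set_scope.
Local Open Scope ring_scope.
Set Implicit Arguments.
Unset Strict Implicit.
Unset Printing Implicit Defensive.

(** Let g = ad f1 ^ 2k (f0) (0), let v be the primitive of the control, which
    is small in the sup norm, and let V n be the integral of |v|^n on [0, T].
    Suppose that g is not in the span of the values at 0 of the brackets of
    weight (number of occurrences of f1) between 1 and 2k - 1. The points - a g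
    with a > 0 small are then unreachable, for the following reason.

    There is a function phi, analytic near 0, whose derivative along g at 0 is
    1 and which is killed at 0 by all iterated Lie derivatives along brackets
    of total weight below 2k (obstruction_function). It is a linear form
    separating g from the span, corrected by terms of higher degree.

    Transport phi by the flow of f1 for the time v: let <phi> be the sum of
    (-v)^j / j! (L_f1^j phi)(x). The control cancels from the derivative of
    <phi>, and what remains is the sum of (-v)^j / j! (L_f0 L_f1^j phi)(x)
    (transport_estimate). Rewrite this in powers of v with coefficients which
    are themselves transported functions. The coefficient of v^2k is at 0 equal
    to (L_g phi)(0) / (2k)! = 1 / (2k)!, by the binomial formula for the iterated
    commutator (lie_ad). The coefficients of v^n with n < 2k are invisible to
    brackets of total weight below 2k - n, and this forces them to be of the
    size of V (2k - n) (pull_small_exists); multiplied by |v|^n and integrated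
    they contribute O(T V (2k)), because V i V j <= 2 T V (i + j). Hence, for
    small T and v, <phi> (T) is essentially at least V (2k) / (2k)! >= 0
    (drift_lower_bound); here it matters that 2k is even.

    If x(T) = - a g, then on the other hand <phi> (T) is about - a, with an error
    of the order of |v(T)|^2k. When f1 does not vanish at 0, the position of the
    endpoint shows that |v(T)| is of the order of a + V 1 (final_primitive),
    so that |v(T)|^2k = O(a^2 + T V (2k)), and the two estimates contradict each
    other (unreachable). When f1 vanishes at 0, all brackets do.

    Controls are only integrable. The product and chain rules are therefore
    proved for absolutely continuous functions, by a bisection argument on
    increments (quadratic_increments). Analyticity is used through majorants of
    power series, which give the geometric growth of L_f1^j h / j! needed to let
    the order of the transport tend to infinity (lie_growth). *)

(** * Polynomials as lists of monomials *)

Section row_norm.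
Context {R : realType} {d : nat}.

Lemma le_coord (x : 'rV[R]_d) k : `|x 0 k| <= `|x|.
Proof.
rewrite /Num.norm /= mx_normrE.
by apply: (@le_bigmax _ _ _ 0 (fun i => `|x i.1 i.2|) (0, k)).
Qed.

Lemma le_row (x : 'rV[R]_d) c : 0 <= c -> (forall k, `|x 0 k| <= c) -> `|x| <= c.
Proof.
move=> c0 xc; rewrite /Num.norm /= mx_normrE.
by apply/bigmax_leP; split => // -[i k] _ /=; rewrite (ord1 i).
Qed.

End row_norm.

Section polynomial_lists.
Context {R : realType} {d : nat}.
Implicit Types (x v : 'rV[R]_d) (w : seq 'I_d) (p q : seq (R * seq 'I_d)) (rho : R).

(** The monomial with exponents the multiplicities of w: a word lists its
    variables one by one. *)
Definition ev_word x w : R := \prod_(i <- w) x 0 i.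
Definition ev x p : R := \sum_(t <- p) t.1 * ev_word x t.2.
Definition coef_norm rho p : R := \sum_(t <- p) `|t.1| * rho ^+ size t.2.

(** The words obtained by deleting one occurrence of i: the i-th partial
    derivative of a monomial, as a sum of monomials with coefficient 1. *)
Fixpoint deriv_word (i : 'I_d) w : seq (seq 'I_d) :=
  if w is k :: w' then
    (if k == i then [:: w'] else [::]) ++ [seq k :: z | z <- deriv_word i w']
  else [::].

Definition deriv_poly i p : seq (R * seq 'I_d) :=
  flatten [seq [seq (t.1, z) | z <- deriv_word i t.2] | t <- p].
Definition mul_poly p q : seq (R * seq 'I_d) :=
  [seq (t.1 * s.1, t.2 ++ s.2) | t <- p, s <- q].

Lemma ev_word_cons x k w : ev_word x (k :: w) = x 0 k * ev_word x w.
Proof. by rewrite /ev_word big_cons. Qed.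

Lemma ev_word_cat x w w' : ev_word x (w ++ w') = ev_word x w * ev_word x w'.
Proof. by rewrite /ev_word big_cat. Qed.

Lemma ev_cat x p q : ev x (p ++ q) = ev x p + ev x q.
Proof. by rewrite /ev big_cat. Qed.

Lemma coef_norm_cat rho p q : coef_norm rho (p ++ q) = coef_norm rho p + coef_norm rho q.
Proof. by rewrite /coef_norm big_cat. Qed.

Lemma coef_norm_ge0 rho p : 0 <= rho -> 0 <= coef_norm rho p.
Proof. by move=> r0; apply: sumr_ge0 => t _; rewrite mulr_ge0// exprn_ge0. Qed.

Lemma ev_mul_poly x p q : ev x (mul_poly p q) = ev x p * ev x q.
Proof.
rewrite /ev /mul_poly big_allpairs_dep mulr_suml /=; apply: eq_bigr => t _.
rewrite mulr_sumr; apply: eq_bigr => s _ /=.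
by rewrite ev_word_cat mulrACA.
Qed.

Lemma coef_norm_mul_poly rho p q : coef_norm rho (mul_poly p q) = coef_norm rho p * coef_norm rho q.
Proof.
rewrite /coef_norm /mul_poly big_allpairs_dep mulr_suml /=; apply: eq_bigr => t _.
rewrite mulr_sumr; apply: eq_bigr => s _ /=.
by rewrite size_cat exprD normrM mulrACA.
Qed.

Lemma ev_word_le x rho w : `|x| <= rho -> `|ev_word x w| <= rho ^+ size w.
Proof.
move=> xr; elim: w => [|k w IH]; first by rewrite /ev_word big_nil normr1.
rewrite ev_word_cons normrM exprS ler_pM// (le_trans _ xr)//.
exact: le_coord.
Qed.

Lemma ev_le x rho p : `|x| <= rho -> `|ev x p| <= coef_norm rho p.
Proof.
move=> xr; rewrite /ev /coef_norm (le_trans (ler_norm_sum _ _ _))//.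
by apply: ler_sum => t _; rewrite normrM ler_wpM2l// ev_word_le.
Qed.

Lemma coef_norm_le rho rho' p : 0 <= rho -> rho <= rho' -> coef_norm rho p <= coef_norm rho' p.
Proof.
move=> r0 rr; apply: ler_sum => t _; rewrite ler_wpM2l//.
by rewrite lerXn2r// nnegrE (le_trans r0).
Qed.

Lemma size_deriv_word i w z : z \in deriv_word i w -> (size z).+1 = size w.
Proof.
elim: w z => [//|k w IH] z /=; rewrite mem_cat => /orP[|].
  by case: ifP => // _; rewrite inE => /eqP ->.
by case/mapP => z' /IH sz -> /=; rewrite sz.
Qed.

Definition ev_deriv_word x i w : R := \sum_(z <- deriv_word i w) ev_word x z.

Lemma ev_deriv_word_cons x i k w : ev_deriv_word x i (k :: w) = (k == i)%:R * ev_word x w + x 0 k * ev_deriv_word x i w.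
Proof.
rewrite /ev_deriv_word /= big_cat big_map /= mulr_sumr; congr (_ + _).
  by case: eqP; rewrite ?big_seq1 ?big_nil ?(mul1r, mul0r).
by apply: eq_bigr => z _; rewrite ev_word_cons.
Qed.

Lemma ev_deriv_poly x i p : ev x (deriv_poly i p) = \sum_(t <- p) t.1 * ev_deriv_word x i t.2.
Proof.
rewrite /ev /deriv_poly big_flatten big_map; apply: eq_bigr => t _.
by rewrite big_map /= -mulr_sumr.
Qed.

Lemma deriv_poly_cat i p q : deriv_poly i (p ++ q) = deriv_poly i p ++ deriv_poly i q.
Proof. by rewrite /deriv_poly map_cat flatten_cat. Qed.

(** Cauchy estimate on one monomial: n rho'^(n-1) (rho - rho') <= rho^n. *)
Lemma coef_norm_deriv_poly i p rho rho' : 0 <= rho' -> rho' < rho ->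
  coef_norm rho' (deriv_poly i p) * (rho - rho') <= coef_norm rho p.
Proof.
move=> r0 rr; rewrite /coef_norm /deriv_poly big_flatten big_map mulr_suml; apply: ler_sum => t _.
rewrite big_map /= -mulr_sumr -mulrA ler_wpM2l//.
suff : (\sum_(z <- deriv_word i t.2) rho' ^+ size z) * (rho - rho') <=
    rho ^+ size t.2 - rho' ^+ size t.2.
  by move/le_trans; apply; rewrite gerBl exprn_ge0.
elim: (t.2) => [|k w IH]; first by rewrite /= big_nil mul0r subrr.
rewrite /= big_cat big_map /= mulrDl.
have -> : \sum_(z <- deriv_word i w) rho' ^+ (size z).+1 =
    rho' * \sum_(z <- deriv_word i w) rho' ^+ size z.
  by rewrite mulr_sumr; apply: eq_bigr => z _; rewrite exprS.
have h1 : (\sum_(z <- if k == i then [:: w] else [::]) rho' ^+ size z) <= rho' ^+ size w.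
  by case: eqP; rewrite ?big_seq1 ?big_nil ?exprn_ge0.
have h2 : rho' ^+ size w <= rho ^+ size w.
  by apply: lerXn2r; rewrite ?nnegrE; lra.
rewrite !exprS.
set a := \sum_(z <- if _ then _ else _) _ in h1 *.
set b := \sum_(z <- deriv_word i w) _ in IH *.
set c := rho' ^+ _ in h1 h2 IH *; set e := rho ^+ _ in h2 IH *.
have h6 : a * (rho - rho') <= c * (rho - rho') by apply: ler_wpM2r; lra.
have h7 : rho' * (b * (rho - rho')) <= rho' * (e - c) by rewrite ler_wpM2l.
have h8 : 0 <= (rho - rho') * (e - c) by apply: mulr_ge0; lra.
by clear IH; nra.
Qed.

(** Every factor of v costs at most |v| / eps in the norm on the larger ball,
    because |v| = (|v| / eps) eps. *)
Lemma ev_word_incr x v w rho' eps : 0 < eps -> `|x| <= rho' -> `|v| <= eps ->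
  `|ev_word (x + v) w - ev_word x w| <= `|v| / eps * (rho' + eps) ^+ size w.
Proof.
move=> e0 xr ve; have r0 : 0 <= rho' := le_trans (normr_ge0 _) xr.
have t0 : 0 <= `|v| / eps by rewrite divr_ge0// ltW.
elim: w => [|k w IH].
  by rewrite /ev_word !big_nil subrr normr0 mulr1.
rewrite !ev_word_cons mxE exprS.
have -> : (x 0 k + v 0 k) * ev_word (x + v) w - x 0 k * ev_word x w =
  x 0 k * (ev_word (x + v) w - ev_word x w) + v 0 k * ev_word (x + v) w by ring.
apply: (le_trans (ler_normD _ _)); rewrite !normrM.
have h1 : `|x 0 k| <= rho' := le_trans (le_coord _ _) xr.
have h2 : `|v 0 k| <= `|v| / eps * eps by rewrite divfK ?gt_eqF// le_coord.
have h3 : `|ev_word (x + v) w| <= (rho' + eps) ^+ size w.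
  by apply: ev_word_le; rewrite (le_trans (ler_normD _ _))// lerD.
have -> : `|v| / eps * ((rho' + eps) * (rho' + eps) ^+ size w) =
   rho' * (`|v| / eps * (rho' + eps) ^+ size w) +
   `|v| / eps * eps * (rho' + eps) ^+ size w by ring.
by rewrite lerD// ler_pM.
Qed.

Lemma ev_word_taylor x v w rho' eps : 0 < eps -> `|x| <= rho' -> `|v| <= eps ->
  `|ev_word (x + v) w - ev_word x w - \sum_i v 0 i * ev_deriv_word x i w| <=
  (`|v| / eps) ^+ 2 * (rho' + eps) ^+ size w.
Proof.
move=> e0 xr ve; have r0 : 0 <= rho' := le_trans (normr_ge0 _) xr.
have t0 : 0 <= `|v| / eps by rewrite divr_ge0// ltW.
elim: w => [|k w IH].
  rewrite /ev_word !big_nil subrr sub0r normrN big1 ?normr0 ?mulr1 ?exprn_ge0//.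
  by move=> i _; rewrite /ev_deriv_word big_nil mulr0.
rewrite !ev_word_cons mxE [(_ + eps) ^+ _]exprS.
have -> : \sum_i v 0 i * ev_deriv_word x i (k :: w) =
    v 0 k * ev_word x w + x 0 k * \sum_i v 0 i * ev_deriv_word x i w.
  rewrite mulr_sumr (bigD1 k)//= [in RHS](bigD1 k)//= !ev_deriv_word_cons eqxx addrA; congr (_ + _).
    by rewrite mul1r; ring.
  apply: eq_bigr => i ik; rewrite ev_deriv_word_cons eq_sym (negbTE ik) mul0r; ring.
set S := \sum_i _ in IH *.
have -> : (x 0 k + v 0 k) * ev_word (x + v) w - x 0 k * ev_word x w -
    (v 0 k * ev_word x w + x 0 k * S) =
  x 0 k * (ev_word (x + v) w - ev_word x w - S) + v 0 k * (ev_word (x + v) w - ev_word x w) by ring.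
apply: (le_trans (ler_normD _ _)); rewrite !normrM.
have h1 : `|x 0 k| <= rho' := le_trans (le_coord _ _) xr.
have h2 : `|v 0 k| <= `|v| / eps * eps by rewrite divfK ?gt_eqF// le_coord.
have h3 := ev_word_incr w e0 xr ve.
have -> : (`|v| / eps) ^+ 2 * ((rho' + eps) * (rho' + eps) ^+ size w) =
   rho' * ((`|v| / eps) ^+ 2 * (rho' + eps) ^+ size w) +
   `|v| / eps * eps * (`|v| / eps * (rho' + eps) ^+ size w) by ring.
by rewrite lerD// ler_pM.
Qed.

(** The bound is uniform in the polynomial through its coefficient norm
    only, so that it passes to limits and yields the differential of
    power series. *)
Lemma ev_taylor x v p rho' eps : 0 < eps -> `|x| <= rho' -> `|v| <= eps ->
  `|ev (x + v) p - ev x p - \sum_i v 0 i * ev x (deriv_poly i p)| <=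
  (`|v| / eps) ^+ 2 * coef_norm (rho' + eps) p.
Proof.
move=> e0 xr ve.
have -> : \sum_i v 0 i * ev x (deriv_poly i p) = \sum_(t <- p) t.1 * \sum_i v 0 i * ev_deriv_word x i t.2.
  under eq_bigr do rewrite ev_deriv_poly mulr_sumr.
  rewrite exchange_big; apply: eq_bigr => t _; rewrite mulr_sumr.
  by apply: eq_bigr => i _; rewrite mulrCA.
rewrite /ev /coef_norm -!sumrB mulr_sumr (le_trans (ler_norm_sum _ _ _))//.
apply: ler_sum => t _; rewrite -!mulrBr normrM mulrCA ler_wpM2l//.
exact: ev_word_taylor.
Qed.

Lemma ev_deriv_polyC x i j p : ev x (deriv_poly i (deriv_poly j p)) = ev x (deriv_poly j (deriv_poly i p)).
Proof.
have E a b : ev x (deriv_poly a (deriv_poly b p)) = \sum_(t <- p) t.1 * \sum_(z <- deriv_word b t.2) ev_deriv_word x a z.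
  rewrite ev_deriv_poly /deriv_poly big_flatten big_map; apply: eq_bigr => t _.
  by rewrite big_map /= mulr_sumr.
rewrite !E; apply: eq_bigr => t _; congr (_ * _).
elim: (t.2) => [|k w IH]; first by rewrite /= !big_nil.
have F a b : \sum_(z <- deriv_word b (k :: w)) ev_deriv_word x a z =
   (k == b)%:R * ev_deriv_word x a w + (k == a)%:R * ev_deriv_word x b w + x 0 k * \sum_(z <- deriv_word b w) ev_deriv_word x a z.
  rewrite /= big_cat big_map /= -addrA; congr (_ + _).
    by case: (k == b); rewrite ?big_seq1 ?big_nil ?mul1r ?mul0r.
  under eq_bigr do rewrite ev_deriv_word_cons.
  by rewrite big_split /= -!mulr_sumr.
by rewrite !F IH [X in X + _ = _]addrC.
Qed.

End polynomial_lists.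

(** * Power series *)

Section series.
Context {R : realType} {d : nat}.
Implicit Types (x v : 'rV[R]_d) (p : seq (R * seq 'I_d)) (rho M : R)
  (sigma tau : nat -> seq (R * seq 'I_d)) (h g : 'rV[R]_d -> R).

Fixpoint psum sigma n := if n is m.+1 then psum sigma m ++ sigma m else [::].

(** A power series is presented as a sum of polynomials, and a monomial may
    occur in several of them, which makes products and derivatives immediate.
    M bounds the sum of the moduli of all terms at radius rho, and all
    monomials have degree at least q. *)
Definition has_series rho M q sigma h :=
  [/\ forall n, all (fun t => (q <= size t.2)%N) (sigma n),
      forall n, coef_norm rho (psum sigma n) <= M &
      forall x, `|x| <= rho -> (fun n => ev x (psum sigma n)) @ \oo --> h x].

Lemma ev_psum x sigma n : ev x (psum sigma n) = \sum_(i < n) ev x (sigma i).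
Proof.
elim: n => [|n IH] /=; first by rewrite /ev big_nil big_ord0.
by rewrite ev_cat IH big_ord_recr.
Qed.

Lemma coef_norm_psum rho sigma n : coef_norm rho (psum sigma n) = \sum_(i < n) coef_norm rho (sigma i).
Proof.
elim: n => [|n IH] /=; first by rewrite /coef_norm big_nil big_ord0.
by rewrite coef_norm_cat IH big_ord_recr.
Qed.

Lemma series_cvg rho M sigma x : `|x| <= rho ->
  (forall n, coef_norm rho (psum sigma n) <= M) ->
  cvg ((fun n => ev x (psum sigma n)) @ \oo).
Proof.
move=> xr bM; have r0 : 0 <= rho := le_trans (normr_ge0 _) xr.
have -> : (fun n => ev x (psum sigma n)) = series (fun n => ev x (sigma n)).
  by apply/funext => n; rewrite ev_psum /series /= big_mkord.
apply: normed_cvg; apply: nondecreasing_is_cvgn.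
  by apply: nondecreasing_series => n _ /=; rewrite normr_ge0.
exists M => _ [n _ <-]; rewrite /= seriesEord /=.
apply: le_trans (bM n); rewrite coef_norm_psum; apply: ler_sum => i _.
exact: ev_le.
Qed.

Lemma cvg_norm_le (u : nat -> R) l c :
  u @ \oo --> l -> (forall n, `|u n| <= c) -> `|l| <= c.
Proof.
move=> ul uc; have nul : (fun n => `|u n|) @ \oo --> `|l| by exact: cvg_norm.
rewrite -(cvg_lim (@Rhausdorff R) nul); apply: limr_le; first by apply/cvg_ex; exists `|l|.
by apply: nearW => n.
Qed.

Lemma series_norm_le rho M q sigma h x : has_series rho M q sigma h ->
  `|x| <= rho -> `|h x| <= M.
Proof.
move=> [_ bM hx] xr; apply: (cvg_norm_le (hx x xr)) => n.
exact: le_trans (ev_le _ xr) (bM n).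
Qed.

Lemma all_psum (P : pred (R * seq 'I_d)) sigma n :
  (forall n, all P (sigma n)) -> all P (psum sigma n).
Proof. by move=> aP; elim: n => [//|n IH] /=; rewrite all_cat IH aP. Qed.

Lemma series_order_le rho M q sigma h x : 0 < rho -> has_series rho M q sigma h ->
  `|x| <= rho -> `|h x| <= M / rho ^+ q * `|x| ^+ q.
Proof.
move=> r0 [aq bM hx] xr; apply: (cvg_norm_le (hx x xr)) => n.
apply: le_trans (ev_le _ (lexx `|x|)) _.
rewrite mulrAC ler_pdivlMr ?exprn_gt0// mulrC.
have := ler_wpM2r (exprn_ge0 q (normr_ge0 x)) (bM n); apply: le_trans.
rewrite /coef_norm mulr_suml mulr_sumr !big_seq; apply: ler_sum => t tn.
have /allP/(_ t tn) qt := all_psum n aq.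
rewrite -(subnKC qt) !exprD.
set a := rho ^+ q; set b := `|x| ^+ q; set k := (_ - _)%N.
have -> : a * (`|t.1| * (b * `|x| ^+ k)) = `|t.1| * a * b * `|x| ^+ k by ring.
have -> : `|t.1| * (a * rho ^+ k) * b = `|t.1| * a * b * rho ^+ k by ring.
rewrite ler_wpM2l ?mulr_ge0 ?exprn_ge0// ?(ltW r0)//.
by apply: lerXn2r; rewrite ?nnegrE ?(ltW r0).
Qed.

Lemma has_series_le rho M q sigma h rho' : 0 <= rho' <= rho ->
  has_series rho M q sigma h -> has_series rho' M q sigma h.
Proof.
move=> /andP[r0 rr] [aq bM hx]; split => // [n|x xr].
  exact: le_trans (coef_norm_le _ r0 rr) (bM n).
by apply: hx; exact: le_trans rr.
Qed.

Lemma series0 rho M q sigma h : 0 <= rho -> (0 < q)%N ->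
  has_series rho M q sigma h -> h 0 = 0.
Proof.
move=> r0 q0 [aq _ /(_ 0)]; rewrite normr0 => /(_ r0) h0.
suff : (fun n => ev (0 : 'rV[R]_d) (psum sigma n)) = fun=> 0.
  by move=> E; rewrite E in h0; apply: (cvg_unique (@Rhausdorff R) h0); exact: cvg_cst.
apply/funext => n; rewrite /ev big_seq big1// => t tn.
have /allP/(_ t tn) := all_psum n aq.
case: (t.2) => [|k w] /=; first by rewrite leqn0 => /eqP q00; rewrite q00 in q0.
by rewrite ev_word_cons mxE mul0r mulr0.
Qed.

Definition addser sigma tau n := sigma n ++ tau n.
(** Increments of the products of the partial sums, so that no convolution of
    coefficients appears. *)
Definition mulser sigma tau n :=
  mul_poly (sigma n) (psum tau n.+1) ++ mul_poly (psum sigma n) (tau n).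
Definition derivser i sigma n := deriv_poly i (sigma n).
Definition cser p n : seq (R * seq 'I_d) := if n is 0%N then p else [::].

Lemma ev_psum_add x sigma tau n :
  ev x (psum (addser sigma tau) n) = ev x (psum sigma n) + ev x (psum tau n).
Proof. by rewrite !ev_psum -big_split; apply: eq_bigr => i _; rewrite ev_cat. Qed.

Lemma coef_norm_psum_add rho sigma tau n :
  coef_norm rho (psum (addser sigma tau) n) = coef_norm rho (psum sigma n) + coef_norm rho (psum tau n).
Proof. by rewrite !coef_norm_psum -big_split; apply: eq_bigr => i _; rewrite coef_norm_cat. Qed.

Lemma ev_psum_mul x sigma tau n :
  ev x (psum (mulser sigma tau) n) = ev x (psum sigma n) * ev x (psum tau n).
Proof.
elim: n => [|n IH]; first by rewrite /= /ev big_nil mul0r.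
rewrite [psum (mulser _ _) _]/= ev_cat IH /mulser ev_cat !ev_mul_poly /= !ev_cat; ring.
Qed.

Lemma coef_norm_psum_mul rho sigma tau n :
  coef_norm rho (psum (mulser sigma tau) n) = coef_norm rho (psum sigma n) * coef_norm rho (psum tau n).
Proof.
elim: n => [|n IH]; first by rewrite /= /coef_norm big_nil mul0r.
rewrite [psum (mulser _ _) _]/= coef_norm_cat IH /mulser coef_norm_cat !coef_norm_mul_poly /= !coef_norm_cat; ring.
Qed.

Lemma psum_d i sigma n : psum (derivser i sigma) n = deriv_poly i (psum sigma n).
Proof. by elim: n => [//|n IH] /=; rewrite IH deriv_poly_cat. Qed.

Lemma psum_c p n : psum (cser p) n.+1 = p.
Proof. by elim: n => [//|n IH]; rewrite -[RHS]IH /= cats0. Qed.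

Lemma has_series_c rho p q : 0 <= rho -> all (fun t => (q <= size t.2)%N) p ->
  has_series rho (coef_norm rho p) q (cser p) (fun x => ev x p).
Proof.
move=> r0 ap; split => [[|n]//|[|n]|x xr].
- by rewrite /= {1}/coef_norm big_nil coef_norm_ge0.
- by rewrite psum_c.
- by apply: cvg_near_cst; exists 1%N => // -[//|n] _ /=; rewrite -[in RHS](psum_c p n).
Qed.

Lemma has_series_add rho M M' q q' sigma tau h g : 
  has_series rho M q sigma h -> has_series rho M' q' tau g ->
  has_series rho (M + M') (minn q q') (addser sigma tau) (fun x => h x + g x).
Proof.
move=> [aq bM hx] [aq' bM' gx]; split => [n|n|x xr].
- rewrite all_cat; apply/andP; split; apply/allP => t tn.
    by rewrite geq_min (allP (aq n) _ tn).
  by rewrite geq_min (allP (aq' n) _ tn) orbT.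
- by rewrite coef_norm_psum_add lerD.
- under eq_fun do rewrite ev_psum_add.
  by apply: cvgD; [exact: hx|exact: gx].
Qed.

Lemma has_series_mul rho M M' q q' sigma tau h g : 0 <= rho ->
  has_series rho M q sigma h -> has_series rho M' q' tau g ->
  has_series rho (M * M') (q + q') (mulser sigma tau) (fun x => h x * g x).
Proof.
move=> r0 [aq bM hx] [aq' bM' gx]; split => [n|n|x xr].
- rewrite /mulser; have aqs := fun n => all_psum n aq; have aqt := fun n => all_psum n aq'.
  rewrite all_cat; apply/andP; split; apply/allP => t /allpairsP[[a b] /= [ta tb ->]] /=;
    rewrite size_cat leq_add//.
  + exact: (allP (aq n) _ ta).
  + exact: (allP (aqt n.+1) _ tb).
  + exact: (allP (aqs n) _ ta).
  + exact: (allP (aq' n) _ tb).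
- by rewrite coef_norm_psum_mul ler_pM// coef_norm_ge0.
- under eq_fun do rewrite ev_psum_mul.
  by apply: cvgM; [exact: hx|exact: gx].
Qed.

Lemma has_series_ext rho M q sigma h g : (forall x, `|x| <= rho -> h x = g x) ->
  has_series rho M q sigma h -> has_series rho M q sigma g.
Proof. by move=> hg [a b c]; split => // x xr; rewrite -hg//; exact: c. Qed.

End series.

(** * Differentiation of power series *)

Lemma cvg_sum_ord {R : realType} {T : Type} {F : set_system T} {FF : Filter F} n
    (f : 'I_n -> T -> R) (l : 'I_n -> R) : (forall i, f i x @[x --> F] --> l i) ->
  (fun x => \sum_(i < n) f i x) @ F --> \sum_(i < n) l i.
Proof.
elim: n f l => [|n IH] f l fl.
  by under eq_fun do rewrite big_ord0; rewrite big_ord0; exact: cvg_cst.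
under eq_fun do rewrite big_ord_recr; rewrite big_ord_recr /=.
by apply: cvgD; [apply: IH|].
Qed.

Section differential.
Context {R : realType} {d : nat}.
Implicit Types (x v : 'rV[R]_d) (f h g : 'rV[R]_d -> R).

Definition lin_row (k : 'I_d -> R) v : R := \sum_i v 0 i * k i.

Lemma lin_row_linear k : linear (lin_row k).
Proof.
move=> a u v; rewrite /lin_row scaler_sumr -big_split; apply: eq_bigr => i _.
by rewrite !mxE mulrDl scalerAl.
Qed.

HB.instance Definition _ k :=
  GRing.isLinear.Build R 'rV[R]_d R _ (lin_row k) (lin_row_linear k).

Lemma lin_row_continuous k : continuous (lin_row k).
Proof.
move=> v; rewrite /lin_row.
apply: (@cvg_sum_ord R _ (nbhs v) _ d (fun i v => v 0 i * k i)) => i.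
by apply: cvgMr_tmp; exact: coord_continuous.
Qed.

(** A quadratic remainder identifies the differential. *)
Lemma diff_quadratic f k x C e : 0 < e ->
  (forall v, `|v| <= e -> `|f (x + v) - f x - lin_row k v| <= C * `|v| ^+ 2) ->
  differentiable f x /\ 'd f x = lin_row k :> ('rV[R]_d -> R).
Proof.
move=> e0 fC; pose C' := `|C| + 1; have C0 : 0 < C' by rewrite ltr_wpDl.
have H : f \o shift x = cst (f x) + lin_row k +o_ (nbhs (0 : 'rV[R]_d)) id.
  apply/eqaddoP => eps eps0; near=> v.
  rewrite !fctE /= opprD addrA [v + x]addrC.
  have ve : `|v| <= e.
    near: v; apply/nbhs_ballP; exists e => //= v; rewrite -ball_normE /= sub0r normrN.
    exact: ltW.
  apply: le_trans (fC v ve) _; rewrite expr2 mulrA ler_wpM2r//.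
  have vC : `|v| <= eps / C'.
    near: v; apply/nbhs_ballP; exists (eps / C') => /=; first by rewrite divr_gt0.
    by move=> v; rewrite -ball_normE /= sub0r normrN; exact: ltW.
  rewrite ler_pdivlMr// mulrC in vC; apply: le_trans vC; rewrite ler_wpM2r//.
  by rewrite /C' (le_trans (ler_norm C))// lerDl.
have dE := diff_unique (@lin_row_continuous k) H.
by split => //; apply/diff_locallyP; rewrite dE; split => //; exact: lin_row_continuous.
Unshelve. all: by end_near. Qed.

Lemma diff_lin_row k x :
  differentiable (lin_row k) x /\ 'd (lin_row k) x = lin_row k :> ('rV[R]_d -> R).
Proof.
apply: (@diff_quadratic _ _ _ 0 1) => // v _.
by rewrite linearD /= addrAC addrK subrr normr0 mul0r.
Qed.

(** The partial derivative is cut off outside the ball of radius r on which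
    the series are studied, so that identities between operators are
    equalities of functions. *)
Definition pd (r : R) (i : 'I_d) h x : R :=
  if `|x| < r then 'd h x (delta_mx 0 i) else 0.

Lemma lin_row_delta k i : lin_row k (delta_mx 0 i) = k i.
Proof.
rewrite /lin_row (bigD1 i)//= big1 ?addr0 ?mxE ?eqxx ?mul1r// => j ji.
by rewrite mxE eqxx (negbTE ji) mul0r.
Qed.

Lemma coord_lin_row i : (fun x : 'rV[R]_d => x 0 i) = lin_row (fun j => (j == i)%:R).
Proof.
apply/funext => x; rewrite /lin_row (bigD1 i)//= eqxx mulr1 big1 ?addr0// => k /negbTE ->.
by rewrite mulr0.
Qed.

(** The Taylor estimate of the partial sums involves their coefficient norms
    only; it passes to the limit. *)
Lemma series_taylor rho M q sigma h rho' : has_series rho M q sigma h ->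
  0 <= rho' < rho ->
  exists k : 'rV[R]_d -> 'I_d -> R, forall x, `|x| <= rho' ->
    (forall i, (fun n => ev x (psum (derivser i sigma) n)) @ \oo --> k x i) /\
    (forall v, `|v| <= rho - rho' ->
      `|h (x + v) - h x - lin_row (k x) v| <= (`|v| / (rho - rho')) ^+ 2 * M).
Proof.
move=> [aq bM hx] /andP[r0 rr].
pose k x i := lim ((fun n => ev x (psum (derivser i sigma) n)) @ \oo).
have kc x i : `|x| <= rho' -> (fun n => ev x (psum (derivser i sigma) n)) @ \oo --> k x i.
  move=> xr; apply: (@series_cvg _ _ rho' (M / (rho - rho'))) => // n.
  rewrite psum_d ler_pdivlMr ?subr_gt0//.
  by apply: le_trans (bM n); exact: coef_norm_deriv_poly.
exists k => x xr; split => [i|v ve]; first exact: kc.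
have xvr : `|x + v| <= rho.
  by apply: le_trans (ler_normD _ _) _; lra.
have xr' : `|x| <= rho by rewrite (le_trans xr)// ltW.
apply: (@cvg_norm_le _ (fun n => ev (x + v) (psum sigma n) - ev x (psum sigma n) -
    \sum_i v 0 i * ev x (psum (derivser i sigma) n))).
  apply: cvgB; first by apply: cvgB; exact: hx.
  by apply: cvg_sum_ord => i; apply: cvgMl_tmp; exact: kc.
move=> n; under eq_bigr do rewrite psum_d.
have e0 : 0 < rho - rho' by rewrite subr_gt0.
apply: le_trans (ev_taylor _ e0 xr ve) _; rewrite subrKC ler_wpM2l//.
by rewrite exprn_ge0// divr_ge0// ltW.
Qed.

Lemma series_diff rho M q sigma h rho' x : has_series rho M q sigma h ->
  0 <= rho' < rho -> `|x| <= rho' ->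
  [/\ differentiable h x,
      forall i, (fun n => ev x (psum (derivser i sigma) n)) @ \oo --> 'd h x (delta_mx 0 i) &
      forall v, `|v| <= rho - rho' ->
        `|h (x + v) - h x - 'd h x v| <= (`|v| / (rho - rho')) ^+ 2 * M].
Proof.
move=> hs rr xr; have [k /(_ x xr)[kc kt]] := series_taylor hs rr.
have e0 : 0 < rho - rho' by case/andP: rr => _; rewrite subr_gt0.
have [|df dE] := @diff_quadratic h (k x) x (M / (rho - rho') ^+ 2) _ e0.
  by move=> v /kt /le_trans; apply; rewrite expr_div_n -mulrA mulrC [_^-1 * M]mulrC.
by split => // [i|v]; rewrite dE ?lin_row_delta//; exact: kt.
Qed.

(** Cauchy estimate: the derivative is bounded on a smaller ball. *)
Lemma has_series_d r rho M q sigma h rho' i : has_series rho M q sigma h ->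
  0 <= rho' < rho -> rho' < r ->
  has_series rho' (M / (rho - rho')) q.-1 (derivser i sigma) (pd r i h).
Proof.
move=> hs rr r'r; have [r0 r1] := andP rr; have [aq bM hx] := hs.
split => [n|n|x xr].
- apply/allP => -[c w] /flattenP[_ /mapP[[c' w'] tn ->]] /mapP[z zd [_ ->]] /=.
  by have := allP (aq n) _ tn; rewrite /= -(size_deriv_word zd); case: (q).
- rewrite psum_d ler_pdivlMr ?subr_gt0//.
  by apply: le_trans (bM n); exact: coef_norm_deriv_poly.
- have [_ + _] := series_diff hs rr xr.
  by rewrite /pd (le_lt_trans xr).
Qed.

End differential.

(** * Functions analytic on a ball *)

Section analytic.
Context {R : realType} {d : nat}.
Variable r : R.
Hypothesis r0 : 0 < r.
Implicit Types (x v : 'rV[R]_d) (h g : 'rV[R]_d -> R) (i j : 'I_d).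

(** One and the same series serves all radii below r; q is a lower bound for
    the order of vanishing at the origin, so that analytic 0 is plain
    analyticity. *)
Definition analytic (q : nat) h := exists sigma, forall rho, 0 < rho < r ->
  exists M, has_series rho M q sigma h.

Lemma analytic_ext q h g : (forall x, `|x| < r -> h x = g x) -> analytic q h -> analytic q g.
Proof.
move=> hg [s hs]; exists s => rho rr; have [M hM] := hs rho rr; exists M.
by apply: has_series_ext hM => x xr; apply: hg; apply: le_lt_trans xr _; case/andP: rr.
Qed.

Lemma analytic_weak q q' h : (q' <= q)%N -> analytic q h -> analytic q' h.
Proof.
move=> qq [s hs]; exists s => rho rr; have [M [a b c]] := hs rho rr; exists M; split => // n.
by apply/allP => t tn; exact: leq_trans (allP (a n) _ tn).
Qed.

Lemma analytic_poly q (p : seq (R * seq 'I_d)) : all (fun t => (q <= size t.2)%N) p ->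
  analytic q (fun x => ev x p).
Proof.
move=> ap; exists (cser p) => rho /andP[rho0 _]; exists (coef_norm rho p).
by apply: has_series_c => //; exact: ltW.
Qed.

Lemma analytic_cst (a : R) : analytic 0 (cst a).
Proof.
apply: analytic_ext (@analytic_poly 0%N [:: (a, [::])] _) => // x _.
by rewrite /ev big_seq1 /ev_word big_nil mulr1.
Qed.

Lemma analytic_coord i : analytic 1 (fun x => x 0 i).
Proof.
apply: analytic_ext (@analytic_poly 1%N [:: (1, [:: i])] _) => // x _.
by rewrite /ev big_seq1 /ev_word big_seq1 mul1r.
Qed.

Lemma analytic_add q h g : analytic q h -> analytic q g -> analytic q (h + g).
Proof.
move=> [s hs] [t gs]; exists (addser s t) => rho rr.
have [M hM] := hs rho rr; have [M' gM] := gs rho rr; exists (M + M').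
by have := has_series_add hM gM; rewrite minnn.
Qed.

Lemma analytic_mul q q' h g : analytic q h -> analytic q' g -> analytic (q + q') (h * g).
Proof.
move=> [s hs] [t gs]; exists (mulser s t) => rho rr.
have [M hM] := hs rho rr; have [M' gM] := gs rho rr; exists (M * M').
by have := has_series_mul _ hM gM; apply; case/andP: rr => /ltW.
Qed.

Lemma analytic_scale q (a : R) h : analytic q h -> analytic q (a *: h).
Proof. by move=> hq; exact: (analytic_mul (analytic_cst a) hq). Qed.

Lemma analytic_opp q h : analytic q h -> analytic q (- h).
Proof. by move=> hq; rewrite -scaleN1r; exact: analytic_scale. Qed.

Lemma analytic_sub q h g : analytic q h -> analytic q g -> analytic q (h - g).
Proof. by move=> hq gq; apply: analytic_add => //; exact: analytic_opp. Qed.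

Lemma analytic0 q : analytic q 0.
Proof.
apply: analytic_ext (@analytic_poly q [::] _) => // x _.
by rewrite /ev big_nil.
Qed.

Lemma analytic_sum q (I : Type) (s : seq I) (P : pred I) (F : I -> 'rV[R]_d -> R) :
  (forall k, P k -> analytic q (F k)) -> analytic q (\sum_(k <- s | P k) F k).
Proof. by move=> Fq; apply: big_ind; [exact: analytic0|move=> a b; exact: analytic_add|exact: Fq]. Qed.

Lemma analytic_pd q i h : analytic q h -> analytic q.-1 (pd r i h).
Proof.
move=> [s hs]; exists (derivser i s) => rho /andP[rho0 rhor].
have [|M hM] := hs ((rho + r) / 2); first by lra.
exists (M / ((rho + r) / 2 - rho)); apply: has_series_d => //; lra.
Qed.

Lemma analytic_diff q h x : analytic q h -> `|x| < r -> differentiable h x.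
Proof.
move=> [s hs] xr; have [|M hM] := hs ((`|x| + r) / 2).
  by have := normr_ge0 x; lra.
have [||//] := @series_diff _ _ _ _ _ _ _ `|x| x hM => //.
by have := normr_ge0 x; lra.
Qed.

Lemma analytic_at0 q h : (0 < q)%N -> analytic q h -> h 0 = 0.
Proof.
move=> q0 [s hs]; have [|M hM] := hs (r / 2); first by have := r0; lra.
by apply: (series0 _ q0 hM); rewrite divr_ge0 // ltW.
Qed.

Lemma analytic_order q h rho : analytic q h -> 0 < rho < r ->
  exists2 C, 0 <= C & forall x, `|x| <= rho -> `|h x| <= C * `|x| ^+ q.
Proof.
move=> [s hs] rr; have [M hM] := hs rho rr; have rho0 : 0 < rho by case/andP: rr.
exists (M / rho ^+ q) => [|x xr]; last exact: series_order_le hM xr.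
rewrite divr_ge0 ?exprn_ge0 ?(ltW rho0)//.
by apply: le_trans (series_norm_le (x := 0) hM _) => //; rewrite normr0 ltW.
Qed.

Lemma diff_pd q h x v : analytic q h -> `|x| < r ->
  'd h x v = lin_row (fun i => pd r i h x) v.
Proof.
move=> hq xr; rewrite [v in LHS]row_sum_delta linear_sum; apply: eq_bigr => i _.
by rewrite linearZ /= /pd xr.
Qed.

(** For small v this is the Taylor estimate on a larger ball; for large v the
    three terms are bounded separately and |v| / e >= 1. *)
Lemma analytic_taylor q h rho : analytic q h -> 0 < rho < r ->
  exists2 C, 0 <= C & forall x v, `|x| <= rho -> `|x + v| <= rho ->
    `|h (x + v) - h x - lin_row (fun i => pd r i h x) v| <= C * `|v| ^+ 2.
Proof.
move=> ha rr; have [rho0 rhor] := andP rr.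
have [C0 C00 hC0] := analytic_order (analytic_weak (leq0n q) ha) rr.
have Ci i := analytic_order (analytic_weak (leq0n _) (analytic_pd i ha)) rr.
pose K i := sval (cid2 (Ci i)).
have K0 i : 0 <= K i by rewrite /K; case: (cid2 (Ci i)).
have hK i x : `|x| <= rho -> `|pd r i h x| <= K i.
  rewrite /K; case: (cid2 (Ci i)) => /= c c0 hB xr; by have := hB x xr; rewrite expr0 mulr1.
have [s hs] := ha; have [|M hM] := hs ((rho + r) / 2); first by lra.
have M0 : 0 <= M.
  by apply: le_trans (series_norm_le (x := 0) hM _) => //; rewrite normr0; lra.
pose e := (rho + r) / 2 - rho; have e0 : 0 < e by rewrite /e; lra.
pose S := \sum_i K i; have S0 : 0 <= S by exact: sumr_ge0.
exists (M / e ^+ 2 + (2 * C0 / e ^+ 2 + S / e)) => [|x v xr xvr].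
  by rewrite !addr_ge0// divr_ge0 ?exprn_ge0 ?mulr_ge0 ?(ltW e0)//.
have [ve|ve] := leP `|v| e.
  have [||_ _ /(_ v ve)] := @series_diff _ _ _ _ _ _ _ rho x hM => //; first by lra.
  rewrite -/e (diff_pd _ ha (le_lt_trans xr rhor)) => /le_trans; apply.
  rewrite expr_div_n mulrDl mulrAC [`|v| ^+ 2 * M]mulrC mulrAC lerDl mulr_ge0 ?exprn_ge0//.
  by rewrite addr_ge0// divr_ge0 ?exprn_ge0 ?mulr_ge0 ?(ltW e0)//.
have h1 : `|h (x + v) - h x| <= 2 * C0.
  rewrite (le_trans (ler_normB _ _))//.
  have := hC0 _ xr; have := hC0 _ xvr; rewrite !expr0; lra.
have h2 : `|lin_row (fun i => pd r i h x) v| <= S * `|v|.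
  rewrite /lin_row (le_trans (ler_norm_sum _ _ _))// /S mulr_suml ler_sum// => i _.
  by rewrite normrM mulrC ler_pM ?le_coord ?hK.
have h3 : 1 <= `|v| / e by rewrite ler_pdivlMr// mul1r ltW.
have h4 : 1 <= (`|v| / e) ^+ 2 by exact: exprn_ege1.
have h5 : 2 * C0 <= 2 * C0 / e ^+ 2 * `|v| ^+ 2.
  by rewrite -mulrA ler_peMr ?mulr_ge0// mulrC -expr_div_n.
have h6 : S * `|v| <= S / e * `|v| ^+ 2.
  rewrite -mulrA ler_wpM2l// expr2 mulrA ler_peMl//.
  by rewrite mulrC.
have h7 : 0 <= M / e ^+ 2 * `|v| ^+ 2.
  by rewrite mulr_ge0 ?exprn_ge0// divr_ge0// exprn_ge0// ltW.
by apply: le_trans (ler_normB _ _) _; rewrite !mulrDl; lra.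
Qed.

End analytic.

Lemma analytic_radius {R : realType} {d : nat} (r r' : R) q (h : 'rV[R]_d -> R) :
  r' <= r -> analytic r q h -> analytic r' q h.
Proof.
move=> rr [s hs]; exists s => rho /andP[rho0 rho1]; apply: hs.
by rewrite rho0 (lt_le_trans rho1).
Qed.

(** * Lie derivatives *)

Section operators.
Context {R : realType} {d : nat}.
Variable r : R.
Hypothesis r0 : 0 < r.
Implicit Types (x v : 'rV[R]_d) (h g : 'rV[R]_d -> R) (i j : 'I_d).
Implicit Types f e : 'rV[R]_d -> 'rV[R]_d.
Local Notation analytic := (analytic r).
Local Notation pd := (pd r).

Lemma pd_in i h x : `|x| < r -> pd i h x = 'd h x (delta_mx 0 i).
Proof. by rewrite /pd => ->. Qed.

Lemma pd_out i h x : r <= `|x| -> pd i h x = 0.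
Proof. by rewrite /pd ltNge => ->. Qed.

Lemma pd_add i h g : analytic 0 h -> analytic 0 g -> pd i (h + g) = pd i h + pd i g.
Proof.
move=> ha ga; apply/funext => x; rewrite -[RHS]/(pd i h x + pd i g x).
have [xr|xr] := ltP `|x| r; last by rewrite !pd_out// (addr0 0).
rewrite (pd_in i (h + g) xr) (pd_in i h xr) (pd_in i g xr).
exact: (congr1 (fun L : 'rV[R]_d -> R => L (delta_mx 0 i))
  (diffD (analytic_diff ha xr) (analytic_diff ga xr))).
Qed.

Lemma pd_mul i h g : analytic 0 h -> analytic 0 g -> pd i (h * g) = h * pd i g + pd i h * g.
Proof.
move=> ha ga; apply/funext => x; rewrite -[RHS]/(h x * pd i g x + pd i h x * g x).
have [xr|xr] := ltP `|x| r; last by rewrite !pd_out// mulr0 mul0r addr0.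
rewrite (pd_in i (h * g) xr) (pd_in i h xr) (pd_in i g xr).
have E := congr1 (fun L : 'rV[R]_d -> R => L (delta_mx 0 i))
  (diffM (analytic_diff ha xr) (analytic_diff ga xr)).
exact: etrans E (congr1 (fun y => _ + y) (mulrC _ _)).
Qed.

Lemma pd_cst i (a : R) : pd i (cst a) = 0.
Proof. by apply/funext => x; rewrite /pd; case: ifP => // _; rewrite diff_cst. Qed.

Lemma pd_scale i (a : R) h : analytic 0 h -> pd i (a *: h) = a *: pd i h.
Proof.
move=> ha; have -> : a *: h = cst a * h by [].
rewrite pd_mul//; last exact: analytic_cst.
by rewrite pd_cst mul0r addr0.
Qed.

Lemma pd_coord i j : pd i (fun x => x 0 j) = fun x => if `|x| < r then (i == j)%:R else 0.
Proof.
apply/funext => x; rewrite /pd (coord_lin_row j); case: ifP => // xr.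
by rewrite (diff_lin_row _ x).2 lin_row_delta.
Qed.

(** Both mixed derivatives are limits of the same polynomials. *)
Lemma pdC i j h : analytic 0 h -> pd i (pd j h) = pd j (pd i h).
Proof.
move=> [s hs]; apply/funext => x; rewrite {1 3}/pd; case: ifP => // xr.
have r1 := r0; have x0 := normr_ge0 x.
pose a := (`|x| + r) / 2; pose b := (a + r) / 2; pose c := (b + r) / 2.
have [|M hM] := hs c; first by rewrite /c /b /a; lra.
have H k : has_series b (M / (c - b)) 0 (derivser k s) (pd k h).
  by apply: (has_series_d _ hM); rewrite /c /b /a; lra.
have F k l : (fun n => ev x (deriv_poly l (deriv_poly k (psum s n)))) @ \oo --> 'd (pd k h) x (delta_mx 0 l).
  have [||_ + _] := series_diff (H k) (rho' := a) (x := x); rewrite /b /a; [lra|lra|].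
  by move=> /(_ l); under eq_fun do rewrite !psum_d.
have := F j i; under eq_fun do rewrite ev_deriv_polyC.
by move/(cvg_unique (@Rhausdorff R)); apply; exact: F.
Qed.

Definition coordf f i : 'rV[R]_d -> R := fun x => f x 0 i.
Definition vanalytic f := forall i, analytic 0 (coordf f i).

Definition lie f h : 'rV[R]_d -> R := \sum_i coordf f i * pd i h.

Lemma lieE f h x : lie f h x = lin_row (fun i => pd i h x) (f x).
Proof. by rewrite /lie /lin_row fct_sumE. Qed.

Lemma analytic_lie q f h : vanalytic f -> analytic q h -> analytic q.-1 (lie f h).
Proof.
move=> fa ha; apply: analytic_sum => i _.
exact: analytic_mul (fa i) (analytic_pd i ha).
Qed.

Lemma analytic_lie0 f h : vanalytic f -> analytic 0 h -> analytic 0 (lie f h).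
Proof. by move=> fa ha; exact: (@analytic_lie 0). Qed.

Lemma analytic_lie1 q f h : (forall i, analytic 1 (coordf f i)) ->
  analytic q h -> analytic q (lie f h).
Proof.
move=> fa ha; apply: analytic_sum => i _.
apply: analytic_weak (analytic_mul (fa i) (analytic_pd i ha)).
by rewrite add1n leqSpred.
Qed.

Lemma lie_add f h g : analytic 0 h -> analytic 0 g -> lie f (h + g) = lie f h + lie f g.
Proof.
move=> ha ga; rewrite /lie -big_split; apply: eq_bigr => i _.
by rewrite pd_add// mulrDr.
Qed.

Lemma lie_scale f (a : R) h : analytic 0 h -> lie f (a *: h) = a *: lie f h.
Proof.
move=> ha; rewrite /lie scaler_sumr; apply: eq_bigr => i _.
by rewrite pd_scale//; apply/funext => x; rewrite !fctE /GRing.scale /= mulrCA.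
Qed.

Lemma lie0 f : lie f 0 = 0.
Proof.
have -> : (0 : 'rV[R]_d -> R) = cst 0 by [].
by rewrite /lie big1// => i _; rewrite pd_cst mulr0.
Qed.

Lemma lie_sum f (I : Type) (s : seq I) (P : pred I) (F : I -> 'rV[R]_d -> R) :
  (forall k, P k -> analytic 0 (F k)) ->
  lie f (\sum_(k <- s | P k) F k) = \sum_(k <- s | P k) lie f (F k).
Proof.
move=> Fa; elim: s => [|k s IH]; first by rewrite !big_nil lie0.
rewrite !big_cons; case: ifP => // Pk.
by rewrite lie_add ?IH//; [exact: Fa|exact: analytic_sum].
Qed.

Lemma lie_mul f h g : analytic 0 h -> analytic 0 g ->
  lie f (h * g) = h * lie f g + lie f h * g.
Proof.
move=> ha ga; rewrite /lie mulr_sumr mulr_suml -big_split; apply: eq_bigr => i _ /=.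
by rewrite pd_mul// mulrDr mulrCA [X in _ + X]mulrA.
Qed.

Lemma diff_coord f x v i : vanalytic f -> `|x| < r -> 'd f x v 0 i = lin_row (fun k => pd k (coordf f i) x) v.
Proof.
move=> fa xr.
have E : f = \sum_k (fun x => coordf f k x *: (delta_mx 0 k : 'rV[R]_d)).
  by apply/funext => y; rewrite fct_sumE [LHS]row_sum_delta.
have fd : differentiable f x.
  rewrite E; apply: differentiable_sum => k; apply: differentiableZl.
  exact: (analytic_diff (fa k)).
rewrite -(diff_pd v (fa i) xr) /coordf -[fun x => f x 0 i]/((fun y : 'rV[R]_d => y 0 i) \o f).
have [yd yE] := diff_lin_row (fun j => (j == i)%:R) (f x).
have E2 := congr1 (fun L : 'rV[R]_d -> R => L v) (diff_comp fd yd).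
rewrite (coord_lin_row i) (etrans E2 (congr1 (fun L : 'rV[R]_d -> R => L ('d f x v)) yE)).
exact: (congr1 (fun L : 'rV[R]_d -> R => L ('d f x v)) (coord_lin_row i)).
Qed.

Lemma lie_bracketE f e x i : vanalytic f -> vanalytic e -> `|x| < r ->
  coordf (lie_bracket f e) i x = (lie f (coordf e i) - lie e (coordf f i)) x.
Proof.
move=> fa ea xr.
have H (a b : 'rV[R]_d) : (a - b) 0 i = a 0 i - b 0 i by rewrite !mxE.
have E1 := etrans (diff_coord (f x) i ea xr) (esym (lieE f (coordf e i) x)).
have E2 := etrans (diff_coord (e x) i fa xr) (esym (lieE e (coordf f i) x)).
exact: etrans (H _ _) (f_equal2 (fun a b => a - b) E1 E2).
Qed.

Lemma vanalytic_bracket f e : vanalytic f -> vanalytic e -> vanalytic (lie_bracket f e).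
Proof.
move=> fa ea i.
apply: (@analytic_ext _ _ _ _ (lie f (coordf e i) - lie e (coordf f i))).
  by move=> x xr; rewrite lie_bracketE.
by apply: analytic_sub => //; exact: analytic_lie0.
Qed.

(** The second derivatives of h cancel by symmetry. *)
Lemma lie_comm f e h : vanalytic f -> vanalytic e -> analytic 0 h ->
  lie (lie_bracket f e) h = lie f (lie e h) - lie e (lie f h).
Proof.
move=> fa ea ha; have pa i : analytic 0 (pd i h) by exact: (@analytic_pd _ _ _ 0).
have E a b : vanalytic b -> lie a (lie b h) =
    \sum_i lie a (coordf b i) * pd i h + \sum_i coordf b i * \sum_j coordf a j * pd j (pd i h).
  move=> ba; rewrite [lie b h]/lie lie_sum => [|i _]; last exact: analytic_mul (ba i) (pa i).
  by rewrite addrC -big_split; apply: eq_bigr => i _; rewrite lie_mul.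
have C : \sum_i coordf e i * (\sum_j coordf f j * pd j (pd i h)) =
   \sum_i coordf f i * (\sum_j coordf e j * pd j (pd i h)).
  under eq_bigr do rewrite mulr_sumr.
  rewrite exchange_big; apply: eq_bigr => i _; rewrite mulr_sumr; apply: eq_bigr => j _.
  by rewrite pdC//; ring.
rewrite (E f e ea) (E e f fa) C.
have Z (V : zmodType) (a b c : V) : a + c - (b + c) = a - b.
  by rewrite opprD addrACA subrr addr0.
rewrite Z -sumrB; apply: eq_bigr => i _; rewrite -mulrBl; apply/funext => x.
rewrite -[RHS]/((lie f (coordf e i) - lie e (coordf f i)) x * pd i h x).
rewrite -[LHS]/(coordf (lie_bracket f e) i x * pd i h x).
have [xr|xr] := ltP `|x| r; first by rewrite lie_bracketE.
by rewrite (pd_out i h xr) !mulr0.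
Qed.

End operators.

(** * Real-analytic functions and their jets *)

Section from_power_series.
Context {R : realType} {d : nat}.
Implicit Types (alpha : {ffun 'I_d -> nat}) (x : 'rV[R]_d).

Definition exponent_word alpha : seq 'I_d := flatten [seq nseq (alpha i) i | i <- enum 'I_d].

Lemma ev_exponent_word x alpha : ev_word x (exponent_word alpha) = monomial x alpha.
Proof.
rewrite /ev_word /exponent_word /monomial big_flatten big_map big_enum /=.
by apply: eq_bigr => i _; rewrite big_nseq iter_mulr mulr1.
Qed.

Definition nat_of_box n (beta : {ffun 'I_d -> 'I_n}) : {ffun 'I_d -> nat} :=
  [ffun i => nat_of_ord (beta i)].

Definition box n : seq {ffun 'I_d -> nat} := [seq nat_of_box beta | beta : {ffun 'I_d -> 'I_n}].

Lemma box_uniq n : uniq (box n).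
Proof.
rewrite map_inj_uniq ?enum_uniq// => b b' /ffunP bb; apply/ffunP => i; apply: val_inj.
by have := bb i; rewrite !ffunE.
Qed.

Lemma mem_box n alpha : (alpha \in box n) = [forall i, (alpha i < n)%N].
Proof.
apply/idP/forallP => [/mapP[b _ ->] i|an]; first by rewrite ffunE.
apply/mapP; exists [ffun i => Ordinal (an i)]; rewrite ?mem_enum//.
by apply/ffunP => i; rewrite !ffunE.
Qed.

(** The multi-indices with largest entry n - 1: summing over shells recovers
    the sums over cubes in which real analyticity is phrased. *)
Definition shell n : seq {ffun 'I_d -> nat} :=
  if n is m.+1 then [seq a <- box n | a \notin box m] else box 0.

Lemma sum_shell (F : {ffun 'I_d -> nat} -> R) n :
  \sum_(k < n.+1) \sum_(a <- shell k) F a = \sum_(a <- box n) F a.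
Proof.
elim: n => [|n IH]; first by rewrite big_ord1.
rewrite big_ord_recr IH /= big_filter [RHS](bigID (fun a => a \in box n)) /=.
congr (_ + _); rewrite -[RHS]big_filter; apply: perm_big; apply: uniq_perm.
- exact: box_uniq.
- by rewrite filter_uniq// box_uniq.
move=> a; rewrite mem_filter; case: (boolP (a \in box n)) => //= an; apply/esym.
move: an; rewrite !mem_box => /forallP an; apply/forallP => i; exact: leqW (an i).
Qed.

Lemma monomial_cst (rho : R) alpha : monomial (const_mx rho) alpha = rho ^+ size (exponent_word alpha).
Proof.
rewrite -ev_exponent_word /ev_word; elim: (exponent_word alpha) => [|k w IH]; first by rewrite big_nil.
by rewrite big_cons IH mxE exprS.
Qed.

(** Absolute summability at the point with all coordinates rho bounds the
    coefficient norms at radius rho. *)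
Lemma real_analytic_analytic (h : 'rV[R]_d -> R) : real_analytic_at h 0 ->
  exists2 r, 0 < r & analytic r 0 h.
Proof.
move=> [c [r [r0 hr]]]; exists r => //.
pose term a : R * seq 'I_d := (c a, exponent_word a).
have E (F : R * seq 'I_d -> R) n : \sum_(i < n.+1) \sum_(t <- [seq term a | a <- shell i]) F t
   = \sum_(a <- box n) F (term a).
  by under eq_bigr do rewrite big_map; exact: sum_shell.
exists (fun n => [seq term a | a <- shell n]) => rho /andP[rho0 rhor].
have cr : `|const_mx rho : 'rV[R]_d| <= rho.
  by apply: le_row => [|k]; rewrite ?(ltW rho0)// mxE gtr0_norm.
have [|sm _] := hr (const_mx rho).
  by rewrite subr0 (le_lt_trans cr).
rewrite subr0 /summable in sm.
set S := esum _ _ in sm *.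
have S0 : (0 <= S)%E by apply: esum_ge0 => a _; exact: abse_ge0.
exists (fine S); split => [n|[|n]|x xr].
- exact/allP.
- by rewrite /= /coef_norm big_nil fine_ge0.
- rewrite coef_norm_psum E -lee_fin fineK ?ge0_fin_numE//.
  apply: esum_ge; exists [set` box n]; first by split; [exact: finite_seq|].
  rewrite -fsbig_seq ?box_uniq// sumEFin lee_fin ler_sum// => a _ /=.
  by rewrite monomial_cst normrM normrX (gtr0_norm rho0).
- rewrite -(cvg_shiftn 1) /=.
  under eq_fun do rewrite addn1 ev_psum E.
  have xr' : `|x - 0| < r by rewrite subr0 (le_lt_trans xr).
  have [_ hx] := hr x xr'; rewrite subr0 in hx.
  apply: cvg_trans hx; apply: near_eq_cvg; near=> n.
  rewrite big_map big_enum; apply: eq_bigr => b _.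
  by rewrite ev_exponent_word.
Unshelve. all: by end_near. Qed.

End from_power_series.

Section jets.
Context {R : realType} {d : nat}.
Variable r : R.
Hypothesis r0 : 0 < r.

Fixpoint words n : seq (seq 'I_d) :=
  if n is m.+1 then [::] :: [seq k :: w | k <- enum 'I_d, w <- words m] else [::].

Lemma mem_words n (w : seq 'I_d) : (w \in words n) = (size w < n)%N.
Proof.
elim: n w => [//|n IH] [|k w] //; rewrite /= inE /= ltnS -IH.
apply/allpairsP/idP => [[[a b] /= [_ wb [_ ->]]]//|wn].
by exists (k, w); split => //=; rewrite mem_enum.
Qed.

Lemma words_uniq n : uniq (words n).
Proof.
elim: n => [//|n IH] /=; rewrite allpairs_uniq ?enum_uniq//; last by move=> [a b] [a' b'] _ _ [-> ->].
by rewrite andbT; apply/allpairsP => -[[a b] /= [_ _]].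
Qed.

(** The remainder is the series formed by the monomials of degree at least n;
    the coefficient of a word sums its occurrences in all the polynomials of
    the series. *)
Lemma analytic_jet n (h : 'rV[R]_d -> R) : analytic r 0 h -> exists c : seq 'I_d -> R,
  analytic r n (h - (fun x => \sum_(w <- words n) c w * ev_word x w)).
Proof.
move=> [s hs].
pose big (t : R * seq 'I_d) := (n <= size t.2)%N.
pose cf w i := \sum_(t <- s i | t.2 == w) t.1.
have cfc w : cvg ((fun m => \sum_(i < m) cf w i) @ \oo).
  have [|M [_ bM _]] := hs (r / 2); first by have := r0; lra.
  have p0 : 0 < (r / 2) ^+ size w by rewrite exprn_gt0// divr_gt0.
  have -> : (fun m => \sum_(i < m) cf w i) = series (cf w).
    by apply/funext => m; rewrite /series /= big_mkord.
  apply: normed_cvg; apply: nondecreasing_is_cvgn.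
    by apply: nondecreasing_series => k _ /=; rewrite normr_ge0.
  exists (M / (r / 2) ^+ size w) => _ [k _ <-]; rewrite /= seriesEord /= ler_pdivlMr//.
  apply: le_trans (bM k); rewrite coef_norm_psum mulr_suml ler_sum// => i _.
  apply: (@le_trans _ _ (\sum_(t <- s i | t.2 == w) `|t.1| * (r / 2) ^+ size t.2)).
    rewrite /cf [leRHS](eq_bigr (fun t : R * seq 'I_d => `|t.1| * (r / 2) ^+ size w)); last first.
      by move=> t /eqP ->.
    by rewrite -mulr_suml ler_wpM2r ?ler_norm_sum// ltW.
  rewrite /coef_norm [leRHS](bigID (fun t => t.2 == w)) /= lerDl sumr_ge0// => t _.
  by rewrite mulr_ge0// exprn_ge0// divr_ge0// ltW.
pose c w := lim ((fun m => \sum_(i < m) cf w i) @ \oo).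
exists c; exists (fun m => [seq t <- s m | big t]) => rho rr; have [M [_ bM hx]] := hs rho rr.
have rho0 : 0 < rho by case/andP: rr.
have small (x : 'rV[R]_d) i : ev x (s i) =
    ev x [seq t <- s i | big t] + \sum_(w <- words n) cf w i * ev_word x w.
  rewrite {1}/ev (bigID big) /= -big_filter; congr (_ + _).
  rewrite big_mkcond /=.
  under [RHS]eq_bigr do rewrite /cf mulr_suml big_mkcond /=.
  rewrite exchange_big; apply: eq_bigr => t _ /=.
  case: (boolP (big t)) => tn /=.
    rewrite big_seq big1// => w; rewrite mem_words; case: eqP => // <-.
    by rewrite ltnNge; move: tn; rewrite /big => ->.
  rewrite (bigD1_seq t.2) ?words_uniq ?mem_words ?ltnNge//= eqxx big1 ?addr0// => w.
  by rewrite eq_sym => /negbTE ->.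
exists M; split => [m|m|x xr].
- by apply/allP => t; rewrite mem_filter => /andP[].
- apply: le_trans (bM m); rewrite !coef_norm_psum ler_sum// => i _.
  rewrite /coef_norm big_filter [leRHS](bigID big) /= lerDl sumr_ge0// => t _.
  by rewrite mulr_ge0// exprn_ge0// ltW.
- have -> : (fun m => ev x (psum (fun m => [seq t <- s m | big t]) m)) =
     (fun m => ev x (psum s m) - \sum_(w <- words n) (\sum_(i < m) cf w i) * ev_word x w).
    apply/funext => m; rewrite !ev_psum; apply/eqP; rewrite eq_sym subr_eq; apply/eqP.
    under eq_bigr do rewrite small; rewrite big_split /=; congr (_ + _).
    by rewrite exchange_big; apply: eq_bigr => w _; rewrite mulr_suml.
  apply: cvgB; first exact: hx.
  elim: (words n) => [|w ws IH].
    by under eq_fun do rewrite big_nil; rewrite big_nil; exact: cvg_cst.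
  under eq_fun do rewrite big_cons; rewrite big_cons.
  by apply: cvgD => //; apply: cvgMr_tmp; exact: cfc.
Qed.

End jets.

Lemma real_analytic_vanalytic {R : realType} {d : nat} (f : 'rV[R]_d -> 'rV[R]_d) :
  (forall i, real_analytic_at (fun x => f x 0 i) 0) -> exists2 r, 0 < r & vanalytic r f.
Proof.
move=> fa; pose rf i := sval (cid2 (real_analytic_analytic (fa i))).
have rf0 i : 0 < rf i by rewrite /rf; case: cid2.
have rfa i : analytic (rf i) 0 (coordf f i) by rewrite /rf; case: cid2.
exists (\big[Num.min/1]_i rf i) => [|i].
  by apply: (big_ind (fun t => 0 < t)) => // a b a0 b0; rewrite lt_min a0.
apply: analytic_radius (rfa i).
exact: bigmin_le.
Qed.

(** * Primitives on a segment *)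

Section primitives.
Context {R : realType}.
Variable T : R.
Implicit Types (f g F G : R -> R) (a b c s : R).
Local Notation mu := (@lebesgue_measure R).

Definition L1 f : Prop := mu.-integrable `[0, T] (EFin \o f).
Definition C0 f := {within `[0, T], continuous f}.

Lemma L1_sub f s : s <= T -> L1 f -> mu.-integrable `[0, s] (EFin \o f).
Proof.
by move=> sT; apply: integrableS => //; apply: subset_itvl; rewrite bnd_simp.
Qed.

Lemma primitive0 f : primitive f 0 = 0.
Proof. by rewrite /primitive set_itv1 Rintegral_set1. Qed.

Lemma L1_add f g : L1 f -> L1 g -> L1 (f + g).
Proof. by move=> fi gi; exact: (integrableD _ fi gi). Qed.

Lemma L1_scale k f : L1 f -> L1 (k *: f).
Proof. by move=> fi; exact: (integrableZl _ k fi). Qed.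

Lemma L1_sub_fun f g : L1 f -> L1 g -> L1 (f - g).
Proof. by move=> fi gi; apply: L1_add => //; rewrite -scaleN1r; exact: L1_scale. Qed.

Lemma L1_norm f : L1 f -> L1 (fun y => `|f y|).
Proof. by move=> fi; exact: integrable_norm. Qed.

Lemma L1_C0 f : C0 f -> L1 f.
Proof. by move=> fc; apply: continuous_compact_integrable => //; exact: segment_compact. Qed.

Lemma L1_mul_C0 f g : L1 f -> C0 g -> L1 (f * g).
Proof.
move=> fi gc; apply: (integrableMl _ fi) => //.
  by apply: subspace_continuous_measurable_fun.
have /compact_bounded[M [_ mrt]] := continuous_compact gc (@segment_compact _ 0 T).
by exists M; split; rewrite ?num_real // => ? ? ? ?; exact: mrt.
Qed.

Lemma C0_cst k : C0 (cst k).
Proof. by move=> x; exact: cvg_cst. Qed.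

Lemma L1_cst k : L1 (cst k).
Proof. by apply: L1_C0; exact: C0_cst. Qed.

Lemma C0_P f : C0 f <-> forall s, 0 <= s <= T -> f @ within `[0, T] (nbhs s) --> f s.
Proof.
split => [/subspace_continuousP fc s sT|fc].
  by apply: fc; rewrite /= in_itv.
by apply/subspace_continuousP => s; rewrite /= in_itv; exact: fc.
Qed.

Lemma C0_add f g : C0 f -> C0 g -> C0 (f + g).
Proof.
move=> /C0_P fc /C0_P gc; apply/C0_P => s sT.
by apply: cvgD; [exact: fc|exact: gc].
Qed.

Lemma C0_mul f g : C0 f -> C0 g -> C0 (f * g).
Proof.
move=> /C0_P fc /C0_P gc; apply/C0_P => s sT.
by apply: cvgM; [exact: fc|exact: gc].
Qed.

Lemma C0_scale k f : C0 f -> C0 (k *: f).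
Proof. by move=> fc; have -> : k *: f = cst k * f by []; apply: C0_mul => //; exact: C0_cst. Qed.

Lemma C0_norm f : C0 f -> C0 (fun y => `|f y|).
Proof. by move=> /C0_P fc; apply/C0_P => s sT; apply: cvg_norm; exact: fc. Qed.

Lemma C0_exp f n : C0 f -> C0 (fun y => f y ^+ n).
Proof.
move=> fc; elim: n => [|n IH]; first exact: C0_cst.
have -> : (fun y => f y ^+ n.+1) = f * (fun y => f y ^+ n).
  by apply/funext => y; rewrite exprS.
exact: C0_mul.
Qed.

Lemma C0_sum (I : Type) (r : seq I) (P : pred I) (F : I -> R -> R) :
  (forall k, P k -> C0 (F k)) -> C0 (\sum_(k <- r | P k) F k).
Proof. by move=> Fc; apply: big_ind; [exact: C0_cst|move=> a b; exact: C0_add|exact: Fc]. Qed.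

Lemma L1_sum (I : Type) (r : seq I) (P : pred I) (F : I -> R -> R) :
  (forall k, P k -> L1 (F k)) -> L1 (\sum_(k <- r | P k) F k).
Proof.
by move=> Fc; apply: big_ind; [exact: L1_cst|move=> a b; exact: L1_add|exact: Fc].
Qed.

Lemma primitive_add f g s : s <= T -> L1 f -> L1 g ->
  primitive (f + g) s = primitive f s + primitive g s.
Proof. by move=> sT fi gi; rewrite /primitive RintegralD//; exact: L1_sub. Qed.

Lemma primitive_scale k f s : s <= T -> L1 f -> primitive (k *: f) s = k * primitive f s.
Proof. by move=> sT fi; rewrite /primitive RintegralZl//; exact: L1_sub. Qed.

Lemma primitive_sub f g s : s <= T -> L1 f -> L1 g ->
  primitive (f - g) s = primitive f s - primitive g s.
Proof.
move=> sT fi gi; rewrite primitive_add//.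
  by rewrite -scaleN1r primitive_scale// mulN1r.
by rewrite -scaleN1r; exact: L1_scale.
Qed.

Lemma primitive_sum (I : Type) (r : seq I) (P : pred I) (F : I -> R -> R) s : s <= T ->
  (forall k, P k -> L1 (F k)) ->
  primitive (\sum_(k <- r | P k) F k) s = \sum_(k <- r | P k) primitive (F k) s.
Proof.
move=> sT Fi; elim: r => [|k r IH].
  rewrite !big_nil -(scale0r (cst (0:R) : R -> R)) primitive_scale ?mul0r//.
  exact: L1_cst.
rewrite !big_cons; case: ifP => // Pk.
by rewrite primitive_add ?IH//; [exact: Fi|exact: L1_sum].
Qed.

Lemma primitive_cst k s : 0 <= s -> primitive (cst k) s = k * s.
Proof.
move=> s0; rewrite /primitive Rintegral_cst//= lebesgue_measure_itv /= lte_fin.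
by move: s0; rewrite le_eqVlt => /orP[/eqP <-|->] /=; rewrite ?ltxx ?mulr0 ?subr0.
Qed.

Lemma primitive_incr f a b : 0 <= a -> a <= b -> b <= T -> L1 f ->
  primitive f b - primitive f a = \int[mu]_(y in `]a, b]) f y.
Proof.
move=> a0 ab bT fi; rewrite /primitive (Rintegral_itvB (a := BLeft 0))//.
exact: L1_sub.
Qed.

Lemma primitive_le f g a b : 0 <= a -> a <= b -> b <= T -> L1 f -> L1 g ->
  (forall y, a <= y <= b -> f y <= g y) ->
  primitive f b - primitive f a <= primitive g b - primitive g a.
Proof.
move=> a0 ab bT fi gi fg; rewrite !primitive_incr//; apply: le_Rintegral => //.
- by apply: integrableS fi => // y /=; rewrite !in_itv /=; lra.
- by apply: integrableS gi => // y /=; rewrite !in_itv /=; lra.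
- by move=> y /=; rewrite in_itv /= => /andP[ay yb]; apply: fg; rewrite ltW.
Qed.

Lemma primitive_norm_le f g a b : 0 <= a -> a <= b -> b <= T -> L1 f -> L1 g ->
  (forall y, a <= y <= b -> `|f y| <= g y) ->
  `|primitive f b - primitive f a| <= primitive g b - primitive g a.
Proof.
move=> a0 ab bT fi gi fg; rewrite ler_norml; apply/andP; split.
  have := @primitive_le (- f) g a b a0 ab bT.
  have E s : s <= T -> primitive (- f) s = - primitive f s.
    by move=> sT; rewrite -scaleN1r primitive_scale// mulN1r.
  rewrite !E//; last lra.
  have fN : L1 (- f) by rewrite -scaleN1r; exact: L1_scale.
  move=> /(_ fN gi) H.
  suff : - primitive f b - - primitive f a <= primitive g b - primitive g a by lra.
  by apply: H => y /fg; rewrite ler_norml => /andP[]; rewrite !fctE; lra.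
by apply: primitive_le => // y /fg; rewrite ler_norml => /andP[].
Qed.

Lemma primitive_C0 f : 0 <= T -> L1 f -> C0 (primitive f).
Proof. by move=> T0 fi; exact: parameterized_integral_continuous. Qed.

(** Bisecting where A takes the middle of its values halves the constant C,
    which is therefore arbitrarily small. This replaces a differentiation
    almost everywhere in the rules of calculus below. *)
Lemma quadratic_increments (A E : R -> R) C : C0 A ->
  (forall a b, 0 <= a -> a <= b -> b <= T -> A a <= A b) ->
  (forall a b, 0 <= a -> a <= b -> b <= T -> `|E b - E a| <= C * (A b - A a) ^+ 2) ->
  forall s, 0 <= s <= T -> E s = E 0.
Proof.
move=> Ac A_nd EA.
have H n : forall a b, 0 <= a -> a <= b -> b <= T ->
    `|E b - E a| <= C / 2 ^+ n * (A b - A a) ^+ 2.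
  elim: n => [|n IH] a b a0 ab bT; first by rewrite expr0 divr1; exact: EA.
  have Aab := A_nd a b a0 ab bT.
  have [||c] := @IVT _ A a b ((A a + A b) / 2) ab.
  - by apply: continuous_subspaceW Ac => y /=; rewrite !in_itv /=; lra.
  - by rewrite min_l// max_r//; lra.
  rewrite in_itv /= => /andP[ac cb] Ac2.
  have -> : E b - E a = (E b - E c) + (E c - E a) by ring.
  apply: le_trans (ler_normD _ _) _.
  apply: le_trans (lerD (IH c b _ cb bT) (IH a c a0 ac _)) _; [lra|lra|].
  rewrite Ac2 [2 ^+ n.+1]exprS.
  have p0 : (2 : R) ^+ n != 0 by rewrite expf_neq0.
  by rewrite le_eqVlt; apply/orP; left; apply/eqP; field.
move=> s /andP[s0 sT]; apply/eqP; rewrite -subr_eq0 -normr_le0.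
apply/ler_addgt0Pr => e e0; rewrite add0r.
pose K := C * (A s - A 0) ^+ 2.
have [n nK] : exists n, `|K| / e < 2 ^+ n.
  exists (Num.bound (`|K| / e)); apply: lt_le_trans (archi_boundP _) _.
    by rewrite divr_ge0// ltW.
  by rewrite -natrX ler_nat ltnW// ltn_expl.
apply: le_trans (H n 0 s (lexx 0) s0 sT) _.
rewrite mulrAC -/K ler_pdivrMr ?exprn_gt0// mulrC.
rewrite ltr_pdivrMr// in nK; rewrite (le_trans (ler_norm K))// ltW//.
Qed.

End primitives.

(** * Absolutely continuous functions and the chain rule *)

Section absolutely_continuous.
Context {R : realType}.
Variable T : R.
Hypothesis T0 : 0 <= T.
Implicit Types (f g F G : R -> R).
Local Notation L1 := (L1 T).
Local Notation C0 := (C0 T).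

(** F is absolutely continuous on [0, T] with derivative f, in integrated
    form. *)
Definition abscont F f := L1 f /\ forall s, 0 <= s <= T -> F s = F 0 + primitive f s.

Lemma abscont_C0 F f : abscont F f -> C0 F.
Proof.
move=> [fi Ff]; apply: (@subspace_eq_continuous _ _ _ (fun s => F 0 + primitive f s)).
  by move=> s; rewrite inE /= in_itv /= => /Ff.
have -> : (fun s => F 0 + primitive f s) = cst (F 0) + primitive f by [].
by apply: C0_add; [exact: C0_cst|exact: primitive_C0].
Qed.

Lemma abscont_incr F f a b : abscont F f -> 0 <= a -> a <= b -> b <= T ->
  F b - F a = primitive f b - primitive f a.
Proof. by move=> [_ Ff] a0 ab bT; rewrite (Ff a) ?(Ff b); lra. Qed.

(** An equality of increments up to a square of the increments of a primitive
    is exact, by bisection. *)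
Lemma abscont_intro F f g C : L1 f -> L1 g -> (forall y, 0 <= g y) ->
  (forall a b, 0 <= a -> a <= b -> b <= T ->
     `|F b - F a - (primitive f b - primitive f a)| <=
       C * (primitive g b - primitive g a) ^+ 2) -> abscont F f.
Proof.
move=> fi gi g0 H; split => // s sT.
have := @quadratic_increments _ T (primitive g) (fun y => F y - primitive f y) C.
move=> /(_ (primitive_C0 T0 gi)) Q.
have -> : F 0 = F s - primitive f s; last by ring.
rewrite Q// ?primitive0 ?subr0// => a b a0 ab bT.
  rewrite -subr_ge0 -[leLHS](subrr (primitive (cst 0) b)).
  have := @primitive_le _ T (cst 0) g a b a0 ab bT (L1_cst _ _) gi (fun y _ => g0 y).
  by rewrite !primitive_cst//; lra.
have -> : F b - primitive f b - (F a - primitive f a) =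
  F b - F a - (primitive f b - primitive f a) by ring.
exact: H.
Qed.

Lemma abscont_osc F f g a b y : abscont F f -> L1 g -> (forall z, `|f z| <= g z) ->
  0 <= a -> a <= y -> y <= b -> b <= T ->
  `|F a - F y| <= primitive g b - primitive g a /\
  `|F b - F y| <= primitive g b - primitive g a.
Proof.
move=> Ff gi fg a0 ay yb bT; have [fi _] := Ff.
have g0 z : 0 <= g z := le_trans (normr_ge0 _) (fg z).
have mono p q : 0 <= p -> p <= q -> q <= T -> primitive g p <= primitive g q.
  move=> p0 pq qT; have := @primitive_le _ T (cst 0) g p q p0 pq qT (L1_cst _ _) gi (fun y _ => g0 y).
  by rewrite !primitive_cst//; lra.
have H p q : 0 <= p -> p <= q -> q <= T -> `|F q - F p| <= primitive g q - primitive g p.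
  by move=> p0 pq qT; rewrite (abscont_incr Ff)//; exact: (primitive_norm_le p0 pq qT fi gi).
have m1 : primitive g a <= primitive g y by apply: mono; lra.
have m2 : primitive g y <= primitive g b by apply: mono; lra.
split; first by rewrite distrC (le_trans (H a y _ _ _))//; lra.
by rewrite (le_trans (H y b _ _ _))//; lra.
Qed.

(** The defect of the product rule on [a, b] is bounded by the oscillations of
    F and G times the integrals of |f| and |g|, which is quadratic. *)
Lemma abscont_mul F f G g : abscont F f -> abscont G g -> abscont (F * G) (f * G + g * F).
Proof.
move=> Ff Gg; have [fi _] := Ff; have [gi _] := Gg.
(* The integrand compares f G + g F with its values frozen at the endpoints, f
   (G a) + (F b) g, whose integral is the increment of F G. *)
have Fc := abscont_C0 Ff; have Gc := abscont_C0 Gg.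
pose m : R -> R := (fun y => `|f y|) + (fun y => `|g y|).
have mi : L1 m by apply: L1_add; exact: L1_norm.
have fGi : L1 (f * G) by exact: L1_mul_C0.
have gFi : L1 (g * F) by exact: L1_mul_C0.
have m0 y : 0 <= m y by rewrite /m addr_ge0.
apply: (@abscont_intro _ _ m 1) => // [|a b a0 ab bT]; first exact: L1_add.
have aT : a <= T by lra.
have -> : (F * G) b - (F * G) a - (primitive (f * G + g * F) b - primitive (f * G + g * F) a)
   = primitive (G a *: f + F b *: g - (f * G + g * F)) b -
     primitive (G a *: f + F b *: g - (f * G + g * F)) a.
  have i1 : L1 (G a *: f) by exact: L1_scale.
  have i2 : L1 (F b *: g) by exact: L1_scale.
  have i3 : L1 (f * G + g * F) by exact: L1_add.
  rewrite !(@primitive_sub _ T)//; [|exact: L1_add|exact: L1_add].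
  rewrite [primitive (_ *: _ + _) b](@primitive_add _ T)//.
  rewrite [primitive (_ *: _ + _) a](@primitive_add _ T)// !(@primitive_scale _ T)//.
  have E1 := abscont_incr Ff a0 ab bT; have E2 := abscont_incr Gg a0 ab bT.
  have -> : (F * G) b - (F * G) a = (F b - F a) * G a + F b * (G b - G a).
    by rewrite -[(F * G) b]/(F b * G b) -[(F * G) a]/(F a * G a); ring.
  by rewrite E1 E2; ring.
pose D := primitive m b - primitive m a.
have -> : 1 * (primitive m b - primitive m a) ^+ 2 = primitive (D *: m) b - primitive (D *: m) a.
  by rewrite !(@primitive_scale _ T)// -mulrBr mul1r expr2.
apply: (@primitive_norm_le _ T) => //.
- apply: L1_sub_fun; last exact: L1_add.
  by apply: L1_add; exact: L1_scale.
- exact: L1_scale.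
move=> y /andP[ay yb].
have fm z : `|f z| <= m z by rewrite /m lerDl.
have gm z : `|g z| <= m z by rewrite /m lerDr.
have [h1 _] := abscont_osc Gg mi gm a0 ay yb bT.
have [_ h2] := abscont_osc Ff mi fm a0 ay yb bT.
rewrite -[X in `|X|]/(G a * f y + F b * g y - (f y * G y + g y * F y)).
have -> : G a * f y + F b * g y - (f y * G y + g y * F y) =
  (G a - G y) * f y + (F b - F y) * g y by ring.
rewrite -[leRHS]/(D * (`|f y| + `|g y|)) mulrDr (le_trans (ler_normD _ _))// !normrM.
by rewrite lerD// ler_wpM2r.
Qed.

Lemma abscont_add F f G g : abscont F f -> abscont G g -> abscont (F + G) (f + g).
Proof.
move=> [fi Ff] [gi Gg]; split => [|s sT]; first exact: L1_add.
rewrite (@primitive_add _ T)//; last by case/andP: sT.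
by rewrite -![(F + G) _]/(F _ + G _) (Ff s)// (Gg s)//; ring.
Qed.

Lemma abscont_cst k : abscont (cst k) 0.
Proof.
split => [|s /andP[s0 _]]; first exact: (L1_cst T 0).
by have := @primitive_cst R 0 s s0; rewrite mul0r /= => ->; rewrite addr0.
Qed.

Lemma abscont_scale k F f : abscont F f -> abscont (k *: F) (k *: f).
Proof.
move=> [fi Ff]; split => [|s sT]; first exact: L1_scale.
rewrite (@primitive_scale _ T)//; last by case/andP: sT.
by rewrite -![(k *: F) _]/(k * F _) (Ff s)//; ring.
Qed.

Lemma abscont_sum (I : Type) (r : seq I) (P : pred I) (F f : I -> R -> R) :
  (forall k, P k -> abscont (F k) (f k)) ->
  abscont (\sum_(k <- r | P k) F k) (\sum_(k <- r | P k) f k).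
Proof.
move=> Ff; elim: r => [|k r IH]; first by rewrite !big_nil; exact: (abscont_cst 0).
by rewrite !big_cons; case: ifP => // Pk; apply: abscont_add => //; exact: Ff.
Qed.

Lemma abscont_exp F f n : abscont F f -> abscont (fun s => F s ^+ n) (fun s => n%:R * F s ^+ n.-1 * f s).
Proof.
move=> Ff; elim: n => [|n IH].
  have -> : (fun s => 0%:R * F s ^+ 0.-1 * f s) = 0.
    by apply/funext => s; rewrite mul0r mul0r.
  exact: (abscont_cst 1).
have := abscont_mul Ff IH; congr (abscont _ _); apply/funext => s.
  by rewrite exprS.
rewrite -[LHS]/(f s * F s ^+ n + n%:R * F s ^+ n.-1 * f s * F s) /=.
case: n {IH} => [|n] /=; first by rewrite !expr0; ring.
by rewrite exprS -[in RHS]natr1; ring.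
Qed.

End absolutely_continuous.

Section chain_rule.
Context {R : realType} {d : nat}.
Variables (T r rho : R) (x : R -> 'rV[R]_d) (x' : 'I_d -> R -> R).
Hypotheses (T0 : 0 <= T) (rr : 0 < rho < r).
Hypothesis xc : {within `[0, T], continuous x}.
Hypothesis xB : forall s, 0 <= s <= T -> `|x s| <= rho.
Hypothesis x_ac : forall i, abscont T (fun s => x s 0 i) (x' i).

Lemma analytic_lip q (h : 'rV[R]_d -> R) : analytic r q h ->
  exists2 K, 0 <= K & forall y z, `|y| <= rho -> `|z| <= rho -> `|h y - h z| <= K * `|y - z|.
Proof.
move=> ha; have [C C0 hC] := analytic_taylor ha rr.
have Ci i := analytic_order (analytic_weak (leq0n _) (analytic_pd i ha)) rr.
pose K i := sval (cid2 (Ci i)).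
have K0 i : 0 <= K i by rewrite /K; case: (cid2 (Ci i)).
have hK i z : `|z| <= rho -> `|pd r i h z| <= K i.
  by rewrite /K; case: (cid2 (Ci i)) => /= c c0 hB zr; have := hB z zr; rewrite expr0 mulr1.
have S0 : 0 <= \sum_i K i by exact: sumr_ge0.
have rho0 : 0 <= rho by case/andP: rr => /ltW.
exists (C * (2 * rho) + \sum_i K i) => [|y z yr zr]; first by rewrite addr_ge0// !mulr_ge0.
have := hC z (y - z) zr; rewrite subrKC => /(_ yr) h1.
have h2 : `|lin_row (fun i => pd r i h z) (y - z)| <= (\sum_i K i) * `|y - z|.
  rewrite /lin_row (le_trans (ler_norm_sum _ _ _))// mulr_suml ler_sum// => i _.
  by rewrite normrM mulrC ler_pM ?le_coord ?hK.
have h3 : `|y - z| ^+ 2 <= 2 * rho * `|y - z|.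
  rewrite expr2 ler_wpM2r// (le_trans (ler_normB _ _))//; lra.
have h4 : C * `|y - z| ^+ 2 <= C * (2 * rho * `|y - z|) by rewrite ler_wpM2l.
move: h1 h2; move: (lin_row _ _) => L h1 h2.
have -> : h y - h z = (h y - h z - L) + L by ring.
by apply: le_trans (ler_normD _ _) _; lra.
Qed.

Lemma C0_comp q h : analytic r q h -> C0 T (h \o x).
Proof.
move=> /analytic_lip[K K0 hK]; apply/C0_P => s sT.
have /subspace_continuousP /(_ s) xs := xc.
have {}xs : x @ within `[0, T] (nbhs s) --> x s by apply: xs; rewrite /= in_itv.
apply/cvgrPdist_le => e e0.
have K1 : 0 < K + 1 by lra.
have xsd := @cvgr_dist_le _ _ _ _ _ _ _ xs (e / (K + 1)) (divr_gt0 e0 K1).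
near=> y.
have yT : 0 <= y <= T.
  suff : `[0, T]%classic y by rewrite /= in_itv.
  by near: y; exact: withinT.
apply: le_trans (hK _ _ (xB sT) (xB yT)) _.
have : `|x s - x y| <= e / (K + 1) by near: y; exact: xsd.
rewrite ler_pdivlMr// mulrDr mulr1 mulrC.
by have := normr_ge0 (x s - x y); lra.
Unshelve. all: by end_near. Qed.

(** On [a, b] the Taylor remainder and the variation of the partial
    derivatives along x are both quadratic in the integral of the derivatives
    of the coordinates of x. *)
Lemma chain_rule q h : analytic r q h ->
  abscont T (h \o x) (\sum_i x' i * (pd r i h \o x)).
Proof.
move=> ha.
have x'i i : L1 T (x' i) by case: (x_ac i).
pose m : R -> R := \sum_i (fun y => `|x' i y|).
have mi : L1 T m.
  by apply: (@L1_sum _ T _ _ xpredT (fun i y => `|x' i y|)) => i _; exact: L1_norm.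
have mE y : m y = \sum_i `|x' i y| by rewrite /m fct_sumE.
have m0 y : 0 <= m y by rewrite mE sumr_ge0.
have x'm i y : `|x' i y| <= m y by rewrite mE (bigD1 i)//= lerDl sumr_ge0.
have pc i : C0 T (pd r i h \o x) by exact: C0_comp (analytic_pd i ha).
have fi i : L1 T (x' i * (pd r i h \o x)) by exact: L1_mul_C0.
have [C CC hC] := analytic_taylor ha rr.
have lipi i := analytic_lip (analytic_pd i ha).
pose K i := sval (cid2 (lipi i)).
have K0 i : 0 <= K i by rewrite /K; case: (cid2 (lipi i)).
have hK i y z : `|y| <= rho -> `|z| <= rho -> `|pd r i h y - pd r i h z| <= K i * `|y - z|.
  by rewrite /K; case: (cid2 (lipi i)) => /= c _; exact.
apply: (@abscont_intro _ T T0 _ _ m (C + \sum_i K i)) => // [|a b a0 ab bT]; first exact: L1_sum.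
have aT : a <= T by lra.
pose D := primitive m b - primitive m a.
have D0 : 0 <= D.
  have := @primitive_le _ T (cst 0) m a b a0 ab bT (L1_cst _ _) mi (fun y _ => m0 y).
  by rewrite !primitive_cst//; [rewrite /D; lra|lra].
have osc y : a <= y -> y <= b -> `|x a - x y| <= D.
  move=> ay yb; apply: le_row => // i; rewrite !mxE.
  by have [] := abscont_osc (x_ac i) mi (x'm i) a0 ay yb bT.
have xaB : `|x a| <= rho by apply: xB; lra.
have xbB : `|x b| <= rho by apply: xB; lra.
have := hC (x a) (x b - x a) xaB; rewrite subrKC => /(_ xbB) h1.
have h2 : C * `|x b - x a| ^+ 2 <= C * D ^+ 2.
  by rewrite ler_wpM2l// lerXn2r// ?nnegrE// distrC osc.
have E : lin_row (fun i => pd r i h (x a)) (x b - x a) -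
   (primitive (\sum_i x' i * (pd r i h \o x)) b - primitive (\sum_i x' i * (pd r i h \o x)) a) =
   \sum_i (primitive (pd r i h (x a) *: x' i - x' i * (pd r i h \o x)) b -
           primitive (pd r i h (x a) *: x' i - x' i * (pd r i h \o x)) a).
  rewrite !(@primitive_sum _ T)// /lin_row -!sumrB; apply: eq_bigr => i _.
  rewrite !(@primitive_sub _ T)//; [|exact: L1_scale|exact: L1_scale].
  rewrite !(@primitive_scale _ T)//.
  have := abscont_incr (x_ac i) a0 ab bT; rewrite !mxE => ->; ring.
have h3 : `|lin_row (fun i => pd r i h (x a)) (x b - x a) -
   (primitive (\sum_i x' i * (pd r i h \o x)) b - primitive (\sum_i x' i * (pd r i h \o x)) a)|
   <= (\sum_i K i) * D ^+ 2.
  rewrite E (le_trans (ler_norm_sum _ _ _))// mulr_suml ler_sum// => i _.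
  have -> : K i * D ^+ 2 = primitive ((K i * D) *: m) b - primitive ((K i * D) *: m) a.
    by rewrite !(@primitive_scale _ T)// -mulrBr -mulrA expr2.
  apply: (@primitive_norm_le _ T) => //.
  - by apply: L1_sub_fun => //; exact: L1_scale.
  - exact: L1_scale.
  move=> y /andP[ay yb].
  have yB : `|x y| <= rho by apply: xB; lra.
  rewrite -[X in `|X|]/(pd r i h (x a) * x' i y - x' i y * pd r i h (x y)).
  rewrite [x' i y * _]mulrC -mulrBl normrM -[leRHS]/(K i * D * m y) ler_pM//.
  by apply: le_trans (hK _ _ _ xaB yB) _; rewrite ler_wpM2l// osc.
move: h1 h3; rewrite -/D -[(h \o x) b]/(h (x b)) -[(h \o x) a]/(h (x a)).
move: (lin_row _ _) => L h1 h3.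
set P := primitive _ b - primitive _ a in h3 *.
have -> : h (x b) - h (x a) - P = (h (x b) - h (x a) - L) + (L - P) by ring.
by apply: le_trans (ler_normD _ _) _; rewrite mulrDl; lra.
Qed.

End chain_rule.

(** * Continuity arguments *)

Section first_exit.
Context {R : realType}.
Local Notation mu := (@lebesgue_measure R).

Lemma C0_near (T : R) (f : R -> R) s e : C0 T f -> 0 <= s <= T -> 0 < e ->
  exists2 del, 0 < del & forall y, 0 <= y <= T -> `|y - s| < del -> `|f y - f s| < e.
Proof.
move=> /C0_P fc sT e0; have /cvgrPdist_lt/(_ e e0) := fc s sT.
rewrite near_withinE => -[del /= del0 H]; exists del => // y yT ys.
by rewrite distrC; apply: H; rewrite ?in_itv//= distrC.
Qed.

(** Continuous induction: the set of times up to which f stays below M is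
    closed, and open by the strict inequality. *)
Lemma first_exit (T M : R) (f : R -> R) : 0 <= T -> C0 T f -> f 0 <= M ->
  (forall s, 0 <= s <= T -> (forall y, 0 <= y <= s -> f y <= M) -> f s < M) ->
  forall s, 0 <= s <= T -> f s <= M.
Proof.
move=> T0 fc f0M H.
pose E := [set s | 0 <= s <= T /\ forall y, 0 <= y <= s -> f y <= M]%classic.
have E0 : E 0 by split=> [|y]; [rewrite lexx T0|rewrite -eq_le => /eqP <-].
have Es : has_sup E by split; [exists 0|exists T => s [/andP[]]].
set s := sup E.
have sT : 0 <= s <= T.
  apply/andP; split; first exact: (sup_upper_bound Es).
  by apply: sup_le_ub; [exists 0|move=> y [/andP[]]].
have below y : 0 <= y -> y < s -> f y <= M.
  move=> y0 ys; have [|e Ee ye] := sup_adherent (_ : 0 < s - y) Es; first by rewrite subr_gt0.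
  by apply: Ee.2; rewrite y0 ltW//; rewrite subKr in ye.
have fsM : f s <= M.
  rewrite leNgt; apply/negP => Mfs.
  have [|del del0 D] := C0_near fc sT (_ : 0 < f s - M); first by rewrite subr_gt0.
  have s0 : 0 < s.
    by rewrite lt_neqAle (andP sT).1 andbT; apply/eqP => s0; move: Mfs; rewrite -s0 ltNge f0M.
  (* A time before s at which f is already above M. *)
  pose y := Num.max 0 (s - del / 2).
  have ys : y < s by rewrite gt_max s0 /=; lra.
  have y0 : 0 <= y by rewrite le_max lexx.
  have yd : `|y - s| < del.
    by rewrite ltr0_norm ?subr_lt0// opprB ltrBlDr -ltrBlDl lt_max; apply/orP; right; lra.
  have yT : 0 <= y <= T by rewrite y0 ltW// (lt_le_trans ys)//; case/andP: sT.
  have := D y yT yd; rewrite ltr_norml => /andP[A _]; have := below y y0 ys; lra.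
have all_s y : 0 <= y <= s -> f y <= M.
  by move=> /andP[y0]; rewrite le_eqVlt => /orP[/eqP ->//|]; exact: below.
have sE : s = T.
  apply/eqP; rewrite eq_le (andP sT).2 leNgt; apply/negP => sT'.
  have fs := H s sT all_s.
  have [|del del0 D] := C0_near fc sT (_ : 0 < M - f s); first by rewrite subr_gt0.
  pose y := Num.min T (s + del / 2).
  have sy : s < y by rewrite lt_min sT' /=; lra.
  have yT : y <= T by rewrite ge_min lexx.
  have yd : y <= s + del / 2 by rewrite ge_min lexx orbT.
  have s0 : 0 <= s by case/andP: sT.
  suff : E y by move/(sup_upper_bound Es); rewrite leNgt sy.
  split=> [|z /andP[z0 zy]]; first by rewrite yT andbT; lra.
  have [zs|sz] := leP z s; first by apply: all_s; rewrite z0.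
  have zT : 0 <= z <= T by rewrite z0; lra.
  have : `|z - s| < del by rewrite gtr0_norm ?subr_gt0//; lra.
  by move/(D z zT); rewrite ltr_norml => /andP[_]; lra.
by move=> y yT; apply: all_s; rewrite sE.
Qed.

(** The essential bound holds everywhere because a primitive is continuous. *)
Lemma Wm1oo_bound (T rho : R) (u : R -> R) : 0 < T -> L1 T u -> (Wm1oo_norm T u <= rho%:E)%E ->
  forall s, 0 <= s <= T -> `|primitive u s| <= rho.
Proof.
move=> T0 ui; rewrite /Wm1oo_norm unlock.
have muT : (0 < mu [set: R])%E.
  by rewrite -set_itvNyy lebesgue_measure_itv /= addye.
rewrite muT => /ess_supP [N [mN N0 NS]] s sT; rewrite leNgt; apply/negP => rs.
have vc : C0 T (primitive u) by apply: primitive_C0 => //; exact: ltW.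
have [|del del0 D] := C0_near (C0_norm vc) sT (_ : 0 < `|primitive u s| - rho); first by rewrite subr_gt0.
pose a := Num.max 0 (s - del); pose b := Num.min T (s + del).
have ab : a < b.
  by case/andP: sT => s0 sT; rewrite gt_max !lt_min T0 /=; apply/and3P; split; lra.
have abN : (`]a, b[ `<=` N)%classic.
  move=> y /=; rewrite in_itv /= gt_max lt_min => /andP[/andP[y0 sy] /andP[yT ys]].
  have yI : y \in `]0, T[%classic by rewrite inE /= in_itv /= y0.
  apply: NS => /=; rewrite patchE yI.
  rewrite lee_fin => yr.
  have yT' : 0 <= y <= T by rewrite !ltW.
  have : `|y - s| < del by rewrite ltr_norml; apply/andP; split; lra.
  by move/(D y yT'); rewrite ltr_norml => /andP[A _]; lra.
have : (mu `]a, b[%classic <= 0)%E.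
  rewrite -[leRHS](N0 : mu N = 0%E); apply: le_measure => //; rewrite inE //.
rewrite lebesgue_measure_itv /= lte_fin ab -EFinB lee_fin subr_le0.
by rewrite leNgt ab.
Qed.

Lemma L1_open (T : R) (u : R -> R) : mu.-integrable `]0, T[ (EFin \o u) -> L1 T u.
Proof.
move=> /integrableP[mf fi].
apply/integrableP; split; first exact: emeasurable_fun_itv_cc mf.
have mn b : measurable_fun [set` Interval (BRight 0) (BSide b T)] (abse \o (EFin \o u)).
  apply: measurableT_comp => //; case: b => //.
  by apply/emeasurable_fun_itv_bndo_bndcP.
by rewrite -integral_itv_obnd_cbnd ?(mn false)// -integral_itv_bndo_bndc ?(mn true).
Qed.
End first_exit.

(** * Integrals of powers *)

Section absorption.
Context {R : realType}.

(** Iterating the self-improving bound shrinks the contribution of the a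
    priori bound B0 geometrically. *)
Lemma absorb (T B0 c : R) (g : R -> R) : 0 <= B0 -> 0 <= c ->
  (forall s, 0 <= s <= T -> g s <= B0) ->
  (forall B, 0 <= B -> (forall s, 0 <= s <= T -> g s <= B) ->
     forall s, 0 <= s <= T -> g s <= B / 2 + c) ->
  forall s, 0 <= s <= T -> g s <= 2 * c.
Proof.
move=> B00 c0 gB0 H.
have K n : forall s, 0 <= s <= T -> g s <= B0 / 2 ^+ n + 2 * c.
  elim: n => [|n IH] s sT; first by rewrite expr0 divr1 (le_trans (gB0 s sT))// lerDl mulr_ge0.
  have p0 : 0 <= B0 / 2 ^+ n by rewrite divr_ge0// exprn_ge0.
  have := H (B0 / 2 ^+ n + 2 * c) _ IH s sT.
  have -> : B0 / 2 ^+ n.+1 = B0 / 2 ^+ n / 2 by rewrite exprS invfM; ring.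
  have q0 : 0 <= B0 / 2 ^+ n + 2 * c by lra.
  by move=> /(_ q0); lra.
move=> s sT; apply/ler_addgt0Pr => e e0.
have [n nB] : exists n, B0 / e <= 2 ^+ n.
  exists (Num.bound (B0 / e)); apply: ltW; apply: lt_le_trans (archi_boundP _) _.
    by rewrite divr_ge0// ltW.
  by rewrite -natrX ler_nat ltnW// ltn_expl.
apply: le_trans (K n s sT) _; rewrite addrC lerD2l.
by rewrite ler_pdivrMr ?exprn_gt0// mulrC -ler_pdivrMr.
Qed.

(** Each factor is at most the larger of a and b. *)
Lemma exp_mul_le (a b : R) i j : 0 <= a -> 0 <= b -> a ^+ i * b ^+ j <= a ^+ (i + j) + b ^+ (i + j).
Proof.
move=> a0 b0; have [ab|ba] := leP a b.
  apply: (@le_trans _ _ (b ^+ (i + j))); last by rewrite lerDr exprn_ge0.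
  by rewrite exprD ler_wpM2r ?exprn_ge0// lerXn2r ?nnegrE.
apply: (@le_trans _ _ (a ^+ (i + j))); last by rewrite lerDl exprn_ge0.
by rewrite exprD ler_wpM2l ?exprn_ge0// lerXn2r ?nnegrE// ltW.
Qed.

Lemma exp_add_le (a b : R) n : 0 <= a -> 0 <= b -> (a + b) ^+ n <= 2 ^+ n * (a ^+ n + b ^+ n).
Proof.
move=> a0 b0; have [ab|ba] := leP a b.
  apply: (@le_trans _ _ ((2 * b) ^+ n)); first by rewrite lerXn2r ?nnegrE ?addr_ge0 ?mulr_ge0//; lra.
  by rewrite exprMn ler_wpM2l ?exprn_ge0// lerDr exprn_ge0.
apply: (@le_trans _ _ ((2 * a) ^+ n)); first by rewrite lerXn2r ?nnegrE ?addr_ge0 ?mulr_ge0//; lra.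
by rewrite exprMn ler_wpM2l ?exprn_ge0// lerDl exprn_ge0.
Qed.

Variables (T : R) (v : R -> R).
Hypotheses (T0 : 0 <= T) (vc : C0 T v) (v1 : forall s, 0 <= s <= T -> `|v s| <= 1).

(** All error terms are measured by these integrals, written V n. *)
Definition vint (w : R -> R) (t : R) n := primitive (fun y => `|w y| ^+ n) t.
Local Notation V := (vint v T).

Lemma int_le (f g : R -> R) : C0 T f -> C0 T g -> (forall y, 0 <= y <= T -> f y <= g y) ->
  primitive f T <= primitive g T.
Proof.
move=> fc gc fg.
have := @primitive_le _ T f g 0 T (lexx 0) T0 (lexx T) (L1_C0 fc) (L1_C0 gc) fg.
by rewrite !primitive0 !subr0.
Qed.

Lemma vint_C0 n : C0 T (fun y => `|v y| ^+ n).
Proof. by apply: C0_exp; exact: C0_norm. Qed.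

Lemma vint_ge0 n : 0 <= V n.
Proof. by apply: Rintegral_ge0 => y _; exact: exprn_ge0. Qed.

Lemma vint_mono m n : (m <= n)%N -> V n <= V m.
Proof.
move=> mn; apply: int_le => [| |y yT]; try exact: vint_C0.
by apply: ler_wiXn2l => //; exact: v1.
Qed.

Lemma int_scale k n : primitive (fun y => k * `|v y| ^+ n) T = k * V n.
Proof. by rewrite -[LHS]/(primitive (k *: _) T) (@primitive_scale _ T)//; apply: L1_C0; exact: vint_C0. Qed.

Lemma int_cst_add k k' n : primitive (fun y => k + k' * `|v y| ^+ n) T = k * T + k' * V n.
Proof.
rewrite -[LHS]/(primitive (cst k + k' *: (fun y => `|v y| ^+ n)) T) (@primitive_add _ T)//.
- by rewrite primitive_cst// int_scale.
- exact: L1_cst.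
- by apply: L1_scale; apply: L1_C0; exact: vint_C0.
Qed.

(** Integrate |v s|^i |v y|^j <= |v s|^(i+j) + |v y|^(i+j) over both
    variables. The factor T is what makes products of integrals negligible. *)
Lemma vint_mul i j : V i * V j <= 2 * T * V (i + j).
Proof.
have C k k' n : C0 T (fun y => k + k' * `|v y| ^+ n).
  apply: (@C0_add _ T (cst k) (k' *: (fun y => `|v y| ^+ n))); first exact: C0_cst.
  by apply: C0_scale; exact: vint_C0.
have H s : 0 <= s <= T -> `|v s| ^+ i * V j <= V (i + j) + T * `|v s| ^+ (i + j).
  move=> sT; rewrite -int_scale.
  have -> : V (i + j) + T * `|v s| ^+ (i + j) = primitive (fun y => `|v s| ^+ (i + j) + 1 * `|v y| ^+ (i + j)) T.
    by rewrite int_cst_add mul1r; ring.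
  apply: int_le => //; first by apply: (@C0_scale _ T _ (fun y => `|v y| ^+ j)); exact: vint_C0.
  by move=> y _; rewrite mul1r; exact: exp_mul_le.
rewrite mulrC -int_scale.
have -> : 2 * T * V (i + j) = primitive (fun y => V (i + j) + T * `|v y| ^+ (i + j)) T.
  by rewrite int_cst_add; ring.
apply: int_le => //; first by apply: (@C0_scale _ T _ (fun y => `|v y| ^+ i)); exact: vint_C0.
by move=> y yT; rewrite mulrC; exact: H.
Qed.

Lemma vint_exp n : 2 * T <= 1 -> V 1 ^+ n.+1 <= V n.+1.
Proof.
move=> T2; elim: n => [|n IH]; first by rewrite expr1.
rewrite exprS; apply: le_trans (ler_wpM2l (vint_ge0 1) IH) _.
apply: le_trans (vint_mul 1 n.+1) _; rewrite add1n.
by rewrite ler_piMl// vint_ge0.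
Qed.

Lemma vint_exp2 n : 2 * T <= 1 -> V 1 ^+ n.+2 <= 2 * T * V n.+2.
Proof.
move=> T2; rewrite exprS; apply: le_trans (ler_wpM2l (vint_ge0 1) (vint_exp n T2)) _.
exact: vint_mul.
Qed.

Lemma vint1_le rv : (forall s, 0 <= s <= T -> `|v s| <= rv) -> V 1 <= rv * T.
Proof.
move=> vr; rewrite -primitive_cst//; apply: int_le => [| |y yT]; first exact: vint_C0.
  exact: C0_cst.
by rewrite expr1; exact: vr.
Qed.

Lemma vint_le rv n : (forall s, 0 <= s <= T -> `|v s| <= rv) -> V n.+1 <= rv * V n.
Proof.
move=> vr; rewrite -int_scale; apply: int_le => [| |y yT]; first exact: vint_C0.
  by apply: (@C0_scale _ T _ (fun y => `|v y| ^+ n)); exact: vint_C0.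
by rewrite exprS ler_wpM2r ?exprn_ge0//; exact: vr.
Qed.

End absorption.

(** * Cauchy estimates for iterated Lie derivatives *)

Section growth.
Context {R : realType} {d : nat}.
Variable r : R.
Implicit Types (h : 'rV[R]_d -> R) (f g : 'rV[R]_d -> 'rV[R]_d).

Definition series_bound rho M h := exists sigma, has_series rho M 0 sigma h.

Lemma series_bound_le rho M h x : series_bound rho M h -> `|x| <= rho -> `|h x| <= M.
Proof. by move=> [s hs]; exact: series_norm_le hs. Qed.

Lemma series_bound_weak rho M M' h : M <= M' -> series_bound rho M h -> series_bound rho M' h.
Proof.
move=> MM [s [a b c]]; exists s; split => // n; exact: le_trans (b n) MM.
Qed.

Lemma series_bound_ge0 rho M h : 0 <= rho -> series_bound rho M h -> 0 <= M.
Proof.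
by move=> rho0 hM; have := series_bound_le (x := 0) hM; rewrite normr0 => /(_ rho0); apply: le_trans.
Qed.

Lemma series_bound_analytic q h rho : analytic r q h -> 0 < rho < r -> exists M, series_bound rho M h.
Proof.
move=> ha rr; have [s hs] := analytic_weak (leq0n q) ha.
by have [M hM] := hs rho rr; exists M, s.
Qed.

Lemma series_bound_sum rho n (F : 'I_n -> 'rV[R]_d -> R) M : 0 <= rho ->
  (forall i, series_bound rho M (F i)) -> series_bound rho (n%:R * M) (\sum_i F i).
Proof.
move=> rho0; elim: n F => [|n IH] F FM.
  exists (cser [::]); rewrite mul0r big_ord0.
  have := @has_series_c R d rho [::] 0 rho0 isT.
  by rewrite /coef_norm big_nil; apply: has_series_ext => x _; rewrite /ev big_nil.
rewrite big_ord_recr; have [s hs] := IH (fun i => F (widen_ord (leqnSn n) i)) (fun i => FM _).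
have [t ht] := FM ord_max; exists (addser s t).
by have := has_series_add hs ht; rewrite minnn -natr1 mulrDl mul1r.
Qed.

Lemma series_bound_lie f rho rho' M F h : 0 <= rho' < rho -> rho' < r ->
  (forall i, series_bound rho' F (coordf f i)) -> series_bound rho M h ->
  series_bound rho' (d%:R * (F * (M / (rho - rho')))) (lie r f h).
Proof.
move=> rr r'r fF [s hs]; have [r0 _] := andP rr.
apply: series_bound_sum => // i; have [t ht] := fF i.
exists (mulser t (derivser i s)).
exact: (has_series_mul r0 ht (has_series_d i hs rr r'r)).
Qed.

(** A weak Stirling bound, from (1 + 1/n)^n <= e. *)
Lemma expn_le_fact n : n%:R ^+ n <= expR 1 ^+ n * n`!%:R :> R.
Proof.
elim: n => [|n IH]; first by rewrite !expr0 mulr1.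
have H : n.+1%:R ^+ n <= expR 1 * n%:R ^+ n :> R.
  case: n {IH} => [|n]; first by rewrite !expr0 mulr1; have := expR_ge1Dx (1 : R); lra.
  have n0 : n.+1%:R != 0 :> R by rewrite pnatr_eq0.
  have -> : n.+2%:R = (1 + n.+1%:R^-1) * n.+1%:R :> R.
    by rewrite mulrDl mulVf// mul1r natr1.
  rewrite exprMn ler_wpM2r ?exprn_ge0//.
  have -> : expR 1 = expR n.+1%:R^-1 ^+ n.+1 :> R.
    by rewrite -expRM_natr mulVf.
  by rewrite lerXn2r ?nnegrE ?expR_ge0 ?addr_ge0// expR_ge1Dx.
rewrite exprS factS natrM [expR 1 ^+ n.+1]exprS.
have -> : expR 1 * expR 1 ^+ n * (n.+1%:R * n`!%:R) = n.+1%:R * (expR 1 * (expR 1 ^+ n * n`!%:R)) :> R by ring.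
rewrite ler_wpM2l// (le_trans H)// ler_wpM2l// expR_ge0.
Qed.

(** Cauchy estimates: n derivatives on n balls whose radii decrease by e / n,
    which gives (A n)^n with A below; the weak Stirling bound turns this into
    a geometric factor times n!. *)
Lemma lie_iter_growth f rho : vanalytic r f -> 0 < rho < r ->
  exists2 C, 0 < C & forall h, analytic r 0 h ->
    exists2 K, 0 <= K & forall n, series_bound rho (K * C ^+ n * n`!%:R) (iter n (lie r f) h).
Proof.
move=> fa rr; have [rho0 rhor] := andP rr.
pose rho1 := (rho + r) / 2; have rr1 : 0 < rho1 < r by rewrite /rho1; lra.
have [F [F0 Ff]] : exists F, 0 <= F /\ forall i, series_bound rho1 F (coordf f i).
  have fi i := series_bound_analytic (fa i) rr1; pose M i := sval (cid (fi i)).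
  have MM i : series_bound rho1 (M i) (coordf f i) by rewrite /M; case: (cid (fi i)).
  have M0 i : 0 <= M i by apply: series_bound_ge0 (MM i); case/andP: rr1 => /ltW.
  exists (\sum_i M i); split => [|i]; first exact: sumr_ge0.
  by apply: series_bound_weak (MM i); rewrite (bigD1 i)//= lerDl sumr_ge0.
pose e := rho1 - rho; have e0 : 0 < e by rewrite /e /rho1; lra.
(* A n is the cost of one derivative when the radius decreases by e / n. *)
pose A := d%:R * F / e; have A0 : 0 <= A by rewrite /A divr_ge0 ?mulr_ge0// ltW.
exists (A * expR 1 + 1); first by rewrite ltr_wpDl// mulr_ge0// expR_ge0.
move=> h ha; have [M hM] := series_bound_analytic ha rr1.
have M0 : 0 <= M by apply: series_bound_ge0 hM; case/andP: rr1 => /ltW.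
exists M => // -[|n].
  rewrite expr0 !mulr1; have [s hs] := hM; exists s; apply: has_series_le hs; rewrite /rho1; lra.
pose N : R := n.+1%:R; have N0 : 0 < N by rewrite ltr0n.
have H j : (j <= n.+1)%N -> series_bound (rho1 - j%:R * (e / N)) ((A * N) ^+ j * M) (iter j (lie r f) h).
  elim: j => [_|j IH jn]; first by rewrite mul0r subr0 expr0 mul1r.
  have {}IH := IH (ltnW jn).
  have eN0 : 0 < e / N by rewrite divr_gt0.
  have jN : j.+1%:R * (e / N) <= e.
    by rewrite mulrCA ler_piMr ?(ltW e0)// ler_pdivrMr// mul1r ler_nat.
  have E : rho1 - j%:R * (e / N) - (rho1 - j.+1%:R * (e / N)) = e / N.
    by rewrite -natr1; ring.
  have rho'0 : 0 <= rho1 - j.+1%:R * (e / N).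
    by rewrite subr_ge0 (le_trans jN)// /e gerBl ltW.
  have := series_bound_lie _ _ (fun i => _) IH.
  move=> /(_ f (rho1 - j.+1%:R * (e / N)) F).
  rewrite E => X; have {}X : series_bound (rho1 - j.+1%:R * (e / N)) (d%:R * (F * ((A * N) ^+ j * M / (e / N)))) (lie r f (iter j (lie r f) h)).
    apply: X; [by rewrite rho'0 -subr_gt0 E| |].
    - have : 0 <= j.+1%:R * (e / N) by rewrite mulr_ge0// ltW.
      by move=> jN0; case/andP: rr1 => _; apply: le_lt_trans; rewrite gerBl.
    move=> i; have [s hs] := Ff i; exists s; apply: has_series_le hs.
    by rewrite rho'0 /= gerBl mulr_ge0// ltW.
  rewrite iterS; apply: series_bound_weak X; rewrite le_eqVlt; apply/orP; left; apply/eqP.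
  rewrite [(A * N) ^+ j.+1]exprS; move: ((A * N) ^+ j) => a.
  by rewrite /A; field; rewrite !gt_eqF.
have := H n.+1 (leqnn _).
have -> : rho1 - n.+1%:R * (e / N) = rho.
  rewrite -/N /e; field; by rewrite gt_eqF.
apply: series_bound_weak; rewrite exprMn mulrC -mulrA ler_wpM2l//.
apply: le_trans (ler_wpM2l (exprn_ge0 _ A0) (expn_le_fact n.+1)) _.
rewrite mulrA -exprMn ler_wpM2r// lerXn2r// ?nnegrE ?lerDl//.
  by rewrite mulr_ge0// expR_ge0.
by rewrite addr_ge0// mulr_ge0// expR_ge0.
Qed.

(** This growth makes the exponential series of the flow of f converge for
    small times. *)
Lemma lie_growth f g rho : vanalytic r f -> vanalytic r g -> 0 < rho < r ->
  exists2 C, 0 < C & forall h, analytic r 0 h ->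
    exists2 K, 0 <= K & forall n x, `|x| <= rho ->
      `|iter n (lie r f) h x| <= K * C ^+ n * n`!%:R /\
      `|lie r g (iter n (lie r f) h) x| <= K * C ^+ n * n`!%:R.
Proof.
move=> fa ga rr; have [rho0 rhor] := andP rr.
pose rho1 := (rho + r) / 2; have rr1 : 0 < rho1 < r by rewrite /rho1; lra.
have [C C0 H] := lie_iter_growth fa rr1; exists C => // h ha.
have [F [F0 Gf]] : exists F, 0 <= F /\ forall i, series_bound rho F (coordf g i).
  have fi i := series_bound_analytic (ga i) rr; pose M i := sval (cid (fi i)).
  have MM i : series_bound rho (M i) (coordf g i) by rewrite /M; case: (cid (fi i)).
  have M0 i : 0 <= M i by apply: series_bound_ge0 (MM i); exact: ltW.
  exists (\sum_i M i); split => [|i]; first exact: sumr_ge0.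
  by apply: series_bound_weak (MM i); rewrite (bigD1 i)//= lerDl sumr_ge0.
have [K K0 hK] := H h ha.
pose e := rho1 - rho; have e0 : 0 < e by rewrite /e /rho1; lra.
exists (K + d%:R * F / e * K).
  by rewrite addr_ge0// !mulr_ge0// invr_ge0 ltW.
move=> n x xr; have p0 : 0 <= C ^+ n * n`!%:R by rewrite mulr_ge0// exprn_ge0// ltW.
have xr1 : `|x| <= rho1 by rewrite (le_trans xr)// /rho1; lra.
have Q0 : 0 <= d%:R * F / e * K * (C ^+ n * n`!%:R).
  by rewrite !mulr_ge0// ?invr_ge0 ?exprn_ge0 ?ltW.
split.
  apply: le_trans (series_bound_le (hK n) xr1) _; rewrite -!mulrA mulrDl.
  by rewrite -!mulrA in Q0 *; rewrite lerDl.
have X := @series_bound_lie g rho1 rho _ F _ _ rhor Gf (hK n).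
apply: le_trans (series_bound_le (X _) xr) _; first by rewrite /rho1; lra.
rewrite -/e; have -> : d%:R * (F * (K * C ^+ n * n`!%:R / e)) = d%:R * F / e * K * (C ^+ n * n`!%:R).
  by field; rewrite gt_eqF.
have P0 : 0 <= K * (C ^+ n * n`!%:R) by rewrite mulr_ge0.
by rewrite -[_ * C ^+ n * _]mulrA mulrDl lerDr.
Qed.

End growth.

(** * Finite families *)

Section linear_algebra.
Context {R : realType}.

(** Choosing one constant for finitely many estimates that only weaken as the
    constant grows. *)
Lemma uniform_constant n (P : 'I_n -> R -> Prop) :
  (forall i K K', K <= K' -> P i K -> P i K') ->
  (forall i, exists2 K, 0 <= K & P i K) -> exists2 K, 0 <= K & forall i, P i K.
Proof.
move=> Pm PK; pose K i := sval (cid2 (PK i)).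
have K0 i : 0 <= K i by rewrite /K; case: (cid2 (PK i)).
exists (\sum_i K i) => [|i]; first exact: sumr_ge0.
apply: (Pm i (K i)); first by rewrite (bigD1 i)//= lerDl sumr_ge0.
by rewrite /K; case: (cid2 (PK i)).
Qed.

(** A maximal free family with property P. *)
Lemma spanning_seq n (P : 'rV[R]_n -> Prop) : exists cs : seq 'rV[R]_n,
  (forall c, c \in cs -> P c) /\ forall c, P c -> c \in <<cs>>%VS.
Proof.
have H k : forall cs : seq 'rV[R]_n, (n - size cs <= k)%N -> free cs ->
    (forall c, c \in cs -> P c) -> exists cs : seq 'rV[R]_n,
  (forall c, c \in cs -> P c) /\ forall c, P c -> c \in <<cs>>%VS.
  have bound (X : seq 'rV[R]_n) : free X -> (size X <= n)%N.
    rewrite /free => /eqP <-; have := dimvS (subvf <<X>>).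
    by rewrite dimvf /dim /= mul1n.
  elim: k => [|k IH] cs ck csf csP.
    exists cs; split => // c Pc; apply: contraT => ccs.
    have := bound (c :: cs); rewrite free_cons ccs csf => /(_ isT) /=; lia.
  have [csS|/existsNP[c /not_implyP[Pc /negP ccs]]] := pselect (forall c, P c -> c \in <<cs>>%VS).
    by exists cs.
  apply: (IH (c :: cs)) => /=; first lia.
    by rewrite free_cons ccs.
  by move=> e; rewrite inE => /orP[/eqP ->//|]; exact: csP.
by apply: (H n [::]) => //; [exact: leq_subr|exact: nil_free].
Qed.

(** Coordinates on a basis extending v :: X. *)
Lemma dual_forms d (v : 'rV[R]_d) (X : seq 'rV[R]_d) : free (v :: X) ->
  exists (p : 'I_d -> R) (xi : 'I_(size X) -> 'I_d -> R),
    [/\ lin_row p v = 1, forall j : 'I_(size X), lin_row p X`_j = 0 &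
        forall i j : 'I_(size X), lin_row (xi i) X`_j = (i == j)%:R].
Proof.
move=> Xf; pose Y := in_tuple (v :: X).
have E i u : coord Y i u = lin_row (fun k => coord Y i (delta_mx 0 k)) u.
  rewrite [u in LHS]row_sum_delta linear_sum; apply: eq_bigr => k _.
  by rewrite linearZ.
exists (fun k => coord Y ord0 (delta_mx 0 k)), (fun i k => coord Y (lift ord0 i) (delta_mx 0 k)).
split => [|j|i j]; rewrite -E.
- by have := coord_free ord0 ord0 (Xf : free Y); rewrite eqxx.
- by have := coord_free (lift ord0 j) ord0 (Xf : free Y); rewrite lift0.
- by have := coord_free (lift ord0 j) (lift ord0 i) (Xf : free Y); rewrite lift0 (inj_eq lift_inj) eq_sym.
Qed.

End linear_algebra.

(** * Truncated exponentials *)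

Section exponential_inverse.
Context {R : realType}.

(** The coefficients of exp(-y). *)
Definition exp_coef (j : nat) : R := (-1) ^+ j / j`!%:R.

Lemma fact_inv_le1 j : j`!%:R^-1 <= 1 :> R.
Proof. by rewrite invf_le1 ?ltr0n ?fact_gt0// ler1n fact_gt0. Qed.

Lemma norm_exp_coef j : `|exp_coef j| = j`!%:R^-1.
Proof. by rewrite /exp_coef normrM normrX normrN1 expr1n mul1r normfV normr_nat. Qed.

Lemma exp_coefS j : j.+1%:R * exp_coef j.+1 = - exp_coef j.
Proof.
have a0 : j.+1%:R != 0 :> R by rewrite pnatr_eq0.
have b0 : j`!%:R != 0 :> R by rewrite pnatr_eq0 -lt0n fact_gt0.
rewrite /exp_coef factS natrM exprS mulN1r; move: (j.+1%:R) (j`!%:R) a0 b0 => a b a0 b0.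
by field; rewrite a0 b0.
Qed.

(** exp(y) exp(-y) = 1, coefficient by coefficient. *)
Lemma exp_coef_convolution n : \sum_(l < n.+1) l`!%:R^-1 * exp_coef (n - l) = (n == 0%N)%:R :> R.
Proof.
have fn0 m : m`!%:R != 0 :> R by rewrite pnatr_eq0 -lt0n fact_gt0.
apply: (mulfI (fn0 n)); rewrite mulr_sumr.
have -> : \sum_(l < n.+1) n`!%:R * (l`!%:R^-1 * exp_coef (n - l)) = (-1 + 1 : R) ^+ n.
  rewrite exprDn; apply: eq_bigr => l _; rewrite expr1n mulr1 /exp_coef.
  have ln : (l <= n)%N by rewrite -ltnS.
  rewrite -(bin_fact ln) !natrM -[RHS]mulr_natr.
  move: (fn0 l) (fn0 (n - l)%N); move: (l`!%:R) ((n - l)`!%:R) ((-1) ^+ (n - l)) => a b c a0 b0.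
  by field; rewrite a0 b0.
by rewrite addNr expr0n; case: n => [|n] /=; rewrite ?fact0 ?mulr1 ?mulr0.
Qed.

Definition conv_coef N n : R :=
  \sum_(l < N) \sum_(i < N) (n == i + l)%N%:R * (l`!%:R^-1 * exp_coef i).

Lemma conv_coefE N n : (n < N)%N -> conv_coef N n = (n == 0%N)%:R.
Proof.
move=> nN; rewrite -exp_coef_convolution /conv_coef.
rewrite (big_ord_widen N (fun l => l`!%:R^-1 * exp_coef (n - l) : R) nN) [RHS]big_mkcond /=.
apply: eq_bigr => l _; rewrite ltnS; case: ifP => ln.
  have nlN : (n - l < N)%N by apply: leq_ltn_trans nN; exact: leq_subr.
  rewrite (bigD1 (Ordinal nlN))//= subnK// eqxx mul1r big1 ?addr0// => i /eqP il.
  case: eqP => [E|]; last by rewrite mul0r.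
  by case: il; apply: val_inj; rewrite /= E addnK.
rewrite big1// => i _; case: eqP => [E|]; last by rewrite mul0r.
by rewrite E leq_addl in ln.
Qed.

(** Truncated at order N, the identity exp(y L) exp(-y L) F = F holds up to
    terms divisible by y^N. F n stands for the n-th derivative of a function
    along a field. *)
Lemma exp_inverse N (y : R) (F : nat -> R) : (0 < N)%N ->
  \sum_(l < N) y ^+ l / l`!%:R * \sum_(i < N) exp_coef i * (y ^+ i * F (i + l)%N) =
  F 0%N + y ^+ N * \sum_(n < N) conv_coef N (N + n) * (y ^+ n * F (N + n)%N).
Proof.
move=> N0.
have -> : \sum_(l < N) y ^+ l / l`!%:R * \sum_(i < N) exp_coef i * (y ^+ i * F (i + l)%N) =
    \sum_(n < N + N) conv_coef N n * (y ^+ n * F n).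
  under [RHS]eq_bigr do rewrite /conv_coef mulr_suml.
  rewrite exchange_big; apply: eq_bigr => l _ /=.
  under [RHS]eq_bigr do rewrite mulr_suml.
  rewrite exchange_big mulr_sumr; apply: eq_bigr => i _ /=.
  have il : (i + l < N + N)%N by rewrite -addnS leq_add// ltnW.
  rewrite (bigD1 (Ordinal il))//= eqxx mul1r big1 ?addr0 => [|n /eqP ni].
    by rewrite exprD; ring.
  case: eqP => [E|]; last by rewrite !mul0r.
  by case: ni; apply: val_inj.
rewrite big_split_ord /=; congr (_ + _).
  case: N N0 => // N _; rewrite big_ord_recl big1 ?addr0 => [|i _].
    by rewrite /= conv_coefE// expr0 !mul1r.
  by rewrite conv_coefE ?mul0r//= /bump /= add1n ltnS.
by rewrite mulr_sumr; apply: eq_bigr => n _; rewrite exprD; ring.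
Qed.

Lemma geometric_sum_le (q : R) n : 0 <= q -> q <= 1 / 2 -> \sum_(i < n) q ^+ i <= 2.
Proof.
move=> q0 q2; suff : \sum_(i < n) q ^+ i + 2 * q ^+ n <= 2.
  by have : 0 <= q ^+ n := exprn_ge0 n q0; lra.
elim: n => [|n IH]; first by rewrite big_ord0 add0r expr0 mulr1.
apply: le_trans IH; rewrite big_ord_recr /= exprS -addrA lerD2l.
have := ler_wpM2r (exprn_ge0 n q0) q2; lra.
Qed.

(** The tail of an exponential series whose derivatives grow geometrically. *)
Lemma tail_le (b : nat -> R) (C K y : R) N n : 0 <= K -> 0 <= C -> C * `|y| <= 1 / 2 ->
  (forall j, `|b j| <= K * C ^+ j * j`!%:R) ->
  `|\sum_(j < N + n) exp_coef j * (y ^+ j * b j) - \sum_(j < N) exp_coef j * (y ^+ j * b j)| <=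
  2 * K * C ^+ N * `|y| ^+ N.
Proof.
move=> K0 C0 Cy bK; rewrite big_split_ord /= addrAC subrr add0r.
have q0 : 0 <= C * `|y| by rewrite mulr_ge0.
apply: le_trans (ler_norm_sum _ _ _) _.
apply: (@le_trans _ _ (\sum_(i < n) (K * (C * `|y|) ^+ N) * (C * `|y|) ^+ i)).
  apply: ler_sum => i _; rewrite normrM norm_exp_coef normrM normrX.
  have fp : 0 < (N + i)`!%:R :> R by rewrite ltr0n fact_gt0.
  rewrite mulrC ler_pdivrMr// -mulrA -exprD exprMn.
  have -> : K * (C ^+ (N + i) * `|y| ^+ (N + i)) * (N + i)`!%:R =
    `|y| ^+ (N + i) * (K * C ^+ (N + i) * (N + i)`!%:R) by ring.
  by rewrite ler_wpM2l// exprn_ge0.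
rewrite -mulr_sumr exprMn.
have -> : 2 * K * C ^+ N * `|y| ^+ N = K * (C ^+ N * `|y| ^+ N) * 2 by ring.
by rewrite ler_wpM2l ?geometric_sum_le// !mulr_ge0// exprn_ge0.
Qed.

End exponential_inverse.

(** * A function that detects a bracket *)

Section system.
Context {R : realType} {d : nat}.
Variables (r : R) (f0 f1 : 'rV[R]_d -> 'rV[R]_d).
Hypotheses (r0 : 0 < r) (f0a : vanalytic r f0) (f1a : vanalytic r f1) (f00 : f0 0 = 0).
Implicit Types (h phi psi : 'rV[R]_d -> R).
Local Notation analytic := (analytic r).
Local Notation Lf0 := (lie r f0).
Local Notation Lf1 := (lie r f1).

Section bracket_words.
Implicit Types (b c : Br) (B C D : seq Br) (g : 'rV[R]_d -> R).

Definition fb b := eval_bracket f0 f1 b.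

Lemma fb_analytic b : vanalytic r (fb b).
Proof. by elim: b => //= b IHb c IHc; exact: vanalytic_bracket. Qed.

Definition Lb b := lie r (fb b).
(** The iterated Lie derivative along the fields of a list of brackets; its
    weight counts the occurrences of f1. *)
Definition LB B h := foldr Lb h B.
Definition weight B : nat := sumn (map n1 B).

Lemma weight_cat B C : weight (B ++ C) = (weight B + weight C)%N.
Proof. by rewrite /weight map_cat sumn_cat. Qed.

Lemma LB_cat B C h : LB (B ++ C) h = LB B (LB C h).
Proof. by rewrite /LB foldr_cat. Qed.

Lemma LB_analytic q B h : analytic q h -> analytic (q - size B) (LB B h).
Proof.
move=> ha; elim: B => [|b B IH] /=; first by rewrite subn0.
by rewrite subnS; apply: analytic_lie => //; exact: fb_analytic.
Qed.

Lemma LB_analytic0 B h : analytic 0 h -> analytic 0 (LB B h).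
Proof. by move=> ha; have := @LB_analytic 0 B h ha; rewrite sub0n. Qed.

Lemma Lb_analytic0 b h : analytic 0 h -> analytic 0 (Lb b h).
Proof. exact: (@LB_analytic0 [:: b]). Qed.

Lemma Lb_bracket b c h : analytic 0 h ->
  Lb b (Lb c h) = Lb c (Lb b h) + Lb (Bracket b c) h.
Proof.
move=> ha; rewrite /Lb [fb (Bracket b c)]/(lie_bracket (fb b) (fb c)) lie_comm//; try exact: fb_analytic.
by rewrite addrC subrK.
Qed.

Lemma LB_add B h g : analytic 0 h -> analytic 0 g -> LB B (h + g) = LB B h + LB B g.
Proof.
move=> ha ga; elim: B => [//|b B IH] /=; rewrite IH.
by rewrite /Lb lie_add//; exact: LB_analytic0.
Qed.

Lemma LB_scale B (a : R) h : analytic 0 h -> LB B (a *: h) = a *: LB B h.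
Proof.
move=> ha; elim: B => [//|b B IH] /=; rewrite IH.
by rewrite /Lb lie_scale//; exact: LB_analytic0.
Qed.

Lemma LB_sub B h g : analytic 0 h -> analytic 0 g -> LB B (h - g) = LB B h - LB B g.
Proof.
move=> ha ga; rewrite -(scaleN1r g) LB_add ?LB_scale ?scaleN1r//.
exact: analytic_opp.
Qed.

(** Transposing two neighbours in a list adds one term in which they are
    merged into their bracket; the merged list is shorter and has the same
    weight. *)
Lemma LB_swap B C b c h : analytic 0 h ->
  LB (B ++ b :: c :: C) h = LB (B ++ c :: b :: C) h + LB (B ++ Bracket b c :: C) h.
Proof.
move=> ha; rewrite !LB_cat /= Lb_bracket; last exact: LB_analytic0.
have Ca := LB_analytic0 C ha.
by rewrite LB_add//; do ?apply: Lb_analytic0.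
Qed.

Lemma Lb0E b h : Lb b h 0 = lin_row (fun i => pd r i h 0) (fb b 0).
Proof. exact: lieE. Qed.

Lemma lie_bracket0 (f g : 'rV[R]_d -> 'rV[R]_d) : f 0 = 0 -> g 0 = 0 -> lie_bracket f g 0 = 0.
Proof.
move=> f0E g0E.
have E1 : 'd g 0 (f 0) = 0 := etrans (congr1 ('d g 0) f0E) (linear0 ('d g 0)).
have E2 : 'd f 0 (g 0) = 0 := etrans (congr1 ('d f 0) g0E) (linear0 ('d f 0)).
exact: (etrans (f_equal2 (fun a b : 'rV[R]_d => a - b) E1 E2) (subrr (0 : 'rV[R]_d))).
Qed.

(** f0 vanishes at the origin, hence so does every bracket of f0 alone. *)
Lemma fb_weight0 b : n1 b = 0%N -> fb b 0 = 0.
Proof.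
rewrite /fb; elim: b => [_|//|b IHb c IHc] /=; first exact: f00.
move/eqP; rewrite addn_eq0 => /andP[/eqP/IHb b0 /eqP/IHc c0].
exact: lie_bracket0.
Qed.

(** This covers the case f1(0) = 0, left aside by final_primitive. *)
Lemma fb_f1_0 b : f1 0 = 0 -> fb b 0 = 0.
Proof.
move=> f10; rewrite /fb; elim: b => [||b IHb c IHc] //=.
exact: lie_bracket0.
Qed.

(** The jet of order 1 is the value at the origin. *)
Lemma analytic1 h : analytic 0 h -> h 0 = 0 -> analytic 1 h.
Proof.
move=> ha h0; have [c cE] := analytic_jet r0 1 ha.
have E : (fun x : 'rV[R]_d => \sum_(w <- words 1) c w * ev_word x w) = cst (c [::]).
  have W1 : @words d 1 = [:: [::]] by rewrite /=; congr cons; elim: (enum 'I_d).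
  by apply/funext => x; rewrite W1 big_seq1 /ev_word big_nil mulr1.
rewrite E in cE; have := analytic_at0 r0 (ltn0Sn 0) cE.
rewrite -[(h - _) 0]/(h 0 - c [::]) h0 sub0r => /eqP; rewrite oppr_eq0 => /eqP c0.
by move: cE; rewrite c0 -[cst 0]/(0 : 'rV[R]_d -> R) subr0.
Qed.

(** Fields of weight 0 vanish at the origin, so that deriving along them does
    not lower the order of vanishing. *)
Lemma LB_order m h B : analytic m h -> (weight B < m)%N -> LB B h 0 = 0.
Proof.
move=> ha Bm; apply: (analytic_at0 r0 (_ : 0 < m - weight B)%N); first by rewrite subn_gt0.
elim: B {Bm} => [|b B IH] /=; first by rewrite subn0.
have -> : weight (b :: B) = (n1 b + weight B)%N by [].
case: (posnP (n1 b)) => [b0|b0].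
  rewrite b0; apply: analytic_lie1 => // i; apply: analytic1; first exact: fb_analytic.
  by rewrite /coordf fb_weight0// mxE.
apply: analytic_weak (analytic_lie (fb_analytic b) IH); lia.
Qed.

Section symmetry.
Variables (W n : nat) (phi : 'rV[R]_d -> R).
Hypothesis phia : analytic 0 phi.

Definition kills m := forall B, (size B <= m)%N -> (weight B <= W)%N -> LB B phi 0 = 0.

Hypothesis phik : kills n.

(** The corrections produced by the transpositions are shorter lists of the
    same weight, which phi already kills. *)
Lemma LB_move B C b D : (size (B ++ C ++ b :: D) <= n.+1)%N ->
  (weight (B ++ C ++ b :: D) <= W)%N ->
  LB (B ++ C ++ b :: D) phi 0 = LB (B ++ b :: C ++ D) phi 0.
Proof.
elim/last_ind: C D => [//|C c IH] D sB wB.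
rewrite -cats1 -!catA /= catA LB_swap// -catA.
rewrite -[LHS]/(LB (B ++ C ++ b :: c :: D) phi 0 + LB ((B ++ C) ++ Bracket c b :: D) phi 0).
have -> : LB ((B ++ C) ++ Bracket c b :: D) phi 0 = 0.
  apply: phik.
    move: sB; rewrite -cats1 !size_cat /=; lia.
  by move: wB; rewrite -cats1 !weight_cat /weight /=; lia.
rewrite addr0 IH//.
  by move: sB; rewrite -cats1 !size_cat /=; lia.
by move: wB; rewrite -cats1 !weight_cat /weight /=; lia.
Qed.

End symmetry.

(** A basis that respects the filtration by weight: brackets are added weight
    by weight, up to a basis of the span of the brackets of weight at most W.
    Weight 0 contributes nothing at the origin. *)
Lemma adapted_basis W : exists bs : seq Br,
  [/\ all (fun b => 1 <= n1 b <= W)%N bs,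
      free [seq fb b 0 | b <- bs] &
      forall b, (n1 b <= W)%N ->
        fb b 0 \in <<[seq fb c 0 | c <- [seq c <- bs | (n1 c <= n1 b)%N]]>>%VS].
Proof.
elim: W => [|W [bs [bsW bsf bsS]]].
  exists [::]; split; rewrite ?nil_free// => b; rewrite leqn0 => /eqP b0.
  by rewrite fb_weight0// span_nil memv0.
suff [E [Ea Ef Es]] : exists E : seq Br, [/\ all (fun b => n1 b == W.+1) E,
    free [seq fb b 0 | b <- E ++ bs] &
    forall b, n1 b = W.+1 -> fb b 0 \in <<[seq fb c 0 | c <- E ++ bs]>>%VS].
  have EW : all (fun b => 1 <= n1 b <= W.+1)%N (E ++ bs).
    rewrite all_cat; apply/andP; split.
      by apply: sub_all Ea => b /eqP ->; rewrite leqnn.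
    by apply: sub_all bsW => b /andP[-> bW]; rewrite leqW.
  exists (E ++ bs); split => // b; rewrite leq_eqVlt => /orP[/eqP bW|bW].
    rewrite bW (_ : [seq c <- _ | _] = E ++ bs); first exact: Es.
    by apply/all_filterP; apply: sub_all EW => c /andP[].
  rewrite filter_cat map_cat span_cat.
  exact: (subvP (addvSr _ _)) (bsS b bW).
have H n : forall E, (d - size (E ++ bs) <= n)%N -> all (fun b => n1 b == W.+1) E ->
    free [seq fb b 0 | b <- E ++ bs] -> exists E : seq Br, [/\ all (fun b => n1 b == W.+1) E,
    free [seq fb b 0 | b <- E ++ bs] &
    forall b, n1 b = W.+1 -> fb b 0 \in <<[seq fb c 0 | c <- E ++ bs]>>%VS].
  have bound (X : seq 'rV[R]_d) : free X -> (size X <= d)%N.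
    rewrite /free => /eqP <-; have := dimvS (subvf <<X>>).
    by rewrite dimvf /dim /= mul1n.
  elim: n => [|n IH] E En Ea Ef.
    exists E; split => // b bW; apply: contraT => bE.
    have := bound (fb b 0 :: [seq fb c 0 | c <- E ++ bs]).
    rewrite free_cons bE Ef => /(_ isT) /=; rewrite size_map; lia.
  have [Es|/existsNP[b /not_implyP[bW /negP bE]]] := pselect (forall b, n1 b = W.+1 ->
      fb b 0 \in <<[seq fb c 0 | c <- E ++ bs]>>%VS); first by exists E.
  apply: (IH (b :: E)) => /=; first lia.
    by rewrite bW eqxx.
  by rewrite free_cons bE.
by apply: (H d [::]) => //; exact: leq_subr.
Qed.

(** Modulo shorter lists Lie derivatives commute. *)
Lemma LB_perm W n phi q (b_ : 'I_q -> Br) (H : seq Br) (J J' : seq 'I_q) :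
  analytic 0 phi -> kills W phi n -> perm_eq J J' ->
  (size (H ++ map b_ J) <= n.+1)%N -> (weight (H ++ map b_ J) <= W)%N ->
  LB (H ++ map b_ J) phi 0 = LB (H ++ map b_ J') phi 0.
Proof.
move=> phia phik; elim: J H J' => [|i J IH] H J' JJ' sB wB.
  by rewrite perm_sym in JJ'; rewrite (perm_nilP JJ').
have iJ' : i \in J' by rewrite -(perm_mem JJ') inE eqxx.
have [P [Q EJ]] : exists P Q : seq 'I_q, J' = P ++ i :: Q.
  by case/splitPr: iJ' => P Q; exists P, Q.
rewrite {}EJ in JJ' iJ' *.
have JPQ : perm_eq J (P ++ Q).
  by rewrite -(perm_cons i) (perm_trans JJ')// -cat1s perm_catCA.
have sJ : size J = (size P + size Q)%N by rewrite (perm_size JPQ) size_cat.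
have wJ : weight (map b_ J) = (weight (map b_ P) + weight (map b_ Q))%N.
  rewrite -weight_cat -map_cat /weight -!map_comp; apply: perm_sumn.
  exact: perm_map.
rewrite [map b_ (i :: J)]/= -cat_rcons (IH _ (P ++ Q))//; first last.
- by move: wB; rewrite cat_rcons.
- by move: sB; rewrite cat_rcons.
rewrite cat_rcons !map_cat /= (LB_move phia phik)//.
  by move: sB; rewrite !size_cat /= ?size_cat /= !size_map sJ; lia.
by move: wB; rewrite !weight_cat /= -[weight (_ :: map b_ J)]/(n1 (b_ i) + weight (map b_ J))%N
   -[weight (_ :: map b_ Q)]/(n1 (b_ i) + weight (map b_ Q))%N wJ; lia.
Qed.

Lemma lin_row_analytic (k : 'I_d -> R) : analytic 1 (lin_row k).
Proof.
rewrite (_ : lin_row k = \sum_i k i *: (fun x : 'rV[R]_d => x 0 i)).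
  by apply: analytic_sum => i _; apply: analytic_scale; exact: analytic_coord.
by apply/funext => x; rewrite fct_sumE; apply: eq_bigr => i _; rewrite mulrC.
Qed.

Lemma Lb_lin_row b (k : 'I_d -> R) : Lb b (lin_row k) 0 = lin_row k (fb b 0).
Proof.
rewrite Lb0E; congr lin_row; apply/funext => i.
by rewrite pd_in ?normr0// (diff_lin_row k 0).2 lin_row_delta.
Qed.

Section correction.
Variables (q : nat) (b_ : 'I_q -> Br) (xi : 'I_q -> 'I_d -> R).
Implicit Types (G : seq 'I_q -> R) (J : seq 'I_q).
Hypothesis xib : forall i j, lin_row (xi i) (fb (b_ j) 0) = (i == j)%:R.

(** The homogeneous polynomial of degree m in the coordinates xi whose
    derivative along the fields b_J at the origin is G J, for a symmetric
    function G of lists of length m. The recursion is Euler's identity. *)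
Fixpoint symm_poly m G : 'rV[R]_d -> R :=
  if m is m'.+1 then
    m%:R^-1 *: \sum_j lin_row (xi j) * symm_poly m' (fun J => G (j :: J))
  else cst (G [::]).

Definition symmetric_fun G := forall J J', perm_eq J J' -> G J = G J'.

Lemma symm_poly_analytic m G : analytic m (symm_poly m G).
Proof.
elim: m G => [|m IH] G; first exact: analytic_cst.
apply: analytic_scale; apply: analytic_sum => j _.
exact: analytic_mul (lin_row_analytic _) (IH _).
Qed.

(** Deriving along b_i acts on the linear forms xi j like the i-th partial
    derivative, up to a function vanishing at the origin; such errors raise
    the order by one. *)
Lemma Lb_symm_poly i m G : symmetric_fun G ->
  analytic m.+1 (Lb (b_ i) (symm_poly m.+1 G) - symm_poly m (fun J => G (i :: J))).
Proof.
have sa0 n F : analytic 0 (symm_poly n F) by exact: analytic_weak (leq0n _) (symm_poly_analytic n F).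
have la0 (k : 'I_d -> R) : analytic 0 (lin_row k) by exact: analytic_weak (leq0n _) (lin_row_analytic k).
have xi1 j : analytic 1 (Lb (b_ i) (lin_row (xi j)) - cst (j == i)%:R).
  apply: analytic1 => //.
    by apply: analytic_sub; [exact: Lb_analytic0|exact: analytic_cst].
  rewrite -[LHS]/(Lb (b_ i) (lin_row (xi j)) 0 - (j == i)%:R).
  by rewrite Lb_lin_row xib subrr.
elim: m G => [|m IH] G Gs.
  rewrite [symm_poly 1 G]/= invr1 scale1r.
  have -> : Lb (b_ i) (\sum_j lin_row (xi j) * cst (G [:: j])) - cst (G [:: i]) =
    \sum_j (Lb (b_ i) (lin_row (xi j)) - cst (j == i)%:R) * cst (G [:: j]).
    rewrite /Lb lie_sum => [|j _]; last exact: analytic_mul (la0 _) (analytic_cst _ _).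
    under [RHS]eq_bigr do rewrite mulrBl.
    rewrite sumrB; congr (_ - _).
      apply: eq_bigr => j _; rewrite lie_mul//; last exact: analytic_cst.
      rewrite (_ : lie r _ (cst _) = 0) ?mulr0 ?add0r//.
      by rewrite /lie big1// => k _; rewrite pd_cst mulr0.
    rewrite (bigD1 i)//= big1 ?addr0 ?eqxx => [|j /negbTE ->].
      by apply/funext => x; rewrite /= -[RHS]/(1 * G [:: i]) mul1r.
    by apply/funext => x; rewrite -[LHS]/(0 * G [:: j]) mul0r.
  by apply: analytic_sum => j _; exact: analytic_mul (xi1 j) (analytic_cst _ _).
pose Gj j J := G (j :: J).
have Gjs j : symmetric_fun (Gj j) by move=> J J' JJ; apply: Gs; rewrite perm_cons.
pose S1 := \sum_j lin_row (xi j) * (Lb (b_ i) (symm_poly m.+1 (Gj j)) - symm_poly m (fun J => Gj j (i :: J))).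
pose S2 := \sum_j (Lb (b_ i) (lin_row (xi j)) - cst (j == i)%:R) * symm_poly m.+1 (Gj j).
have E : Lb (b_ i) (symm_poly m.+2 G) - symm_poly m.+1 (Gj i) = m.+2%:R^-1 *: (S1 + S2).
  have -> : symm_poly m.+2 G = m.+2%:R^-1 *: \sum_j lin_row (xi j) * symm_poly m.+1 (Gj j) by [].
  rewrite /Lb lie_scale; last by apply: analytic_sum => j _; exact: analytic_mul (la0 _) (sa0 _ _).
  rewrite lie_sum => [|j _]; last exact: analytic_mul (la0 _) (sa0 _ _).
  have -> : \sum_j lie r (fb (b_ i)) (lin_row (xi j) * symm_poly m.+1 (Gj j)) =
    S1 + S2 + m.+2%:R *: symm_poly m.+1 (Gj i).
    under eq_bigr do rewrite lie_mul//.
    rewrite big_split /S1 /S2 /=.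
    under [\sum_j lin_row (xi j) * (_ - _)]eq_bigr do rewrite mulrBr.
    under [\sum_j (_ - _) * _]eq_bigr do rewrite mulrBl.
    rewrite !sumrB.
    have -> : \sum_j cst (j == i)%:R * symm_poly m.+1 (Gj j) = symm_poly m.+1 (Gj i).
      rewrite (bigD1 i)// eqxx big1 => [|j ji]; last by rewrite (negbTE ji); exact: mul0r.
      by apply: etrans (addr0 _) _; exact: mul1r.
    have -> : \sum_j lin_row (xi j) * symm_poly m (fun J => Gj j (i :: J)) =
       m.+1%:R *: symm_poly m.+1 (Gj i).
      rewrite [symm_poly m.+1 _]/= scalerA mulfV ?scale1r ?pnatr_eq0//.
      apply: eq_bigr => j _; congr (_ * symm_poly m _); apply/funext => J.
      by apply: Gs; rewrite -[_ :: _]/([:: j] ++ [:: i] ++ J) perm_catCA.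
    rewrite -[m.+2]addn1 natrD scalerDl scale1r.
    have Z (V : zmodType) (a b c e : V) : a + b = a - c + (b - e) + (c + e).
      by rewrite [RHS]addrACA !subrK.
    exact: Z.
  by rewrite scalerDr scalerA mulVf ?pnatr_eq0// scale1r addrK.
rewrite -[fun J => G (i :: J)]/(Gj i) E; apply: analytic_scale; apply: analytic_add.
  by apply: analytic_sum => j _; exact: analytic_mul (lin_row_analytic _) (IH _ (Gjs j)).
by apply: analytic_sum => j _; exact: analytic_mul (xi1 j) (symm_poly_analytic _ _).
Qed.

Lemma LB_symm_poly G J : symmetric_fun G -> LB (map b_ J) (symm_poly (size J) G) 0 = G J.
Proof.
elim/last_ind: J G => [//|J i IH] G Gs.
have sa0 n F : analytic 0 (symm_poly n F) by exact: analytic_weak (leq0n _) (symm_poly_analytic n F).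
rewrite size_rcons map_rcons -cats1 LB_cat.
pose S := symm_poly (size J).+1 G; rewrite -[LB [:: b_ i] _]/(Lb (b_ i) S).
pose Q := symm_poly (size J) (fun J => G (i :: J)).
have SQ := Lb_symm_poly i (size J) Gs; rewrite -/S -/Q in SQ.
have -> : Lb (b_ i) S = (Lb (b_ i) S - Q) + Q by rewrite subrK.
have SQ0 : analytic 0 (Lb (b_ i) S - Q) by exact: analytic_weak (leq0n _) SQ.
have Qa : analytic 0 Q by exact: sa0.
rewrite (LB_add _ SQ0 Qa) -[LHS]/(LB (map b_ J) (Lb (b_ i) S - Q) 0 + LB (map b_ J) Q 0).
rewrite (analytic_at0 r0 _ (LB_analytic (map b_ J) SQ)) ?size_map ?subSnn// add0r.
rewrite IH; first by apply: Gs; rewrite perm_sym perm_rcons.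
by move=> I I' II; apply: Gs; rewrite perm_cons.
Qed.

End correction.

Lemma span_filter_comb (f : Br -> 'rV[R]_d) (P : pred Br) (s : seq Br) v :
  v \in <<[seq f c | c <- [seq c <- s | P c]]>>%VS ->
  exists a : nat -> R, v = \sum_(i < size s) a i *: f (nth X0 s i) /\
    forall i, (i < size s)%N -> a i != 0 -> P (nth X0 s i).
Proof.
elim: s v => [|b s IH] v /=.
  by rewrite span_nil memv0 => /eqP ->; exists (fun=> 0); rewrite big_ord0.
have aux w k : w \in <<[seq f c | c <- [seq c <- s | P c]]>>%VS -> (k != 0 -> P b) ->
    exists a : nat -> R, k *: f b + w = \sum_(i < (size s).+1) a i *: f (nth X0 (b :: s) i) /\
    forall i, (i < (size s).+1)%N -> a i != 0 -> P (nth X0 (b :: s) i).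
  move=> /IH[a [-> aP]] kP; exists (fun i => if i is j.+1 then a j else k).
  by rewrite big_ord_recl; split => // -[|i] //; rewrite ltnS; exact: aP.
case: ifP => [Pb|nPb] vs.
  move: vs; rewrite /= span_cons => /memv_addP[_ /vlineP[k ->] [w ws ->]].
  exact: aux.
by have [||a [E aP]] := aux v 0; rewrite ?eqxx//; exists a; rewrite -E scale0r add0r.
Qed.

Lemma weight_size B : (weight B < size B)%N -> exists C b D, B = C ++ b :: D /\ n1 b = 0%N.
Proof.
elim: B => [//|b B IH]; rewrite -[weight _]/(n1 b + weight B)%N /=.
have [b0 _|b0 bB] := posnP (n1 b); first by exists [::], b, B.
have [|C [c [D [-> c0]]]] := IH; first lia.
by exists (b :: C), c, D.
Qed.

(** A list longer than its weight contains a field of weight 0; moved to the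
    front, it vanishes at the origin. *)
Lemma kills_more W n phi : analytic 0 phi -> (W <= n)%N -> kills W phi n -> kills W phi n.+1.
Proof.
move=> pa Wn pk B; rewrite leq_eqVlt => /orP[/eqP sB wB|]; last by rewrite ltnS; exact: pk.
have [|C [b [D [EB b0]]]] := @weight_size B; first by rewrite sB ltnS (leq_trans wB).
rewrite EB -[C ++ _]/([::] ++ C ++ b :: D) (LB_move pa pk) -?EB ?sB//.
by rewrite -[LHS]/(Lb b (LB (C ++ D) phi) 0) Lb0E fb_weight0// linear0.
Qed.

(** Start from a linear form that vanishes on the brackets of weight at most W
    and takes the value 1 on the given bracket. Degree by degree, subtract the
    polynomial in the dual coordinates that cancels the derivatives along the
    lists of basis fields. All other lists reduce to these: a derivative at
    the origin depends on its first field only through the value of that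
    field, which is a combination of basis fields of no larger weight, and
    LB_move brings the remaining fields to the front. Lists longer than their
    weight are then killed for free. *)
Lemma obstruction_function W bstar :
  (forall bs : seq Br, all (fun b => 1 <= n1 b <= W)%N bs ->
     fb bstar 0 \notin <<[seq fb b 0 | b <- bs]>>%VS) ->
  exists phi, [/\ analytic 1 phi, forall B, (weight B <= W)%N -> LB B phi 0 = 0 &
    Lb bstar phi 0 = 1].
Proof.
move=> nspan; have [bs [bsW bsf bsS]] := adapted_basis W.
pose X := [seq fb b 0 | b <- bs]; pose q := size X.
have [|p [xi [p1 pX xiX]]] := @dual_forms _ _ (fb bstar 0) X.
  by rewrite free_cons nspan.
pose b_ (i : 'I_q) := nth X0 bs i.
have szX : size X = size bs by rewrite size_map.
have ltX (i : 'I_q) : (i < size bs)%N by rewrite -szX.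
have bE (i : 'I_q) : fb (b_ i) 0 = X`_i by rewrite (nth_map X0).
have xib i j : lin_row (xi i) (fb (b_ j) 0) = (i == j)%:R by rewrite bE xiX.
have bcomb b : (n1 b <= W)%N -> exists a : 'I_q -> R,
    fb b 0 = \sum_i a i *: fb (b_ i) 0 /\ forall i, a i != 0 -> (n1 (b_ i) <= n1 b)%N.
  move=> /bsS /(@span_filter_comb (fun c => fb c 0) (fun c => n1 c <= n1 b)%N)[a [E aP]].
  by exists a; rewrite E -szX; split => // i; exact: aP.
suff step n : exists phi, [/\ analytic 1 phi, kills W phi n.+1 & Lb bstar phi 0 = 1].
  have [phi [pa pk pb]] := step W; exists phi; split => // B BW.
  have H m : kills W phi (m + W.+1).
    elim: m => [|m IH]; first exact: pk.
    rewrite addSn; apply: kills_more => //; first exact: analytic_weak pa.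
    by rewrite (leq_trans (leqnSn W))// leq_addl.
  by apply: (H (size B)) => //; exact: leq_addr.
elim: n => [|n [phi [pa pk pb]]].
  exists (lin_row p); split; [exact: lin_row_analytic| |by rewrite Lb_lin_row].
  move=> [_ _|b [|//] _]; first by rewrite [LB _ _]/= linear0.
  rewrite -[weight _]/(n1 b + 0)%N addn0 => bW.
  rewrite -[LB _ _]/(Lb b (lin_row p)) Lb_lin_row// .
  have [a [-> _]] := bcomb b bW; rewrite linear_sum big1// => i _.
  by rewrite linearZ /= bE pX scaler0.
have pa0 : analytic 0 phi := analytic_weak (leq0n _) pa.
pose G J := if (size J == n.+2) && (weight (map b_ J) <= W)%N then LB (map b_ J) phi 0 else 0.
have Gs : symmetric_fun G.
  move=> J J' JJ; rewrite /G -(perm_size JJ).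
  have <- : weight (map b_ J) = weight (map b_ J').
    by rewrite /weight -!map_comp; apply: perm_sumn; exact: perm_map.
  case: ifP => // /andP[/eqP sJ wJ].
  by apply: (LB_perm (b_ := b_) (H := [::]) pa0 pk JJ); rewrite ?size_map ?sJ.
pose Q := symm_poly xi n.+2 G.
have Qa : analytic n.+2 Q by exact: symm_poly_analytic.
have Qa0 : analytic 0 Q := analytic_weak (leq0n _) Qa.
have Q0 B : (size B < n.+2)%N -> LB B Q 0 = 0.
  move=> sB; apply: (analytic_at0 r0 _ (LB_analytic B Qa)).
  by rewrite subn_gt0.
have LBQ B : LB B (phi - Q) 0 = LB B phi 0 - LB B Q 0 by rewrite LB_sub.
have p'a0 : analytic 0 (phi - Q) by exact: analytic_sub.
have p'k : kills W (phi - Q) n.+1.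
  by move=> B sB wB; rewrite LBQ Q0// subr0 pk.
exists (phi - Q); split.
- apply: analytic_sub => //; exact: analytic_weak Qa.
- move=> B; rewrite leq_eqVlt => /orP[/eqP sB wB|]; last by rewrite ltnS; exact: p'k.
  suff H m : forall B J, size B = m -> size (B ++ map b_ J) = n.+2 ->
      (weight (B ++ map b_ J) <= W)%N -> LB (B ++ map b_ J) (phi - Q) 0 = 0.
    by have := H _ B [::] erefl; rewrite cats0; exact.
  elim: m => [|m IH] {sB wB}B J.
    move/size0nil => -> /=; rewrite size_map => sJ wJ.
    rewrite LBQ; have := LB_symm_poly xib J Gs; rewrite sJ -/Q => ->.
    by rewrite /G sJ eqxx wJ subrr.
  case: B => [//|b B] [sB] /= [sBJ] wBJ.
  have E : LB (b :: B ++ map b_ J) (phi - Q) 0 = lin_row (fun i => pd r i (LB (B ++ map b_ J) (phi - Q)) 0) (fb b 0).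
    exact: Lb0E.
  have wE c : weight (c :: B ++ map b_ J) = (n1 c + weight (B ++ map b_ J))%N by [].
  have [a [bE' aP]] := bcomb b (leq_trans (leq_addr _ _) wBJ).
  rewrite -[LHS]/(LB (b :: B ++ map b_ J) (phi - Q) 0) E bE' linear_sum big1// => i _; rewrite linearZ /= -Lb0E.
  have [->|ai] := eqVneq (a i) 0; first by rewrite scale0r.
  have bib := aP i ai.
  rewrite -[Lb _ _]/(LB ([::] ++ b_ i :: B ++ map b_ J) (phi - Q)).
  rewrite -(LB_move p'a0 p'k) /=; first last.
  + move: wBJ; rewrite wE !weight_cat -[weight (_ :: map b_ J)]/(n1 (b_ i) + weight (map b_ J))%N; lia.
  + by move: sBJ; rewrite !size_cat /=; lia.
  rewrite -[b_ i :: map b_ J]/(map b_ (i :: J)) IH ?scaler0//.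
  + by move: sBJ; rewrite !size_cat /=; lia.
  + move: wBJ; rewrite wE !weight_cat -[weight (map b_ (i :: J))]/(n1 (b_ i) + weight (map b_ J))%N; lia.
- by rewrite -[Lb _ _]/(LB [:: bstar] (phi - Q)) LBQ Q0// subr0.
Qed.

(** * Functions invisible to brackets of small weight *)

Definition L1pow j h := iter j Lf1 h.

Lemma L1pow_analytic j h : analytic 0 h -> analytic 0 (L1pow j h).
Proof. by move=> ha; elim: j => [//|j IH]; exact: analytic_lie0. Qed.

(** The functions invisible to brackets of total weight below m. Applying f0
    preserves this class and applying f1 lowers m by one; this grading
    organizes all the estimates. *)
Definition vanishing m h := analytic 0 h /\ forall B, (weight B < m)%N -> LB B h 0 = 0.

Lemma vanishing_Lf0 m h : vanishing m h -> vanishing m (Lf0 h).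
Proof.
move=> [ha hv]; split => [|B wB]; first exact: analytic_lie0.
have := hv (B ++ [:: Defs.X0]); rewrite LB_cat weight_cat addn0; exact.
Qed.

Lemma L1powE j h : L1pow j h = LB (nseq j Defs.X1) h.
Proof. by elim: j => [//|j IH]; rewrite -[RHS]/(Lf1 (LB (nseq j Defs.X1) h)) -IH. Qed.

Lemma vanishing_L1pow j m h : vanishing m h -> vanishing (m - j) (L1pow j h).
Proof.
move=> [ha hv]; split => [|B wB]; first exact: L1pow_analytic.
have := hv (B ++ nseq j Defs.X1); rewrite LB_cat weight_cat -L1powE; apply.
have -> : weight (nseq j Defs.X1) = j by rewrite /weight map_nseq sumn_nseq mul1n.
lia.
Qed.

Lemma vanishing_order m n h : (m <= n)%N -> analytic n h -> vanishing m h.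
Proof.
move=> mn ha; split => [|B wB]; first exact: analytic_weak ha.
by apply: (LB_order ha); exact: leq_trans mn.
Qed.

Lemma vanishing_analytic1 m h : (0 < m)%N -> vanishing m h -> analytic 1 h.
Proof. by move=> m0 [ha hv]; apply: analytic1 => //; exact: (hv [::]). Qed.

Lemma vanishing_sub m h g : vanishing m h -> vanishing m g -> vanishing m (h - g).
Proof.
move=> [ha hv] [ga gv]; split => [|B wB]; first exact: analytic_sub.
rewrite (LB_sub _ ha ga) -[LHS]/(LB B h 0 - LB B g 0).
by rewrite hv// gv// subrr.
Qed.

Definition jet_poly N (c : 'rV[R]_(size (@words d N))) : 'rV[R]_d -> R :=
  fun x => \sum_i c 0 i * ev_word x (nth [::] (words N) i).

(** Modulo functions of order N only the jets of order N matter, and they form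
    a space of finite dimension. *)
Lemma vanishing_generated m N : (m <= N)%N -> exists q (e : 'I_q -> 'rV[R]_d -> R),
  (forall i, vanishing m (e i)) /\
  forall h, vanishing m h -> exists a : 'I_q -> R, analytic N (h - \sum_i a i *: e i).
Proof.
move=> mN; have [cs [csP csS]] := spanning_seq (fun c : 'rV[R]_(size (@words d N)) => vanishing m (jet_poly c)).
pose q := size cs; pose X := in_tuple cs.
exists q, (fun i : 'I_q => jet_poly (tnth X i)); split => [i|h hm].
  by apply: csP; exact: mem_tnth.
have [c cE] := analytic_jet r0 N hm.1.
pose c' : 'rV[R]_(size (@words d N)) := \row_i c (nth [::] (words N) i).
have E : (fun x : 'rV[R]_d => \sum_(w <- words N) c w * ev_word x w) = jet_poly c'.
  apply/funext => x; rewrite (big_nth [::]) big_mkord; apply: eq_bigr => i _.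
  by rewrite mxE.
rewrite E in cE.
have c'P : vanishing m (jet_poly c').
  have -> : jet_poly c' = h - (h - jet_poly c') by rewrite opprB addrC subrK.
  by apply: vanishing_sub => //; exact: vanishing_order cE.
exists (fun i => coord X i c').
suff -> : \sum_i coord X i c' *: jet_poly (tnth X i) = jet_poly c' by [].
apply/funext => x; rewrite fct_sumE.
rewrite [in RHS](coord_span (csS _ c'P : c' \in <<X>>%VS)).
have L (a : R) (c1 c2 : 'rV[R]_(size (@words d N))) :
    jet_poly (a *: c1 + c2) x = a * jet_poly c1 x + jet_poly c2 x.
  rewrite /jet_poly mulr_sumr -big_split; apply: eq_bigr => i _.
  by rewrite /= !mxE; ring.
have jet0 : @jet_poly N 0 x = 0 by rewrite /jet_poly big1// => i _; rewrite mxE mul0r.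
elim/big_ind2: _ => [|c1 y c2 z -> ->|i _]; first by rewrite jet0.
  by have := L 1 c1 c2; rewrite scale1r mul1r.
by rewrite -[LHS]/(coord X i c' * jet_poly (tnth X i) x) (tnth_nth 0) -[_ *: _]addr0 L jet0 addr0.
Qed.

(** The iterated commutator [L_f1, [L_f1, ... L_f0]] expanded by the binomial
    formula. *)
Lemma lie_ad n h : analytic 0 h ->
  lie r (ad f1 n f0) h = \sum_(j < n.+1) ((-1) ^+ j * 'C(n, j)%:R) *: L1pow (n - j) (Lf0 (L1pow j h)).
Proof.
have ad_a m : vanalytic r (ad f1 m f0).
  by elim: m => [//|m IH]; exact: vanalytic_bracket.
have ga j l g : analytic 0 g -> analytic 0 (L1pow l (Lf0 (L1pow j g))).
  by move=> g0; apply: L1pow_analytic => //; apply: analytic_lie0 => //; exact: L1pow_analytic.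
elim: n h => [|n IH] h ha.
  by rewrite big_ord1 bin0 expr0 mulr1 scale1r.
rewrite -[ad f1 n.+1 f0]/(lie_bracket f1 (ad f1 n f0)) lie_comm//.
have L1a : analytic 0 (Lf1 h) by exact: analytic_lie0.
rewrite !IH// lie_sum => [|j _]; last by apply: analytic_scale; exact: ga.
under eq_bigr => j _ do rewrite (lie_scale _ _ (ga j (n - j)%N h ha)).
have E1 : \sum_(j < n.+1) ((-1) ^+ j * 'C(n, j)%:R) *: Lf1 (L1pow (n - j) (Lf0 (L1pow j h))) =
   \sum_(j < n.+2) ((-1) ^+ j * 'C(n, j)%:R) *: L1pow (n.+1 - j) (Lf0 (L1pow j h)).
  rewrite [RHS]big_ord_recr /= bin_small// mulr0 scale0r addr0.
  by apply: eq_bigr => j _; rewrite subSn// -ltnS.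
have E2 : \sum_(j < n.+1) ((-1) ^+ j * 'C(n, j)%:R) *: L1pow (n - j) (Lf0 (L1pow j (Lf1 h))) =
  - \sum_(j < n.+2) ((-1) ^+ j * (if val j is i.+1 then 'C(n, i) else 0)%:R) *: L1pow (n.+1 - j) (Lf0 (L1pow j h)).
  rewrite [in RHS]big_ord_recl /= mulr0 scale0r add0r -sumrN; apply: eq_bigr => j _.
  rewrite /bump /= add1n subSS exprS mulN1r mulNr scaleNr opprK.
  by rewrite /L1pow -iterSr.
rewrite E1 E2 opprK -big_split; apply: eq_bigr => -[[|j] jn] _ /=.
  by rewrite mulr0 scale0r addr0 !bin0.
by rewrite -scalerDl -mulrDr -natrD binS.
Qed.

End bracket_words.

(** * Transport along the flow of f1 *)

Section trajectories.
Variable rx : R.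
Hypothesis rr : 0 < rx < r.
Implicit Types (T rv : R) (u : R -> R) (x : R -> 'rV[R]_d).

Definition traj rv T u x : Prop :=
  [/\ 0 <= T, L1 T u, {within `[0, T], continuous x},
      forall s, 0 <= s <= T -> `|x s| <= rx /\ `|primitive u s| <= rv &
      forall s, 0 <= s <= T -> forall i : 'I_d,
        x s 0 i = \int[lebesgue_measure]_(y in `[0, s]) (f0 (x y) 0 i + u y * f1 (x y) 0 i)].

(** The truncation at order N of h transported back along the flow of f1 for
    the time v. Since v is the primitive of the control, this quantity does
    not feel the control directly. *)
Definition pull N h (v : R -> R) x (s : R) : R := \sum_(j < N) exp_coef j * (v s ^+ j * L1pow j h (x s)).
(** The part of the time derivative of pull that does not contain the
    control. *)
Definition drift N h (v : R -> R) x (s : R) : R := \sum_(j < N) exp_coef j * (v s ^+ j * Lf0 (L1pow j h) (x s)).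

Section one_trajectory.
Variables (rv T : R) (u : R -> R) (x : R -> 'rV[R]_d).
Hypothesis tr : traj rv T u x.
Let v := primitive u.

Lemma abscont_v : abscont T v u.
Proof.
have [T0 ui _ _ _] := tr; split; first exact: ui.
by move=> s _; rewrite /v primitive0 add0r.
Qed.

Lemma traj_x0 : x 0 = 0.
Proof.
have [T0 _ _ _ xE] := tr; apply/rowP => i.
by rewrite xE ?lexx// set_itv1 Rintegral_set1 mxE.
Qed.

Lemma traj_C0 q h : analytic q h -> C0 T (h \o x).
Proof.
have [T0 ui xc xB xE] := tr.
by apply: (C0_comp rr xc) => s /xB[].
Qed.

Lemma traj_abscont i : abscont T (fun s => x s 0 i) (coordf f0 i \o x + u * (coordf f1 i \o x)).
Proof.
have [T0 ui xc xB xE] := tr; split.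
  by apply: L1_add; [apply: L1_C0; exact: traj_C0 (f0a i)|apply: L1_mul_C0 => //; exact: traj_C0 (f1a i)].
by move=> s sT; rewrite traj_x0 mxE add0r xE.
Qed.

Lemma traj_chain q h : analytic q h -> abscont T (h \o x) (Lf0 h \o x + u * (Lf1 h \o x)).
Proof.
move=> ha; have [T0 ui xc xB xE] := tr.
have := chain_rule T0 rr xc (fun s sT => (xB s sT).1) traj_abscont ha.
congr (abscont _ _); apply/funext => s; rewrite fct_sumE.
rewrite -[RHS]/(Lf0 h (x s) + u s * Lf1 h (x s)) !lieE /lin_row mulr_sumr -big_split.
apply: eq_bigr => i _ /=.
rewrite -[LHS]/((f0 (x s) 0 i + u s * f1 (x s) 0 i) * pd r i h (x s)); ring.
Qed.

(** The contributions of u telescope, and only the last term of the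
    exponential series remains. *)
Lemma pull_abscont M h : analytic 0 h ->
  abscont T (pull M.+1 h v x) (drift M.+1 h v x + u * (fun s => exp_coef M * (v s ^+ M * L1pow M.+1 h (x s)))).
Proof.
move=> ha; have [T0 ui xc xB xE] := tr.
have F j : abscont T (exp_coef j *: ((fun s => v s ^+ j) * (L1pow j h \o x)))
    (exp_coef j *: ((fun s => j%:R * v s ^+ j.-1 * u s) * (L1pow j h \o x) +
       (Lf0 (L1pow j h) \o x + u * (Lf1 (L1pow j h) \o x)) * (fun s => v s ^+ j))).
  by apply: abscont_scale => //; apply: abscont_mul => //; [apply: abscont_exp => //; exact: abscont_v|exact: traj_chain (L1pow_analytic _ ha)].
have := @abscont_sum R T _ (index_enum 'I_M.+1) xpredT _ _ (fun j _ => F (nat_of_ord j)).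
congr (abscont _ _); apply/funext => s; rewrite fct_sumE.
  by apply: eq_bigr => j _.
rewrite -[RHS]/(drift M.+1 h v x s + u s * (exp_coef M * (v s ^+ M * L1pow M.+1 h (x s)))) /drift.
elim: M => [|M IH].
  rewrite !big_ord1 -[LHS]/(exp_coef 0 * (0%:R * 1 * u s * h (x s) + (Lf0 h (x s) + u s * Lf1 h (x s)) * 1)).
  by rewrite /= expr0; ring.
rewrite big_ord_recr IH [in RHS]big_ord_recr /=.
rewrite -[Lf1 (L1pow M h)]/(L1pow M.+1 h) -[Lf1 (L1pow M.+1 h)]/(L1pow M.+2 h).
set S := \sum_(i < M.+1) _.
rewrite -[X in _ + X]/(exp_coef M.+1 * (M.+1%:R * v s ^+ M * u s * L1pow M.+1 h (x s) +
   (Lf0 (L1pow M.+1 h) (x s) + u s * L1pow M.+2 h (x s)) * v s ^+ M.+1)).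
have := @exp_coefS R M; move: (exp_coef M) (exp_coef M.+1) (L1pow M.+1 h (x s)) (L1pow M.+2 h (x s)) (Lf0 _ _) => a b c e l ba.
rewrite !mulrDr.
have -> : b * (M.+1%:R * v s ^+ M * u s * c) = (M.+1%:R * b) * v s ^+ M * u s * c by ring.
by rewrite ba; ring.
Qed.

Lemma drift_C0 N h : analytic 0 h -> C0 T (drift N h v x).
Proof.
move=> ha; rewrite (_ : drift N h v x = \sum_(j < N) exp_coef j *: ((fun s => v s ^+ j) * (Lf0 (L1pow j h) \o x))).
  have [T0 ui xc xB xE] := tr.
  apply: C0_sum => j _; apply: C0_scale; apply: C0_mul.
    by apply: C0_exp; apply: abscont_C0 T0 _ _ abscont_v.
  by apply: traj_C0; apply: analytic_lie0 => //; exact: L1pow_analytic.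
by apply/funext => s; rewrite fct_sumE.
Qed.

Lemma v_C0 : C0 T v.
Proof. by have [T0 _ _ _ _] := tr; exact: abscont_C0 T0 _ _ abscont_v. Qed.

Lemma vexp_C0 n : C0 T (fun s => `|v s| ^+ n).
Proof. by apply: C0_exp; apply: C0_norm; exact: v_C0. Qed.

End one_trajectory.

(** Apply the product rule to a truncation of order M and let M tend to
    infinity: the term containing u is bounded by 2^-M times the integral of
    |u|, while the terms of degree at least N in v sum to O(|v|^N). The
    constant K does not depend on u. *)
Lemma transport_estimate : exists2 rv, 0 < rv & forall h N, analytic 1 h ->
  exists2 K, 0 <= K & forall T u x, traj rv T u x -> forall s, 0 <= s <= T ->
    `|pull N h (primitive u) x s - primitive (drift N h (primitive u) x) s| <=
    K * (`|primitive u s| ^+ N + primitive (fun y => `|primitive u y| ^+ N) T).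
Proof.
have [C C0 growth] := lie_growth f1a f0a rr.
(* Then C |v| <= 1/4, which beats the factor M + 1 lost by the last term of
   the series: (M + 1) 4^-M <= 2^-M. *)
have rv0 : 0 < 1 / (4 * C) by rewrite divr_gt0// mulr_gt0.
exists (1 / (4 * C)) => // h N ha1.
have ha : analytic 0 h := analytic_weak (leq0n _) ha1.
have [K K0 hK] := growth h ha.
have K1 : 0 <= 2 * K * C ^+ N by rewrite !mulr_ge0// exprn_ge0// ltW.
exists (2 * K * C ^+ N) => // T u x tr s sT.
have [T0 ui xc xB xE] := tr; set v := primitive u.
have Cv y : 0 <= y <= T -> C * `|v y| <= 1 / 4.
  move=> /xB[_]; rewrite -/v => vy; apply: le_trans (ler_wpM2l (ltW C0) vy) _.
  by rewrite le_eqVlt; apply/orP; left; apply/eqP; field; rewrite gt_eqF.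
have vN : L1 T (fun y => `|v y| ^+ N) by apply: L1_C0; exact: (vexp_C0 tr (n := N)).
have ui' := L1_norm ui.
apply/ler_addgt0Pr => e e0.
pose U := primitive (fun y => `|u y|) T.
have mono (g : R -> R) : L1 T g -> (forall y, 0 <= g y) -> 0 <= primitive g s <= primitive g T.
  move=> gi g0; have [s0 sT'] := andP sT.
  have A := @primitive_le _ T (cst 0) g 0 s (lexx 0) s0 sT' (L1_cst _ _) gi (fun y _ => g0 y).
  have B := @primitive_le _ T (cst 0) g s T s0 sT' (lexx T) (L1_cst _ _) gi (fun y _ => g0 y).
  by move: A B; rewrite !primitive_cst// primitive0; lra.
have U0 : 0 <= U by have := mono _ ui' (fun y => normr_ge0 _); rewrite /U; lra.
have [m mU] : exists m, K * C * U / e <= 2 ^+ m.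
  exists (Num.bound (K * C * U / e)); apply: ltW; apply: lt_le_trans (archi_boundP _) _.
    by rewrite !mulr_ge0// ?invr_ge0 ltW.
  by rewrite -natrX ler_nat ltnW// ltn_expl.
pose M := (N + m)%N.
pose rem y := exp_coef M * (v y ^+ M * L1pow M.+1 h (x y)).
have remB y : 0 <= y <= T -> `|rem y| <= K * C / 2 ^+ M.
  move=> yT; have [xy _] := xB y yT.
  have [hy _] := hK M.+1 (x y) xy.
  rewrite /rem normrM norm_exp_coef normrM normrX.
  have fp : 0 < M`!%:R :> R by rewrite ltr0n fact_gt0.
  rewrite mulrC ler_pdivrMr//.
  apply: le_trans (ler_wpM2l (exprn_ge0 _ (normr_ge0 _)) hy) _.
  rewrite factS natrM exprS.
  have -> : `|v y| ^+ M * (K * (C * C ^+ M) * (M.+1%:R * M`!%:R)) =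
     K * C * M`!%:R * (M.+1%:R * (C * `|v y|) ^+ M) by rewrite exprMn; ring.
  have -> : K * C / 2 ^+ M * M`!%:R = K * C * M`!%:R * (2 ^+ M)^-1 by ring.
  rewrite ler_wpM2l ?mulr_ge0 ?(ltW C0)//.
  have p1 : (C * `|v y|) ^+ M <= (1 / 4) ^+ M.
    by rewrite lerXn2r ?nnegrE ?mulr_ge0 ?(ltW C0) ?Cv.
  apply: le_trans (ler_wpM2l _ p1) _ => //.
  have p2 : 0 < (2 : R) ^+ M by rewrite exprn_gt0.
  rewrite -[leRHS]mul1r ler_pdivlMr// expr_div_n expr1n.
  have -> : (4 : R) ^+ M = 2 ^+ M * 2 ^+ M by rewrite -exprMn; congr (_ ^+ _); ring.
  have -> : M.+1%:R * (1 / (2 ^+ M * 2 ^+ M)) * 2 ^+ M = M.+1%:R / 2 ^+ M :> R.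
    by field; rewrite gt_eqF.
  by rewrite ler_pdivrMr// mul1r -natrX ler_nat ltn_expl.
have vc := v_C0 tr.
have [Gi GE] := pull_abscont tr M ha.
rewrite -/v in Gi GE.
pose g : R -> R := (2 * K * C ^+ N) *: (fun y => `|v y| ^+ N) + (K * C / 2 ^+ M) *: (fun y => `|u y|).
have gi : L1 T g by apply: L1_add; exact: L1_scale.
have KCM : 0 <= K * C / 2 ^+ M by rewrite divr_ge0 ?exprn_ge0 ?mulr_ge0// ltW.
have Mn : M.+1 = (N + m.+1)%N by rewrite /M addnS.
have Di : L1 T (drift N h v x) by apply: L1_C0; exact: (drift_C0 tr ha).
have pull0 : pull M.+1 h v x 0 = 0.
  rewrite /pull big_ord_recl big1 => [|i _].
    rewrite -[L1pow _ _]/h (traj_x0 tr) (analytic_at0 r0 (ltn0Sn 0) ha1) ?mulr0 ?addr0//.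
  by rewrite /v primitive0 exprS mul0r mul0r mulr0.
have Q y : 0 <= y <= T -> C * `|v y| <= 1 / 2 by move/Cv; lra.
have E : pull N h v x s - primitive (drift N h v x) s =
   - (pull M.+1 h v x s - pull N h v x s) +
   (primitive (drift M.+1 h v x + u * rem - drift N h v x) s -
    primitive (drift M.+1 h v x + u * rem - drift N h v x) 0).
  rewrite primitive0 subr0 (@primitive_sub _ T)//; last by case/andP: sT.
  by rewrite (GE s sT) pull0 -/rem; ring.
rewrite E; apply: le_trans (ler_normD _ _) _; rewrite normrN.
have b1 : `|pull M.+1 h v x s - pull N h v x s| <= 2 * K * C ^+ N * `|v s| ^+ N.
  rewrite Mn; apply: (@tail_le R (fun j => L1pow j h (x s))) => //; [exact: ltW|exact: Q|].
  by move=> j; have [xs _] := xB s sT; exact: (hK j _ xs).1.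
have b2 : `|primitive (drift M.+1 h v x + u * rem - drift N h v x) s -
    primitive (drift M.+1 h v x + u * rem - drift N h v x) 0| <= primitive g s - primitive g 0.
  apply: (@primitive_norm_le _ T) => //; [by case/andP: sT|by case/andP: sT|exact: L1_sub_fun|].
  move=> y /andP[y0 ys]; have yT : 0 <= y <= T by case/andP: sT; lra.
  rewrite -[X in `|X|]/(drift M.+1 h v x y + u y * rem y - drift N h v x y).
  have -> : drift M.+1 h v x y + u y * rem y - drift N h v x y =
    (drift M.+1 h v x y - drift N h v x y) + u y * rem y by ring.
  apply: le_trans (ler_normD _ _) _; apply: lerD.
    rewrite Mn; apply: (@tail_le R (fun j => Lf0 (L1pow j h) (x y))) => //; [exact: ltW|exact: Q|].
    by move=> j; have [xs _] := xB y yT; exact: (hK j _ xs).2.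
  by rewrite normrM mulrC ler_wpM2r// remB.
apply: le_trans (lerD b1 b2) _.
have sT' : s <= T by case/andP: sT.
rewrite primitive0 subr0 (@primitive_add _ T)//; [|exact: L1_scale|exact: L1_scale].
rewrite !(@primitive_scale _ T)// mulrDr -addrA lerD2l.
have /andP[_ m1] := mono _ vN (fun y => exprn_ge0 _ (normr_ge0 _)).
have /andP[_ m2] := mono _ ui' (fun y => normr_ge0 _).
apply: lerD; first by rewrite ler_wpM2l.
apply: le_trans (ler_wpM2l KCM m2) _; rewrite -/U.
have p2 : 0 < (2 : R) ^+ M by rewrite exprn_gt0.
rewrite mulrAC ler_pdivrMr//.
rewrite ler_pdivrMr// in mU; apply: le_trans mU _.
rewrite mulrC ler_wpM2l ?(ltW e0)// /M exprD ler_peMl ?exprn_ge0//.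
by rewrite exprn_ege1// ler1n.
Qed.

(** * A priori estimates along trajectories *)

Section estimates.
Variable rv : R.
Hypothesis rv1 : rv <= 1.
Local Notation traj := (traj rv).
Local Notation V T u := (vint (primitive u) T).
Hypothesis pull_drift : forall h N, analytic 1 h ->
  exists2 K, 0 <= K & forall T u x, traj T u x -> forall s, 0 <= s <= T ->
    `|pull N h (primitive u) x s - primitive (drift N h (primitive u) x) s| <=
    K * (`|primitive u s| ^+ N + V T u N).

Lemma ball_bound n (q : 'I_n -> nat) (h : 'I_n -> 'rV[R]_d -> R) :
  (forall j, analytic (q j) (h j)) -> exists2 K, 0 <= K &
  forall j y, `|y| <= rx -> `|h j y| <= K * `|y| ^+ q j.
Proof.
move=> ha; apply: uniform_constant => [j K K' KK H y yr|j]; last exact: analytic_order (ha j) rr.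
by apply: le_trans (H y yr) _; rewrite ler_wpM2r ?exprn_ge0.
Qed.

Lemma primitive_norm_bound T (f g : R -> R) s : C0 T f -> C0 T g ->
  (forall y, 0 <= y <= T -> `|f y| <= g y) -> 0 <= s <= T -> `|primitive f s| <= primitive g T.
Proof.
move=> fc gc fg /andP[s0 sT].
have := @primitive_norm_le _ T f g 0 s (lexx 0) s0 sT (L1_C0 fc) (L1_C0 gc).
rewrite !primitive0 !subr0 => H.
have {}H : `|primitive f s| <= primitive g s.
  by apply: H => y /andP[y0 ys]; apply: fg; rewrite y0 (le_trans ys).
apply: le_trans H _.
have : `|primitive (cst 0) T - primitive (cst 0) s| <= primitive g T - primitive g s.
  apply: (@primitive_norm_le _ T) => //; [exact: L1_cst|exact: L1_C0|move=> y /andP[sy yT] /=].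
  by rewrite normr0 (le_trans _ (fg y _))// yT (le_trans s0).
by move=> /(le_trans (normr_ge0 _)); rewrite subr_ge0.
Qed.

Section sizes.
Variables (T : R) (u : R -> R) (x : R -> 'rV[R]_d).
Hypothesis tr : traj T u x.

Lemma v_le1 s : 0 <= s <= T -> `|primitive u s| <= 1.
Proof. by have [_ _ _ xB _] := tr => /xB[_ /le_trans]; apply. Qed.

Lemma v_exp_le m n s : 0 <= s <= T -> (m <= n)%N -> `|primitive u s| ^+ n <= `|primitive u s| ^+ m.
Proof. by move=> sT mn; apply: ler_wiXn2l => //; exact: v_le1. Qed.

Lemma traj_T0 : 0 <= T. Proof. by case: tr. Qed.

End sizes.

Lemma f0_analytic1 i : analytic 1 (coordf f0 i).
Proof. by apply: analytic1 => //; rewrite /coordf f00 mxE. Qed.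

(** With N = 1, each coordinate of x is the integral of that of f0 up to O(|v|
    + V 1), and this integral is at most a multiple of T sup |x| because f0
    vanishes at the origin; absorb it for small T. *)
Lemma state_bound : exists Tm K, [/\ 0 < Tm, 2 * Tm <= 1, 0 <= K &
  forall T u x, traj T u x -> T <= Tm -> forall s, 0 <= s <= T ->
    `|x s| <= K * (`|primitive u s| + V T u 1)].
Proof.
pose c (i : 'I_d) := fun y : 'rV[R]_d => y 0 i.
have ca i : analytic 1 (c i) by exact: analytic_coord.
have [K K0 hK] := @uniform_constant R d (fun i K => forall T u x, traj T u x -> forall s, 0 <= s <= T ->
    `|pull 1 (c i) (primitive u) x s - primitive (drift 1 (c i) (primitive u) x) s| <=
    K * (`|primitive u s| ^+ 1 + V T u 1)) 
  (fun i K K' KK H T u x tr s sT => le_trans (H T u x tr s sT)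
    (ler_wpM2r (addr_ge0 (exprn_ge0 _ (normr_ge0 _)) (vint_ge0 _ _ _)) KK))
  (fun i => pull_drift 1 (ca i)).
have [A A0 hA] := ball_bound (fun i : 'I_d => analytic_lie1 f0_analytic1 (ca i)).
have A1 : 0 < 2 * (A + 1) by lra.
exists (1 / (2 * (A + 1))), (K + 2 * (K + A * K)); split.
- by rewrite divr_gt0.
- by rewrite mulrA mulr1 ler_pdivrMr//; lra.
- by rewrite !addr_ge0 ?mulr_ge0// addr_ge0// mulr_ge0.
move=> T u x tr; rewrite ler_pdivlMr// => TT s sT.
have T0 := traj_T0 tr; have V0 := vint_ge0 T (primitive u) 1.
have [_ _ _ xB _] := tr.
have vc := v_C0 tr.
have := @absorb R T rx ((K + A * K) * V T u 1) (fun s => `|x s| - K * `|primitive u s|).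
move=> /(_ _ _ _ _ s sT) H.
suff : `|x s| - K * `|primitive u s| <= 2 * ((K + A * K) * V T u 1).
  by have := mulr_ge0 K0 V0; have := mulr_ge0 (mulr_ge0 A0 K0) (normr_ge0 (primitive u s));
     have := mulr_ge0 K0 (normr_ge0 (primitive u s)); nra.
apply: H; [by case/andP: rr => /ltW|by rewrite mulr_ge0// addr_ge0// mulr_ge0| |].
  move=> y yT; have [xy _] := xB y yT; apply: le_trans xy.
  by rewrite gerBl mulr_ge0.
move=> B B0 HB y yT.
have AT : A * T <= 1 / 2 by lra.
have ATB : A * T * B <= 1 / 2 * B by rewrite ler_wpM2r.
suff S : `|x y| <= K * (`|primitive u y| + V T u 1) + (A * B * T + A * K * V T u 1) by lra.
have V0' := mulr_ge0 (mulr_ge0 A0 K0) V0.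
have ABT : 0 <= A * B * T by rewrite !mulr_ge0.
apply: le_row => [|i]; first by rewrite addr_ge0 ?addr_ge0// mulr_ge0// addr_ge0.
have exp_coef0 : exp_coef 0 = 1 :> R by rewrite /exp_coef fact0 expr0 divr1.
have pE z : pull 1 (c i) (primitive u) x z = x z 0 i.
  by rewrite /pull big_ord1 exp_coef0 expr0 !mul1r.
have dE' z : drift 1 (c i) (primitive u) x z = Lf0 (c i) (x z).
  by rewrite /drift big_ord1 exp_coef0 expr0 !mul1r.
have H1 := hK i T u x tr y yT; rewrite pE expr1 in H1.
have H2 : `|primitive (drift 1 (c i) (primitive u) x) y| <= A * B * T + A * K * V T u 1.
  rewrite -(int_cst_add T0 vc); apply: primitive_norm_bound => //.
  - by apply: (drift_C0 tr); exact: analytic_weak (ca i).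
  - apply: (@C0_add _ T (cst (A * B)) ((A * K) *: (fun z => `|primitive u z| ^+ 1))); first exact: C0_cst.
    by apply: C0_scale; exact: vint_C0.
  move=> z zT; have [xz _] := xB z zT; rewrite dE'.
  apply: le_trans (hA i _ xz) _; rewrite !expr1 -!mulrA -mulrDr ler_wpM2l//.
  by have := HB z zT; lra.
have -> : x y 0 i = (x y 0 i - primitive (drift 1 (c i) (primitive u) x) y) +
   primitive (drift 1 (c i) (primitive u) x) y by rewrite subrK.
by apply: le_trans (ler_normD _ _) _; exact: lerD.
Qed.

Lemma pull_bounded N h : analytic 0 h -> exists2 K, 0 <= K &
  forall T u x, traj T u x -> forall s, 0 <= s <= T -> `|pull N h (primitive u) x s| <= K.
Proof.
move=> ha; have [K K0 hK] := ball_bound (fun j : 'I_N => L1pow_analytic j ha).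
exists (\sum_(j < N) K) => [|T u x tr s sT]; first exact: sumr_ge0.
have [_ _ _ xB _] := tr; have [xs _] := xB s sT.
rewrite /pull (le_trans (ler_norm_sum _ _ _))// ler_sum// => j _.
have := hK j _ xs; rewrite expr0 mulr1; apply: le_trans.
rewrite mulrA normrM ler_piMl// normrM norm_exp_coef normrX mulr_ile1 ?exprn_ge0 ?invr_ge0//.
  by exact: fact_inv_le1.
by apply: exprn_ile1 => //; exact: v_le1 tr s sT.
Qed.

(** The j-th Lie derivative lowers the order of vanishing by j, which the
    factor v^j restores. *)
Lemma pull_remainder N h : analytic N h -> exists2 K, 0 <= K &
  forall T u x, traj T u x -> forall s, 0 <= s <= T ->
    `|pull N h (primitive u) x s| <= K * (`|x s| + `|primitive u s|) ^+ N.
Proof.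
move=> ha.
have hja j : analytic (N - j) (L1pow j h).
  by elim: j => [|j IH]; rewrite ?subn0// subnS; exact: analytic_lie.
have [K K0 hK] := ball_bound (fun j : 'I_N => hja j).
exists (\sum_(j < N) K) => [|T u x tr s sT]; first exact: sumr_ge0.
have [_ _ _ xB _] := tr; have [xs _] := xB s sT.
rewrite /pull (le_trans (ler_norm_sum _ _ _))// mulr_suml ler_sum// => j _.
rewrite normrM norm_exp_coef mulrC ler_pdivrMr ?ltr0n ?fact_gt0//.
set w := `|x s| + _; have w0 : 0 <= w by rewrite addr_ge0.
apply: (@le_trans _ _ (K * w ^+ N)); last first.
  by rewrite ler_peMr ?ler1n ?fact_gt0// mulr_ge0// exprn_ge0.
have wE : w ^+ N = w ^+ j * w ^+ (N - j) by rewrite -exprD subnKC// ltnW.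
rewrite normrM normrX wE mulrCA.
apply: ler_pM; rewrite ?exprn_ge0//.
  by apply: lerXn2r; rewrite ?nnegrE// /w lerDr.
apply: le_trans (hK j _ xs) _; rewrite ler_wpM2l//.
by apply: lerXn2r; rewrite ?nnegrE// /w lerDl.
Qed.

Lemma L1pow_add i l psi : L1pow i (L1pow l psi) = L1pow (i + l) psi.
Proof. by rewrite /L1pow iterD. Qed.

(** The value of psi at the state is recovered from transported functions. *)
Lemma push_pull N psi : (0 < N)%N -> analytic 0 psi -> exists2 K, 0 <= K &
  forall T u x, traj T u x -> forall s, 0 <= s <= T ->
    `|\sum_(l < N) primitive u s ^+ l / l`!%:R * pull N (L1pow l psi) (primitive u) x s - psi (x s)|
    <= K * `|primitive u s| ^+ N.
Proof.
move=> N0 pa; have [K K0 hK] := ball_bound (fun j : 'I_(N + N) => L1pow_analytic j pa).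
exists (\sum_(n < N) `|conv_coef N (N + n)| * K) => [|T u x tr s sT].
  by apply: sumr_ge0 => n _; exact: mulr_ge0.
have [_ _ _ xB _] := tr; have [xs _] := xB s sT.
have := exp_inverse (primitive u s) (fun n => L1pow n psi (x s)) N0.
have -> : \sum_(l < N) primitive u s ^+ l / l`!%:R * pull N (L1pow l psi) (primitive u) x s =
  \sum_(l < N) primitive u s ^+ l / l`!%:R * \sum_(i < N) exp_coef i * (primitive u s ^+ i * L1pow (i + l) psi (x s)).
  apply: eq_bigr => l _; congr (_ * _); rewrite /pull; apply: eq_bigr => i _.
  by rewrite L1pow_add.
move=> ->; rewrite -[L1pow 0 psi _]/(psi (x s)) addrAC subrr add0r normrM normrX mulrC ler_wpM2r ?exprn_ge0//.
rewrite (le_trans (ler_norm_sum _ _ _))// ler_sum// => n _.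
rewrite normrM ler_wpM2l// normrM normrX.
have := hK (rshift N n) _ xs; rewrite expr0 mulr1 /= => hn.
apply: le_trans hn; rewrite ler_piMl//.
by apply: exprn_ile1 => //; exact: (v_le1 tr).
Qed.

(** These functions appear when the drift is expanded in powers of v. *)
Definition L101 j l h := L1pow l (Lf0 (L1pow j h)).

Lemma L101_analytic j l h : analytic 0 h -> analytic 0 (L101 j l h).
Proof.
by move=> ha; apply: L1pow_analytic => //; apply: analytic_lie0 => //; exact: L1pow_analytic.
Qed.

Lemma vanishing_L101 j l m h : vanishing m h -> vanishing (m - (j + l)) (L101 j l h).
Proof.
move=> hm; rewrite subnDA; apply: vanishing_L1pow => //; apply: vanishing_Lf0 => //.
exact: vanishing_L1pow.
Qed.

(** Replacing each L_f0 L_f1^j h by transported functions turns the drift into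
    a polynomial in v whose coefficients are again of the form pull. *)
Lemma drift_expand N h : (0 < N)%N -> analytic 0 h -> exists2 K, 0 <= K &
  forall T u x, traj T u x -> forall s, 0 <= s <= T ->
    `|\sum_(j < N) \sum_(l < N) exp_coef j / l`!%:R * (primitive u s ^+ (j + l) * pull N (L101 j l h) (primitive u) x s)
      - drift N h (primitive u) x s| <= K * `|primitive u s| ^+ N.
Proof.
move=> N0 ha.
have La j : analytic 0 (Lf0 (L1pow j h)) by apply: analytic_lie0 => //; exact: L1pow_analytic.
have [K K0 hK] := @uniform_constant R N (fun j K => forall T u x, traj T u x -> forall s, 0 <= s <= T ->
    `|\sum_(l < N) primitive u s ^+ l / l`!%:R * pull N (L1pow l (Lf0 (L1pow j h))) (primitive u) x s - Lf0 (L1pow j h) (x s)|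
    <= K * `|primitive u s| ^+ N)
  (fun i K K' KK H T u x tr s sT => le_trans (H T u x tr s sT) (ler_wpM2r (exprn_ge0 _ (normr_ge0 _)) KK))
  (fun j => push_pull N0 (La j)).
exists (\sum_(j < N) K) => [|T u x tr s sT]; first exact: sumr_ge0.
rewrite /drift -sumrB (le_trans (ler_norm_sum _ _ _))// mulr_suml ler_sum// => j _.
have -> : \sum_(l < N) exp_coef j / l`!%:R * (primitive u s ^+ (j + l) * pull N (L101 j l h) (primitive u) x s) =
  exp_coef j * (primitive u s ^+ j * \sum_(l < N) primitive u s ^+ l / l`!%:R * pull N (L101 j l h) (primitive u) x s).
  rewrite !mulr_sumr; apply: eq_bigr => l _; rewrite exprD; ring.
rewrite -mulrBr -mulrBr mulrA normrM.
apply: le_trans (hK j T u x tr s sT); rewrite ler_piMl//.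
rewrite normrM norm_exp_coef normrX mulr_ile1 ?exprn_ge0 ?invr_ge0//.
  by exact: fact_inv_le1.
by apply: exprn_ile1 => //; exact: (v_le1 tr).
Qed.

Lemma fact_coef_le j l : `|exp_coef j / l`!%:R : R| <= 1.
Proof.
rewrite normrM norm_exp_coef normfV normr_nat mulr_ile1 ?invr_ge0//.
  by exact: fact_inv_le1.
by exact: fact_inv_le1.
Qed.

(** The a priori estimate to be established by induction on m, with the last
    term coming from the truncation at order N. *)
Definition pull_small m N Tm := forall m', (0 < m' <= m)%N -> forall h, vanishing m' h ->
  exists2 K, 0 <= K & forall T u x, traj T u x -> T <= Tm -> forall s, 0 <= s <= T ->
    `|pull N h (primitive u) x s| <= K * (V T u m' + `|primitive u s| ^+ N).

(** The contributions to the drift of a function invisible up to weight M of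
    its terms of intermediate degree n in v: their coefficients are invisible
    up to weight M - n only. *)
Definition mixed M T u s : R := \sum_(n < M) `|primitive u s| ^+ n.+1 * V T u (M - n.+1).

Lemma mixed_ge0 M T u s : 0 <= mixed M T u s.
Proof. by apply: sumr_ge0 => n _; rewrite mulr_ge0 ?exprn_ge0// vint_ge0. Qed.

Lemma mixed_C0 M T u x : traj T u x -> C0 T (mixed M T u).
Proof.
move=> tr.
rewrite (_ : mixed M T u = \sum_(n < M) V T u (M - n.+1) *: (fun s => `|primitive u s| ^+ n.+1)).
  by apply: C0_sum => n _; apply: C0_scale; exact: (vexp_C0 tr (n := n.+1)).
by apply/funext => s; rewrite fct_sumE; apply: eq_bigr => n _; rewrite mulrC.
Qed.

(** By vint_mul a product of two integrals gains a factor T, so that the mixed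
    terms are negligible with respect to V M. *)
Lemma int_mixed M T u x : traj T u x -> primitive (mixed M T u) T <= M%:R * (2 * T * V T u M).
Proof.
move=> tr; have T0 := traj_T0 tr; have vc := v_C0 tr.
rewrite (_ : mixed M T u = \sum_(n < M) V T u (M - n.+1) *: (fun s => `|primitive u s| ^+ n.+1)); last first.
  by apply/funext => s; rewrite fct_sumE; apply: eq_bigr => n _; rewrite mulrC.
have i1 n : L1 T (fun s => `|primitive u s| ^+ n) by apply: L1_C0; exact: vint_C0.
rewrite (@primitive_sum _ T)// => [|n _]; last exact: L1_scale.
apply: (@le_trans _ _ (\sum_(n < M) 2 * T * V T u M)); last by rewrite sumr_const card_ord -[leLHS]mulr_natl.
apply: ler_sum => n _; rewrite (@primitive_scale _ T)//.
have := vint_mul T0 vc (M - n.+1) n.+1; rewrite subnK//.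
Qed.

(** Sort the expansion of the drift by the degree j + l in v: degree 0 is L_f0
    h, the intermediate degrees are mixed terms, degree M is the main term,
    and higher degrees are O(|v|^(M+1)). *)
Lemma drift_top_degree M N Tm h : (0 < M < N)%N -> pull_small M.-1 N Tm -> vanishing M h ->
  exists2 K, 0 <= K & forall T u x, traj T u x -> T <= Tm -> forall s, 0 <= s <= T ->
    `|drift N h (primitive u) x s - primitive u s ^+ M *
       \sum_(j < N) \sum_(l < N) (j + l == M)%N%:R * (exp_coef j / l`!%:R * pull N (L101 j l h) (primitive u) x s)|
    <= K * (`|pull N (Lf0 h) (primitive u) x s| + mixed M T u s + `|primitive u s| ^+ M.+1).
Proof.
move=> /andP[M0 MN] small hv; have ha : analytic 0 h := hv.1.
have N0 : (0 < N)%N by exact: ltn_trans MN.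
pose rhs T u x s := `|pull N (Lf0 h) (primitive u) x s| + mixed M T u s + `|primitive u s| ^+ M.+1.
have rhs0 T u x s : 0 <= rhs T u x s.
  by rewrite !addr_ge0 ?exprn_ge0// mixed_ge0.
have term (j l : 'I_N) : exists2 K, 0 <= K & forall T u x, traj T u x -> T <= Tm -> forall s, 0 <= s <= T ->
    `|(j + l != M)%N%:R * (primitive u s ^+ (j + l) * pull N (L101 j l h) (primitive u) x s)| <= K * rhs T u x s.
  have [E|E] := eqVneq (j + l)%N M.
    by exists 0 => // T u x tr _ s _; rewrite mul0r normr0 mul0r.
  have [jl0|jl0] := posnP (j + l)%N.
    have [j0 l0] : nat_of_ord j = 0%N /\ nat_of_ord l = 0%N by split; lia.
    have -> : L101 j l h = Lf0 h by rewrite /L101 j0 l0.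
    exists 1 => // T u x tr _ s _; rewrite jl0 mul1r expr0 !mul1r /rhs -addrA lerDl.
    by rewrite addr_ge0 ?mixed_ge0 ?exprn_ge0.
  have [jlM|] := ltnP (j + l) M.
    have gv := vanishing_L101 j l hv.
    have [|K K0 hK] := small (M - (j + l))%N _ _ gv.
      rewrite subn_gt0 jlM /=; lia.
    exists K => // T u x tr TT s sT; rewrite mul1r normrM normrX.
    have := ler_wpM2l (exprn_ge0 (j + l) (normr_ge0 (primitive u s))) (hK T u x tr TT s sT).
    move/le_trans; apply; rewrite mulrCA ler_wpM2l// mulrDr -exprD /rhs -addrA.
    apply: ler_wpDl => //; apply: lerD.
      have nM : ((j + l).-1 < M)%N by lia.
      rewrite /mixed (bigD1 (Ordinal nM))//= prednK// lerDl sumr_ge0// => n _.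
      by rewrite mulr_ge0 ?exprn_ge0// vint_ge0.
    apply: (v_exp_le tr) => //; lia.
  rewrite leq_eqVlt eq_sym (negbTE E) /= => Mjl.
  have [K K0 hK] := pull_bounded N (L101_analytic j l ha).
  exists K => // T u x tr TT s sT; rewrite mul1r normrM normrX mulrC.
  apply: ler_pM => //.
    exact: hK tr s sT.
  rewrite /rhs; apply: ler_wpDl; first by rewrite addr_ge0// mixed_ge0.
  exact: (v_exp_le tr).
have [K K0 hK] := @uniform_constant R N (fun j K => forall l : 'I_N, forall T u x, traj T u x -> T <= Tm -> forall s, 0 <= s <= T ->
    `|(j + l != M)%N%:R * (primitive u s ^+ (j + l) * pull N (L101 j l h) (primitive u) x s)| <= K * rhs T u x s)
  (fun i K K' KK H l T u x tr TT s sT => le_trans (H l T u x tr TT s sT) (ler_wpM2r (rhs0 T u x s) KK))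
  (fun j => @uniform_constant R N (fun l K => forall T u x, traj T u x -> T <= Tm -> forall s, 0 <= s <= T ->
    `|(j + l != M)%N%:R * (primitive u s ^+ (j + l) * pull N (L101 j l h) (primitive u) x s)| <= K * rhs T u x s)
  (fun i K K' KK H T u x tr TT s sT => le_trans (H T u x tr TT s sT) (ler_wpM2r (rhs0 T u x s) KK))
  (term j)).
have [K' K'0 hK'] := drift_expand N0 ha.
exists (\sum_(j < N) \sum_(l < N) K + K') => [|T u x tr TT s sT].
  by rewrite addr_ge0// sumr_ge0// => j _; exact: sumr_ge0.
have H1 := hK' T u x tr s sT.
set S := \sum_(j < N) \sum_(l < N) exp_coef j / _ * _ in H1.
set Q := _ * \sum_(j < N) _.
have -> : drift N h (primitive u) x s - Q = (S - Q) - (S - drift N h (primitive u) x s) by ring.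
apply: le_trans (ler_normB _ _) _; rewrite -/(rhs T u x s) mulrDl; apply: lerD; last first.
  apply: le_trans H1 _; rewrite ler_wpM2l// /rhs.
  by apply: ler_wpDl; [rewrite addr_ge0// mixed_ge0|exact: (v_exp_le tr)].
have -> : S - Q = \sum_(j < N) \sum_(l < N) exp_coef j / l`!%:R *
  ((j + l != M)%N%:R * (primitive u s ^+ (j + l) * pull N (L101 j l h) (primitive u) x s)).
  rewrite /S /Q mulr_sumr -sumrB; apply: eq_bigr => j _; rewrite mulr_sumr -sumrB.
  apply: eq_bigr => l _; case: eqP => [->|_] /=; ring.
rewrite (le_trans (ler_norm_sum _ _ _))// mulr_suml ler_sum// => j _.
rewrite (le_trans (ler_norm_sum _ _ _))// mulr_suml ler_sum// => l _.
rewrite normrM; apply: le_trans (hK j l T u x tr TT s sT).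
by rewrite ler_piMl// fact_coef_le.
Qed.

Lemma pull_sub N h h' v x s : analytic 0 h -> analytic 0 h' ->
  pull N (h - h') v x s = pull N h v x s - pull N h' v x s.
Proof.
move=> ha hb; rewrite /pull -sumrB; apply: eq_bigr => j _.
rewrite !(L1powE) (LB_sub _ ha hb).
by move: (LB _ h) (LB _ h') => a b; rewrite -[(a - b) _]/(a _ - b _); ring.
Qed.

Lemma pull_comb N q (a : 'I_q -> R) (e : 'I_q -> 'rV[R]_d -> R) v x s : (forall i, analytic 0 (e i)) ->
  pull N (\sum_i a i *: e i) v x s = \sum_i a i * pull N (e i) v x s.
Proof.
move=> ea; rewrite /pull; under [RHS]eq_bigr do rewrite mulr_sumr.
rewrite exchange_big; apply: eq_bigr => j _ /=.
have E m : L1pow m (\sum_i a i *: e i) = \sum_i a i *: L1pow m (e i).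
  elim: m => [//|m IH]; rewrite -[LHS]/(lie r f1 (L1pow m (\sum_i a i *: e i))) IH lie_sum => [|i _].
    by apply: eq_bigr => i _; rewrite lie_scale//; exact: L1pow_analytic.
  by apply: analytic_scale; exact: L1pow_analytic.
by rewrite E fct_sumE !mulr_sumr; apply: eq_bigr => i _; rewrite -[(_ *: _) _]/(a i * L1pow j (e i) (x s)); ring.
Qed.

(** A function of order N is controlled by |x|^N + |v|^N, and V 1 ^ N <=
    V N. *)
Lemma remainder_small Tx Kx N h : (0 < N)%N -> 2 * Tx <= 1 -> 0 <= Kx ->
  (forall T u x, traj T u x -> T <= Tx -> forall s, 0 <= s <= T ->
    `|x s| <= Kx * (`|primitive u s| + V T u 1)) ->
  analytic N h -> exists2 K, 0 <= K & forall T u x, traj T u x -> T <= Tx -> forall s, 0 <= s <= T ->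
    `|pull N h (primitive u) x s| <= K * (V T u N + `|primitive u s| ^+ N).
Proof.
move=> N0 Tx1 Kx0 xb ha; have [K K0 hK] := pull_remainder ha.
exists (K * ((Kx + 1) ^+ N * 2 ^+ N)) => [|T u x tr TT s sT].
  by rewrite !mulr_ge0// exprn_ge0// addr_ge0.
have T0 := traj_T0 tr; have vc := v_C0 tr.
apply: le_trans (hK T u x tr s sT) _; rewrite -!mulrA ler_wpM2l//.
have V0 := vint_ge0 T (primitive u) 1.
have step : `|x s| + `|primitive u s| <= (Kx + 1) * (V T u 1 + `|primitive u s|).
  by have := xb T u x tr TT s sT; lra.
apply: (@le_trans _ _ (((Kx + 1) * (V T u 1 + `|primitive u s|)) ^+ N)).
  by rewrite lerXn2r ?nnegrE ?addr_ge0// mulr_ge0 ?addr_ge0.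
rewrite exprMn ler_wpM2l ?exprn_ge0 ?addr_ge0//.
apply: le_trans (exp_add_le _ V0 (normr_ge0 _)) _.
rewrite ler_wpM2l ?exprn_ge0// lerD2r -(prednK N0); apply: vint_exp => //; lra.
Qed.

(** Induction on the weight M. Modulo functions of order N, the functions
    invisible up to weight M+1 are combinations of finitely many e_i. The
    drift of e_i involves L_f0 e_i, which is again such a combination, mixed
    terms, and powers of v; hence the total size G of the accumulated drifts
    is bounded by a multiple of T sup G + V (M+1), and G is absorbed for small
    T. *)
Lemma pull_small_exists N M : (M < N)%N ->
  exists Tm Kx, [/\ 0 < Tm, 2 * Tm <= 1, 0 <= Kx, pull_small M N Tm &
  forall T u x, traj T u x -> T <= Tm -> forall s, 0 <= s <= T ->
    `|x s| <= Kx * (`|primitive u s| + V T u 1)].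
Proof.
elim: M => [|M IH] MN.
  have [Tx [Kx [Tx0 Tx1 Kx0 xb]]] := state_bound.
  exists Tx, Kx; split => // m'; rewrite leqn0 lt0n; by case/andP => /negP.
have [Tm [Kx [Tm0 Tm1 Kx0 small xb]]] := IH (ltnW MN).
have N0 : (0 < N)%N by exact: leq_ltn_trans MN.
have [q [e [ev ec]]] := vanishing_generated (ltnW MN).
have ea0 i : analytic 0 (e i) := (ev i).1.
have ea1 i : analytic 1 (e i) := vanishing_analytic1 (ltn0Sn M) (ev i).
have dom h : vanishing M.+1 h -> exists2 K, 0 <= K & forall T u x, traj T u x -> T <= Tm -> forall s, 0 <= s <= T ->
    `|pull N h (primitive u) x s| <= K * (\sum_i `|pull N (e i) (primitive u) x s| + (V T u N + `|primitive u s| ^+ N)).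
  move=> hv; have [a ha] := ec h hv.
  have [K K0 hK] := remainder_small N0 Tm1 Kx0 xb ha.
  exists (\sum_i `|a i| + K) => [|T u x tr TT s sT]; first by rewrite addr_ge0// sumr_ge0.
  have sa : analytic 0 (\sum_i a i *: e i) by apply: analytic_sum => i _; exact: analytic_scale.
  have -> : pull N h (primitive u) x s = \sum_i a i * pull N (e i) (primitive u) x s +
      pull N (h - \sum_i a i *: e i) (primitive u) x s.
    by rewrite pull_sub; [rewrite pull_comb// addrC subrK|exact: hv.1|].
  have P0 : 0 <= \sum_i `|pull N (e i) (primitive u) x s| by exact: sumr_ge0.
  have Q0 : 0 <= V T u N + `|primitive u s| ^+ N by rewrite addr_ge0 ?vint_ge0 ?exprn_ge0.
  have A0 : 0 <= \sum_i `|a i| by exact: sumr_ge0.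
  apply: le_trans (ler_normD _ _) _; rewrite mulrDl; apply: lerD; last first.
    apply: le_trans (hK T u x tr TT s sT) _; rewrite ler_wpM2l//; lra.
  apply: (@le_trans _ _ ((\sum_i `|a i|) * \sum_i `|pull N (e i) (primitive u) x s|)); last first.
    by rewrite ler_wpM2l//; lra.
  rewrite (le_trans (ler_norm_sum _ _ _))// mulr_suml ler_sum// => i _.
  by rewrite normrM ler_wpM2l// (bigD1 i)//= lerDl sumr_ge0.
(* G is the total size of the drifts accumulated by the generators; w bounds
   the remaining terms. *)
pose G T u x s := \sum_i `|primitive (drift N (e i) (primitive u) x) s|.
pose w T u s := V T u M.+1 + `|primitive u s| ^+ M.+1.
have w0 T u s : 0 <= w T u s by rewrite addr_ge0 ?vint_ge0 ?exprn_ge0.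
have G0 T u x s : 0 <= G T u x s by exact: sumr_ge0.
have wN T u x s : traj T u x -> 0 <= s <= T -> V T u N + `|primitive u s| ^+ N <= w T u s.
  move=> tr sT; apply: lerD; last exact: (v_exp_le tr sT (ltnW MN)).
  by apply: (vint_mono (traj_T0 tr) (v_C0 tr) (v_le1 tr)); exact: ltnW.
have [Ks Ks0 star] := @uniform_constant R q (fun i K => forall T u x, traj T u x -> forall s, 0 <= s <= T ->
    `|pull N (e i) (primitive u) x s - primitive (drift N (e i) (primitive u) x) s| <=
    K * (`|primitive u s| ^+ N + V T u N))
  (fun i K K' KK H T u x tr s sT => le_trans (H T u x tr s sT)
    (ler_wpM2r (addr_ge0 (exprn_ge0 _ (normr_ge0 _)) (vint_ge0 _ _ _)) KK))
  (fun i => pull_drift N (ea1 i)).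
have gen T u x s : traj T u x -> 0 <= s <= T ->
    \sum_i `|pull N (e i) (primitive u) x s| <= G T u x s + q%:R * Ks * (V T u N + `|primitive u s| ^+ N).
  move=> tr sT.
  have -> : q%:R * Ks * (V T u N + `|primitive u s| ^+ N) =
      \sum_(i < q) Ks * (`|primitive u s| ^+ N + V T u N).
    by rewrite sumr_const card_ord -[RHS]mulr_natl mulrA [V T u N + _]addrC.
  rewrite -big_split ler_sum// => i _ /=; rewrite addrC -lerBlDr.
  by apply: le_trans (star i T u x tr s sT); exact: lerB_dist.
have [A A0 driftB] : exists2 A, 0 <= A & forall i T u x, traj T u x -> T <= Tm -> forall s, 0 <= s <= T ->
    `|drift N (e i) (primitive u) x s| <= A * (G T u x s + w T u s + mixed M.+1 T u s).
  apply: (@uniform_constant R q (fun i A => forall T u x, traj T u x -> T <= Tm -> forall s, 0 <= s <= T ->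
    `|drift N (e i) (primitive u) x s| <= A * (G T u x s + w T u s + mixed M.+1 T u s))).
    move=> i K K' KK H T u x tr TT s sT; apply: le_trans (H T u x tr TT s sT) _.
    by rewrite ler_wpM2r// addr_ge0 ?mixed_ge0// addr_ge0.
  move=> i; have [|K1 K10 hK1] := drift_top_degree (M := M.+1) _ small (ev i); first by rewrite MN.
  have [K2 K20 hK2] := dom _ (vanishing_Lf0 (ev i)).
  have [K3 K30 hK3] := @uniform_constant R N (fun j K => forall l : 'I_N, forall T u x, traj T u x -> forall s, 0 <= s <= T ->
      `|pull N (L101 j l (e i)) (primitive u) x s| <= K)
    (fun i K K' KK H l T u x tr s sT => le_trans (H l T u x tr s sT) KK)
    (fun j => @uniform_constant R N (fun l K => forall T u x, traj T u x -> forall s, 0 <= s <= T ->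
      `|pull N (L101 j l (e i)) (primitive u) x s| <= K)
      (fun i K K' KK H T u x tr s sT => le_trans (H T u x tr s sT) KK)
      (fun l => pull_bounded N (L101_analytic j l (ea0 i)))).
  pose c := K2 * (1 + q%:R * Ks); have c0 : 0 <= c by rewrite mulr_ge0// addr_ge0// mulr_ge0.
  exists (\sum_(j < N) \sum_(l < N) K3 + K1 * (c + 1)) => [|T u x tr TT s sT].
    by rewrite addr_ge0 ?mulr_ge0 ?addr_ge0// sumr_ge0// => j _; exact: sumr_ge0.
  have H1 := hK1 T u x tr TT s sT.
  set Q := _ * \sum_(j < N) _ in H1.
  have -> : drift N (e i) (primitive u) x s = Q + (drift N (e i) (primitive u) x s - Q) by ring.
  have m0 := mixed_ge0 M.+1 T u s; have g0 := G0 T u x s; have ww := w0 T u s.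
  have vM : `|primitive u s| ^+ M.+1 <= w T u s by rewrite lerDr vint_ge0.
  apply: le_trans (ler_normD _ _) _; rewrite mulrDl; apply: lerD.
    rewrite /Q normrM normrX mulrC mulr_suml.
    apply: (@le_trans _ _ (\sum_(j < N) (\sum_(l < N) K3) * `|primitive u s| ^+ M.+1)).
      rewrite -mulr_suml ler_wpM2r ?exprn_ge0//.
      rewrite (le_trans (ler_norm_sum _ _ _))// ler_sum// => j _.
      rewrite (le_trans (ler_norm_sum _ _ _))// ler_sum// => l _.
      rewrite normrM -[leRHS]mul1r ler_pM//.
        by case: eqP => _; rewrite ?normr1 ?normr0.
      apply: le_trans (hK3 j l T u x tr s sT); rewrite normrM ler_piMl//.
      exact: fact_coef_le.
    by apply: ler_sum => j _; rewrite ler_wpM2l ?sumr_ge0//; lra.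
  apply: le_trans H1 _; rewrite -mulrA ler_wpM2l//.
  have H2 := hK2 T u x tr TT s sT; have H3 := gen T u x s tr sT; have H4 := wN T u x s tr sT.
  have H5 : `|pull N (Lf0 (e i)) (primitive u) x s| <= c * (G T u x s + w T u s).
    apply: le_trans H2 _; rewrite /c -mulrA ler_wpM2l// mulrDl mul1r.
    have qk : 0 <= q%:R * Ks by rewrite mulr_ge0.
    have := ler_wpM2l qk H4; have := mulr_ge0 qk g0; rewrite mulrDr; lra.
  have vM2 : `|primitive u s| ^+ M.+2 <= w T u s.
    by apply: le_trans vM; exact: (v_exp_le tr).
  have := mulr_ge0 c0 m0; rewrite [(c + 1) * _]mulrDl [c * (_ + _ + _)]mulrDr mul1r; lra.
have qA : 0 <= q%:R * A by rewrite mulr_ge0.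
have Dc i T u x : traj T u x -> C0 T (drift N (e i) (primitive u) x).
  by move=> tr; exact: (drift_C0 tr (ea0 i)).
have W0 : 0 <= q%:R * A * M.+3%:R by rewrite mulr_ge0.
(* For T <= Tm' the accumulated drifts can be absorbed: q A T <= 1/2. *)
pose Tm' := Num.min Tm (1 / (2 * (q%:R * A + 1))).
have qA1 : 0 < 2 * (q%:R * A + 1) by lra.
have GV T u x : traj T u x -> T <= Tm' -> forall s, 0 <= s <= T ->
    G T u x s <= 2 * (q%:R * A * M.+3%:R * V T u M.+1).
  move=> tr; rewrite le_min ler_pdivlMr// => /andP[TT TA].
  have T0 := traj_T0 tr; have vc := v_C0 tr.
  have V0 := vint_ge0 T (primitive u) M.+1.
  apply: (@absorb R T (\sum_i primitive (fun y => `|drift N (e i) (primitive u) x y|) T)).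
  - apply: sumr_ge0 => i _; rewrite (le_trans (normr_ge0 (primitive (drift N (e i) (primitive u) x) T)))//.
    by apply: primitive_norm_bound => //; [exact: Dc|apply: C0_norm; exact: Dc|rewrite lexx T0].
  - by rewrite mulr_ge0.
  - move=> s sT; apply: ler_sum => i _.
    by apply: (primitive_norm_bound (Dc i T u x tr)) => //; apply: C0_norm; exact: Dc.
  move=> B B0 HB s sT.
  pose maj : R -> R := cst (A * (B + V T u M.+1)) +
     (A *: (fun y => `|primitive u y| ^+ M.+1) + A *: mixed M.+1 T u).
  have mc := mixed_C0 tr (M := M.+1).
  have c1 : C0 T (A *: (fun y => `|primitive u y| ^+ M.+1)) by apply: C0_scale; exact: vint_C0.
  have c2 : C0 T (A *: mixed M.+1 T u) by exact: C0_scale.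
  have majE : primitive maj T = A * (B + V T u M.+1) * T + (A * V T u M.+1 + A * primitive (mixed M.+1 T u) T).
    rewrite (@primitive_add _ T) ?primitive_cst//; last by apply: L1_C0; exact: C0_add.
      rewrite (@primitive_add _ T)//; [|exact: L1_C0|exact: L1_C0].
      rewrite !(@primitive_scale _ T)//; [exact: L1_C0|].
      by apply: L1_C0; exact: vint_C0.
    exact: L1_cst.
  have Di i : `|primitive (drift N (e i) (primitive u) x) s| <= primitive maj T.
    apply: primitive_norm_bound => //; first exact: Dc.
      by apply: C0_add; [exact: C0_cst|exact: C0_add].
    move=> y yT; apply: le_trans (driftB i T u x tr TT y yT) _.
    rewrite -[maj y]/(A * (B + V T u M.+1) + (A * `|primitive u y| ^+ M.+1 + A * mixed M.+1 T u y)).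
    by rewrite -!mulrDr ler_wpM2l// /w; have := HB y yT; lra.
  apply: (@le_trans _ _ (\sum_(i < q) primitive maj T)); first by apply: ler_sum => i _; exact: Di.
  rewrite sumr_const card_ord -[leLHS]mulr_natl majE.
  have im := int_mixed M.+1 tr.
  have T2 : 2 * T <= 1 by lra.
  have im' : primitive (mixed M.+1 T u) T <= M.+1%:R * V T u M.+1.
    by apply: le_trans im _; rewrite ler_wpM2l// ler_piMl.
  have E3 : M.+3%:R = M.+1%:R + 2 :> R by rewrite -natrD addn2.
  have B1 := ler_wpM2r B0 (_ : q%:R * A * T <= 1 / 2); have {B1}B1 := B1 ltac:(lra).
  have B2 := ler_wpM2r V0 (_ : q%:R * A * T <= q%:R * A); have {}B2 := B2 ltac:(by rewrite ler_piMr//; lra).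
  have B3 := ler_wpM2l qA im'.
  rewrite E3; lra.
exists Tm', Kx; split => //.
- by rewrite lt_min Tm0 divr_gt0.
- by apply: le_trans Tm1; rewrite ler_pM2l// ge_min lexx.
- move=> m' /andP[m'0]; rewrite leq_eqVlt => /orP[/eqP ->|m'M] h hv; last first.
    have [|K K0 hK] := small m' _ h hv; first by rewrite m'0.
    by exists K => // T u x tr; rewrite le_min => /andP[TT _]; exact: hK.
  have [K K0 hK] := dom h hv.
  pose k := 2 * (q%:R * A * M.+3%:R) + q%:R * Ks + 1.
  exists (K * k) => [|T u x tr TT s sT].
    by rewrite /k mulr_ge0// !addr_ge0 ?mulr_ge0.
  have Tm_ : T <= Tm by move: TT; rewrite le_min => /andP[].
  apply: le_trans (hK T u x tr Tm_ s sT) _; rewrite -mulrA ler_wpM2l//.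
  have H1 := gen T u x s tr sT; have H2 := GV T u x tr TT s sT.
  have V0 := vint_ge0 T (primitive u) M.+1; have p0 := exprn_ge0 N (normr_ge0 (primitive u s)).
  have H3 : V T u N <= V T u M.+1 := vint_mono (traj_T0 tr) (v_C0 tr) (v_le1 tr) (ltnW MN).
  have qK : 0 <= q%:R * Ks by rewrite mulr_ge0.
  have H4 := ler_wpM2l qK H3; have H5 := mulr_ge0 W0 p0.
  rewrite /k; lra.
by move=> T u x tr; rewrite le_min => /andP[TT _]; exact: xb.
Qed.

Lemma analytic_lipschitz0 psi : analytic 0 psi -> exists2 K, 0 <= K &
  forall y, `|y| <= rx -> `|psi y - psi 0| <= K * `|y|.
Proof.
move=> pa; have pa1 : analytic 1 (psi - cst (psi 0)).
  apply: analytic1 => //; first by apply: analytic_sub => //; exact: analytic_cst.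
  exact: subrr.
by have [K K0 hK] := analytic_order pa1 rr; exists K => // y /hK; rewrite expr1.
Qed.

Lemma pull_at0 N psi : (0 < N)%N -> analytic 0 psi -> exists2 K, 0 <= K &
  forall T u x, traj T u x -> forall s, 0 <= s <= T ->
    `|pull N psi (primitive u) x s - psi 0| <= K * (`|x s| + `|primitive u s|).
Proof.
case: N => // N _ pa; have [K K0 hK] := analytic_lipschitz0 pa.
have [A A0 hA] := ball_bound (fun j : 'I_N => L1pow_analytic j.+1 pa).
exists (K + \sum_(j < N) A) => [|T u x tr s sT]; first by rewrite addr_ge0// sumr_ge0.
have [_ _ _ xB _] := tr; have [xs _] := xB s sT.
have S0 : 0 <= \sum_(j < N) A by exact: sumr_ge0.
rewrite /pull big_ord_recl -[exp_coef _ * _]/(exp_coef 0 * (1 * psi (x s))) [exp_coef 0]divr1 expr0 !mul1r addrAC.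
apply: le_trans (ler_normD _ _) _.
rewrite mulrDl; apply: lerD.
  by apply: le_trans (hK _ xs) _; rewrite ler_wpM2l// lerDl.
apply: (@le_trans _ _ ((\sum_(j < N) A) * `|primitive u s|)); last by rewrite ler_wpM2l// lerDr.
rewrite (le_trans (ler_norm_sum _ _ _))// mulr_suml ler_sum// => j _.
rewrite normrM norm_exp_coef normrM normrX /=.
have v1 := v_le1 tr sT.
have := hA j _ xs; rewrite expr0 mulr1 => Hj.
have fi : ((j.+1)`!%:R : R)^-1 <= 1 by exact: fact_inv_le1.
apply: le_trans (ler_piMl _ fi) _; first by rewrite mulr_ge0// exprn_ge0.
rewrite mulrC ler_pM// ?exprn_ge0// exprS ler_piMr//; exact: exprn_ile1.
Qed.

Lemma lie_coord i y : `|y| < r -> lie r f1 (fun z : 'rV[R]_d => z 0 i) y = f1 y 0 i.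
Proof.
move=> yr; rewrite lieE /lin_row (bigD1 i)//= pd_coord yr eqxx mulr1 big1 ?addr0// => j ji.
by rewrite pd_coord yr (negbTE ji) mulr0.
Qed.

(** At second order the i-th coordinate of the endpoint is v f1_i(0) up to the
    drift, O(V 1), and errors that are absorbed for small v. *)
Lemma final_primitive i : f1 0 0 i != 0 -> exists eps K, [/\ 0 < eps, 0 <= K &
  forall T u x, traj T u x -> T <= eps -> `|primitive u T| <= eps ->
    `|primitive u T| <= K * (`|x T| + V T u 1)].
Proof.
move=> f1i; pose c := fun y : 'rV[R]_d => y 0 i.
have ca : analytic 1 c by exact: analytic_coord.
have ca0 : analytic 0 c by exact: analytic_weak ca.
have [Tx [Kx [Tx0 Tx1 Kx0 xb]]] := state_bound.
have [K K0 hK] := pull_drift 2 ca.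
have [A A0 hA] := analytic_lipschitz0 (f1a i).
have L0a j : analytic 1 (Lf0 (L1pow j c)).
  apply: analytic1 => //; first by apply: analytic_lie0 => //; exact: L1pow_analytic.
  by rewrite lieE f00 /lin_row big1// => k _; rewrite mxE mul0r.
have [B B0 hB] := ball_bound (fun j : 'I_2 => L0a j).
have b0 : 0 < `|f1 0 0 i| by rewrite normr_gt0.
have K1 : 0 < 2 * (K + 1) by lra.
pose b := `|f1 0 0 i|; rewrite -/b in b0.
pose C := 2 / b * (1 + A + K + 4 * B * Kx).
exists (Num.min Tx (b / (2 * (K + 1)))), C; split.
- by rewrite lt_min Tx0 divr_gt0.
- by rewrite /C mulr_ge0 ?divr_ge0 ?(ltW b0)// !addr_ge0 ?mulr_ge0.
move=> T u x tr; rewrite !le_min => /andP[TT _] /andP[_]; rewrite ler_pdivlMr// => vT.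
have [T0 _ _ xB _] := tr; have TTT : 0 <= T <= T by rewrite lexx T0.
have [xT _] := xB T TTT; have vc := v_C0 tr.
have H := hK T u x tr T TTT.
have V0 := vint_ge0 T (primitive u) 1.
have V21 : V T u 2 <= V T u 1 by exact: (vint_mono T0 vc (v_le1 tr)).
have DB : `|primitive (drift 2 c (primitive u) x) T| <= 4 * B * Kx * V T u 1.
  apply: (@le_trans _ _ (primitive (fun y => 2 * B * Kx * V T u 1 + 2 * B * Kx * `|primitive u y| ^+ 1) T)).
    apply: primitive_norm_bound => //; first exact: (drift_C0 tr ca0).
      apply: (@C0_add _ T (cst (2 * B * Kx * V T u 1)) ((2 * B * Kx) *: (fun y => `|primitive u y| ^+ 1))).
        exact: C0_cst.
      by apply: C0_scale; exact: vint_C0.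
    move=> y yT; have [xy _] := xB y yT.
    have t j : `|exp_coef j * (primitive u y ^+ j * Lf0 (L1pow j c) (x y))| <= `|Lf0 (L1pow j c) (x y)|.
      rewrite normrM norm_exp_coef normrM mulrA ler_piMl// mulr_ile1 ?exprn_ge0 ?invr_ge0//.
        by exact: fact_inv_le1.
      by rewrite normrX; apply: exprn_ile1 => //; exact: (v_le1 tr).
    rewrite /drift (le_trans (ler_norm_sum _ _ _))// big_ord_recl big_ord1.
    have t0 := le_trans (t 0%N) (hB ord0 _ xy).
    have t1 := le_trans (t 1%N) (hB (lift ord0 ord0) _ xy).
    apply: le_trans (lerD t0 t1) _; rewrite !expr1 -mulrDr.
    have xy' := xb T u x tr TT y yT.
    apply: le_trans (ler_wpM2l B0 (lerD xy' xy')) _; rewrite le_eqVlt; apply/orP; left.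
    by apply/eqP; ring.
  rewrite int_cst_add//.
  have : 2 * B * Kx * V T u 1 * T <= 2 * B * Kx * V T u 1.
    by rewrite ler_piMr ?mulr_ge0//; lra.
  lra.
have pE : pull 2 c (primitive u) x T = x T 0 i - primitive u T * f1 (x T) 0 i.
  rewrite /pull big_ord_recl big_ord1 /= /bump /= addn0 /L1pow /=.
  rewrite -[lie r f1 c]/(lie r f1 (fun z : 'rV[R]_d => z 0 i)) lie_coord; last first.
    by apply: le_lt_trans xT _; case/andP: rr.
  by rewrite /exp_coef /c !divr1 expr1 !expr0; ring.
rewrite pE in H.
have HA := hA _ xT.
have xi : `|x T 0 i| <= `|x T| by exact: le_coord.
have v1 : `|primitive u T| <= 1 := v_le1 tr TTT.
set v := primitive u T in H v1 vT *.
set D := primitive _ T in H DB.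
have main : `|v| * b <= `|x T| + A * `|x T| + K * (`|v| ^+ 2 + V T u 1) + 4 * B * Kx * V T u 1.
  rewrite /b -normrM.
  have -> : v * f1 0 0 i = x T 0 i - v * (coordf f1 i (x T) - coordf f1 i 0) -
       (x T 0 i - v * f1 (x T) 0 i - D) - D by rewrite /coordf; ring.
  apply: le_trans (ler_normB _ _) _; apply: lerD => //.
  apply: le_trans (ler_normB _ _) _; apply: lerD.
    apply: le_trans (ler_normB _ _) _; apply: lerD => //.
    rewrite normrM; apply: le_trans HA; rewrite ler_piMl//.
  by apply: le_trans H _; rewrite ler_wpM2l// lerD2l.
have v2 : K * `|v| ^+ 2 <= `|v| * (b / 2).
  have := ler_wpM2l (normr_ge0 v) vT; have := exprn_ge0 2 (normr_ge0 v); rewrite expr2; nra.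
rewrite /C -/v.
have : `|v| * b <= 2 * ((1 + A + K + 4 * B * Kx) * (`|x T| + V T u 1)).
  have := mulr_ge0 A0 V0; have := mulr_ge0 K0 (normr_ge0 (x T)).
  by have := mulr_ge0 (mulr_ge0 B0 Kx0) (normr_ge0 (x T)); lra.
rewrite -ler_pdivlMr// => /le_trans; apply; rewrite le_eqVlt; apply/orP; left; apply/eqP; ring.
Qed.

(** * The obstruction *)

Section quadratic_obstruction.
Variables (M : nat) (phi : 'rV[R]_d -> R).
Hypotheses (M2 : (2 <= M)%N) (Meven : ~~ odd M).
Hypotheses (phiv : vanishing M phi) (phi1 : lie r (ad f1 M f0) phi 0 = 1).

(** The binomial formula lie_ad at the origin. *)
Lemma main_coefficient :
  \sum_(j < M.+1) \sum_(l < M.+1) (j + l == M)%N%:R * (exp_coef j / l`!%:R * L101 j l phi 0) = M`!%:R^-1.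
Proof.
have M0 : M`!%:R != 0 :> R by rewrite pnatr_eq0 -lt0n fact_gt0.
apply: (mulfI M0); rewrite divff// -[RHS]phi1 (lie_ad M phiv.1) fct_sumE mulr_sumr.
apply: eq_bigr => j _; have jM : (j <= M)%N by rewrite -ltnS.
have lM : (M - j < M.+1)%N by rewrite ltnS leq_subr.
rewrite (bigD1 (Ordinal lM))//= subnKC// eqxx mul1r big1 ?addr0 => [|l /eqP lj].
  rewrite -[RHS]/((-1) ^+ j * 'C(M, j)%:R * L101 j (M - j) phi 0) mulrA; congr (_ * _).
  have a0 : j`!%:R != 0 :> R by rewrite pnatr_eq0 -lt0n fact_gt0.
  have b0 : (M - j)`!%:R != 0 :> R by rewrite pnatr_eq0 -lt0n fact_gt0.
  rewrite -(bin_fact jM) !natrM /exp_coef; field; by rewrite a0 b0.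
case: eqP => [E|]; last by rewrite mul0r.
by case: lj; apply: val_inj => /=; lia.
Qed.

(** Only the main term counts: its coefficient is within O(|x| + |v|) of 1 /
    M!, and v^M = |v|^M for even M. *)
Lemma drift_lower_bound : exists eps C, [/\ 0 < eps, 0 <= C &
  forall rho T u x, rho <= rv -> traj T u x -> T <= eps ->
   (forall s, 0 <= s <= T -> `|primitive u s| <= rho) ->
   V T u M / M`!%:R - C * (T + rho) * V T u M <= primitive (drift M.+1 phi (primitive u) x) T].
Proof.
have M0 : (0 < M)%N by exact: ltnW.
have [Tm [Kx [Tm0 Tm1 Kx0 small xb]]] := pull_small_exists (ltnSn M).
have small' : pull_small M.-1 M.+1 Tm.
  by move=> m' /andP[m0 mM]; apply: small; rewrite m0 (leq_trans mM)// leq_pred.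
have [|K K0 hK] := drift_top_degree (M := M) (N := M.+1) _ small' phiv; first by rewrite M0 /=.
have [|K1 K10 hK1] := small M _ _ (vanishing_Lf0 phiv); first by rewrite M0 /=.
have [K2 K20 hK2] := @uniform_constant R M.+1 (fun j K => forall l : 'I_M.+1, forall T u x, traj T u x -> forall s, 0 <= s <= T ->
      `|pull M.+1 (L101 j l phi) (primitive u) x s - L101 j l phi 0| <= K * (`|x s| + `|primitive u s|))
    (fun i K K' KK H l T u x tr s sT => le_trans (H l T u x tr s sT) (ler_wpM2r (addr_ge0 (normr_ge0 _) (normr_ge0 _)) KK))
    (fun j => @uniform_constant R M.+1 (fun l K => forall T u x, traj T u x -> forall s, 0 <= s <= T ->
      `|pull M.+1 (L101 j l phi) (primitive u) x s - L101 j l phi 0| <= K * (`|x s| + `|primitive u s|))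
      (fun i K K' KK H T u x tr s sT => le_trans (H T u x tr s sT) (ler_wpM2r (addr_ge0 (normr_ge0 _) (normr_ge0 _)) KK))
      (fun l => pull_at0 (ltn0Sn M) (L101_analytic j l phiv.1))).
pose n2 : R := \sum_(j < M.+1) \sum_(l < M.+1) K2.
have n20 : 0 <= n2 by apply: sumr_ge0 => j _; exact: sumr_ge0.
pose kx := 2 * Kx + 1; have kx0 : 0 <= kx by rewrite addr_ge0// mulr_ge0.
exists Tm, (n2 * kx + K * (2 * K1 + 2 * M%:R + 1)); split => //.
  by rewrite addr_ge0// mulr_ge0// !addr_ge0// mulr_ge0.
move=> rho T u x rr' tr TT vr.
have [T0 _ _ xB _] := tr; have vc := v_C0 tr.
have rho0 : 0 <= rho by apply: le_trans (vr 0 _); rewrite ?lexx.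
have vM s : `|primitive u s| ^+ M = primitive u s ^+ M.
  by rewrite -normrX ger0_norm// exprn_even_ge0.
have lower s : 0 <= s <= T -> (M`!%:R^-1 - n2 * (kx * rho)) * `|primitive u s| ^+ M -
   K * (K1 * (V T u M + rho * `|primitive u s| ^+ M) + mixed M T u s + rho * `|primitive u s| ^+ M)
   <= drift M.+1 phi (primitive u) x s.
  move=> sT; have H := hK T u x tr TT s sT.
  set Q := \sum_(j < M.+1) _ in H.
  have vs := vr s sT.
  have p0 := exprn_ge0 M (normr_ge0 (primitive u s)).
  have vM1 : `|primitive u s| ^+ M.+1 <= rho * `|primitive u s| ^+ M by rewrite exprS ler_wpM2r.
  have V1 : V T u 1 <= rho.
    by apply: le_trans (vint1_le T0 vc vr) _; rewrite ler_piMr//; lra.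
  have xs : `|x s| + `|primitive u s| <= kx * rho.
    have := xb T u x tr TT s sT; have := ler_wpM2l Kx0 (lerD vs V1); rewrite /kx; lra.
  have QB : `|Q - M`!%:R^-1| <= n2 * (kx * rho).
    rewrite -main_coefficient /Q -sumrB (le_trans (ler_norm_sum _ _ _))// mulr_suml ler_sum// => j _.
    rewrite -sumrB (le_trans (ler_norm_sum _ _ _))// mulr_suml ler_sum// => l _.
    rewrite -!mulrBr normrM; apply: (@le_trans _ _ (`|exp_coef j / l`!%:R * (pull M.+1 (L101 j l phi) (primitive u) x s - L101 j l phi 0)|)).
      by rewrite ler_piMl//; case: eqP; rewrite ?normr1 ?normr0.
    rewrite normrM; apply: (@le_trans _ _ `|pull M.+1 (L101 j l phi) (primitive u) x s - L101 j l phi 0|).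
      by rewrite ler_piMl// fact_coef_le.
    apply: le_trans (hK2 j l T u x tr s sT) _; exact: ler_wpM2l.
  have H1 := hK1 T u x tr TT s sT.
  move: H; rewrite ler_norml => /andP[H _].
  move: QB; rewrite ler_norml => /andP[QB _].
  have HQ : (M`!%:R^-1 - n2 * (kx * rho)) * `|primitive u s| ^+ M <= primitive u s ^+ M * Q.
    rewrite -vM mulrC ler_wpM2l//; lra.
  apply: (@le_trans _ _ (primitive u s ^+ M * Q + (drift M.+1 phi (primitive u) x s - primitive u s ^+ M * Q))); last first.
    by rewrite addrC subrK.
  apply: lerD HQ (le_trans _ H); rewrite lerN2 ler_wpM2l//.
  have := ler_wpM2l K10 vM1; lra.
pose a := M`!%:R^-1 - n2 * (kx * rho) - K * (K1 * rho + rho).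
have mc := mixed_C0 tr (M := M).
have c0 : C0 T (a *: (fun y => `|primitive u y| ^+ M)) by apply: C0_scale; exact: vint_C0.
have c1 : C0 T (cst (- (K * K1 * V T u M))) by exact: C0_cst.
have c2 : C0 T (- K *: mixed M T u) by exact: C0_scale.
have c3 := C0_add c1 c2; have c4 := C0_add c0 c3.
have majE : primitive (a *: (fun y => `|primitive u y| ^+ M) + (cst (- (K * K1 * V T u M)) + - K *: mixed M T u)) T =
    a * V T u M + (- (K * K1 * V T u M) * T - K * primitive (mixed M T u) T).
  rewrite (@primitive_add _ T)//; [|exact: L1_C0|exact: L1_C0].
  rewrite (@primitive_add _ T)//; [|exact: L1_C0|exact: L1_C0].
  rewrite primitive_cst// (@primitive_scale _ T)//; last by apply: L1_C0; exact: vint_C0.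
  by rewrite (@primitive_scale _ T) ?mulNr//; exact: L1_C0.
apply: (@le_trans _ _ (a * V T u M + (- (K * K1 * V T u M) * T - K * primitive (mixed M T u) T))); last first.
  rewrite -majE; apply: int_le => //; first exact: (drift_C0 tr phiv.1).
  move=> y yT; apply: le_trans (lower y yT).
  rewrite -[leLHS]/(a * `|primitive u y| ^+ M + (- (K * K1 * V T u M) + - K * mixed M T u y)) /a.
  rewrite le_eqVlt; apply/orP; left; apply/eqP; ring.
have V0 := vint_ge0 T (primitive u) M.
have K1M := mulr_ge0 K0 (ler0n R M).
have im := ler_wpM2l K0 (int_mixed M tr).
have e1 : 0 <= n2 * kx * T * V T u M by rewrite !mulr_ge0.
have e2 : 0 <= K * K1 * T * V T u M by rewrite !mulr_ge0.
have e3 : 0 <= K * K1 * rho * V T u M by rewrite !mulr_ge0.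
have e4 : 0 <= K * M%:R * rho * V T u M by rewrite !mulr_ge0.
have e5 : 0 <= K * T * V T u M by rewrite !mulr_ge0.
rewrite /a {lower hK hK1 hK2 c0 c1 c2 c3 c4 majE}.
move: (primitive (mixed M T u) T) im => mx im.
set MM := M`!%:R^-1; lra.
Qed.

Hypothesis phi10 : analytic 1 phi.

(** The Lie derivatives of phi along f1 of order between 1 and M - 1 vanish at
    the origin, so that their values at x are O(|x|). *)
Lemma pull_end : exists2 K, 0 <= K & forall T u x, traj T u x -> forall s, 0 <= s <= T ->
  `|pull M.+1 phi (primitive u) x s - phi (x s)| <= K * (`|primitive u s| * `|x s| + `|primitive u s| ^+ M).
Proof.
have h0 j : (j < M)%N -> L1pow j phi 0 = 0.
  move=> jM; have [_ H] := vanishing_L1pow j phiv.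
  by apply: (H [::]); rewrite /weight /= subn_gt0.
have term (j : 'I_M) : exists2 K, 0 <= K & forall T u x, traj T u x -> forall s, 0 <= s <= T ->
    `|exp_coef j.+1 * (primitive u s ^+ j.+1 * L1pow j.+1 phi (x s))| <=
       K * (`|primitive u s| * `|x s| + `|primitive u s| ^+ M).
  have [K K0 hK] := analytic_lipschitz0 (L1pow_analytic j.+1 phiv.1).
  have [A A0 hA] := analytic_order (L1pow_analytic j.+1 phiv.1) rr.
  exists (K + A) => [|T u x tr s sT]; first by rewrite addr_ge0.
  have [_ _ _ xB _] := tr; have [xs _] := xB s sT.
  have v1 := v_le1 tr sT.
  have fi : ((j.+1)`!%:R : R)^-1 <= 1 by exact: fact_inv_le1.
  rewrite normrM norm_exp_coef normrM normrX.
  apply: le_trans (ler_piMl _ fi) _; first by rewrite mulr_ge0// exprn_ge0.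
  have p0 : 0 <= `|primitive u s| * `|x s| by rewrite mulr_ge0.
  have q0 : 0 <= `|primitive u s| ^+ M by rewrite exprn_ge0.
  have [jM|] := ltnP j.+1 M.
    have := hK _ xs; rewrite h0// subr0 => H.
    apply: (@le_trans _ _ (`|primitive u s| * (K * `|x s|))); last first.
      have := mulr_ge0 K0 q0; have := mulr_ge0 A0 (addr_ge0 p0 q0); lra.
    by rewrite ler_pM ?exprn_ge0// exprS ler_piMr//; exact: exprn_ile1.
  move=> Mj; have jE : j.+1 = M by apply/eqP; rewrite eqn_leq Mj ltn_ord.
  have := hA _ xs; rewrite expr0 mulr1 jE => H.
  apply: le_trans (ler_wpM2l q0 H) _.
  have := mulr_ge0 A0 p0; have := mulr_ge0 K0 (addr_ge0 p0 q0); lra.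
have [K K0 hK] := @uniform_constant R M (fun j K => forall T u x, traj T u x -> forall s, 0 <= s <= T ->
    `|exp_coef j.+1 * (primitive u s ^+ j.+1 * L1pow j.+1 phi (x s))| <=
       K * (`|primitive u s| * `|x s| + `|primitive u s| ^+ M))
  (fun i K K' KK H T u x tr s sT => le_trans (H T u x tr s sT)
    (ler_wpM2r (addr_ge0 (mulr_ge0 (normr_ge0 _) (normr_ge0 _)) (exprn_ge0 _ (normr_ge0 _))) KK)) term.
exists (\sum_(j < M) K) => [|T u x tr s sT]; first exact: sumr_ge0.
rewrite /pull big_ord_recl -[exp_coef _ * _]/(exp_coef 0 * (1 * phi (x s))) [exp_coef 0]divr1 expr0 !mul1r addrAC subrr add0r.
by rewrite (le_trans (ler_norm_sum _ _ _))// mulr_suml ler_sum// => j _; exact: (hK j T u x tr s sT).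
Qed.

(** At x(T) = - a g the function phi is close to - a, while its transported
    value is almost at least V M / M!. The discrepancy between the two is
    |v(T)|^M = O(a^2 + T V M), and all error terms carry a small factor times
    a or V M. *)
Lemma unreachable i : f1 0 0 i != 0 -> 0 < rv -> exists2 eps, 0 < eps & forall T u x a, traj T u x ->
  T <= eps -> (forall s, 0 <= s <= T -> `|primitive u s| <= eps) -> 0 < a <= eps ->
  x T <> - a *: ad f1 M f0 0.
Proof.
move=> f1i rv0; set gv := ad f1 M f0 0.
have [eps1 [C1 [e10 C10 lower]]] := drift_lower_bound.
have [eps2 [K2 [e20 K20 final]]] := final_primitive f1i.
have [K3 K30 star] := pull_drift M.+1 phi10.
have [K4 K40 pend] := pull_end.
have [K6 K60 taylor] := analytic_taylor phi10 rr.
pose K7 := K2 ^+ M * (2 ^+ M * (`|gv| ^+ M + 1)).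
have gM : 0 <= `|gv| ^+ M by exact: exprn_ge0.
have K70 : 0 <= K7 by rewrite !mulr_ge0// ?exprn_ge0// addr_ge0.
(* A and B collect the constants of the errors eps V M and eps a. *)
pose A := 2 * C1 + K3 + 2 * ((K3 + K4) * K7).
pose B := K6 * `|gv| ^+ 2 + K4 * `|gv| + (K3 + K4) * K7.
have K34 : 0 <= (K3 + K4) * K7 by rewrite mulr_ge0// addr_ge0.
have A0 : 0 <= A by rewrite !addr_ge0// mulr_ge0.
have B0 : 0 <= B by rewrite !addr_ge0// mulr_ge0// exprn_ge0.
have Mf : 0 < M`!%:R :> R by rewrite ltr0n fact_gt0.
pose eps := Num.min (1 / 2) (Num.min eps1 (Num.min eps2 (Num.min rv
  (Num.min (1 / (M`!%:R * (A + 1))) (1 / (2 * (B + 1))))))).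
have A1 : 0 < M`!%:R * (A + 1) by rewrite mulr_gt0//; lra.
have B1 : 0 < 2 * (B + 1) by lra.
have eps0 : 0 < eps by rewrite !lt_min e10 e20 rv0 !divr_gt0.
have : eps <= eps by [].
rewrite {2}/eps !le_min => /andP[ea /andP[eb /andP[ec /andP[ed]]]].
rewrite !ler_pdivlMr// => /andP[ee ef].
exists eps => // T u x a tr TT vr /andP[a0 ae] xT.
have [T0 _ _ xB _] := tr; have TTT : 0 <= T <= T by rewrite lexx T0.
have [xTr _] := xB T TTT; have vc := v_C0 tr; have vT := vr T TTT.
set v := primitive u T in vT.
have V0 := vint_ge0 T (primitive u) M.
have V10 := vint_ge0 T (primitive u) 1.
have T2 : 2 * T <= 1.
  by have := le_trans TT ea; rewrite ler_pdivlMr// mulrC.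
have normx : `|x T| = a * `|gv| by rewrite xT normrZ normrN gtr0_norm.
have v0 : 0 <= `|v| ^+ M by exact: exprn_ge0.
have L := lower eps T u x ed tr (le_trans TT eb) vr.
have F := final T u x tr (le_trans TT ec) (le_trans vT ec).
have S := star T u x tr T TTT; have P := pend T u x tr T TTT.
have X := taylor 0 (- a *: gv).
rewrite -/v normx in F S P.
have Y : phi (x T) <= - a + K6 * `|gv| ^+ 2 * (a * eps).
  have x00' : `|0 : 'rV[R]_d| <= rx by rewrite normr0; case/andP: rr => /ltW.
  have := X x00'; rewrite add0r -xT => /(_ xTr); rewrite normx.
  have -> : phi 0 = 0 by exact: (analytic_at0 r0 (ltn0Sn 0) phi10).
  have -> : lin_row (fun i => pd r i phi 0) (x T) = - a.
    by rewrite xT linearZ /= -lieE phi1 -[LHS]/(- a * 1) mulr1.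
  rewrite ler_norml => /andP[_ Y].
  have : K6 * (a * `|gv|) ^+ 2 <= K6 * `|gv| ^+ 2 * (a * eps).
    rewrite exprMn -mulrA ler_wpM2l// [leLHS]mulrC ler_wpM2l ?exprn_ge0// expr2.
    by rewrite ler_wpM2l// ltW.
  by move: Y; lra.
have vM : `|v| ^+ M <= K7 * (a * eps + 2 * eps * V T u M).
  apply: (@le_trans _ _ ((K2 * (a * `|gv| + V T u 1)) ^+ M)).
    by rewrite lerXn2r ?nnegrE// mulr_ge0// addr_ge0// mulr_ge0// ltW.
  rewrite exprMn /K7 -!mulrA ler_wpM2l ?exprn_ge0//.
  apply: le_trans (exp_add_le _ _ V10) _; first by rewrite mulr_ge0// ltW.
  rewrite ler_wpM2l ?exprn_ge0//.
  have E1 : (a * `|gv|) ^+ M <= `|gv| ^+ M * (a * eps).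
    rewrite exprMn mulrC ler_wpM2l// -(subnK M2) exprD expr2.
    apply: (@le_trans _ _ (1 * (a * a))); last by rewrite mul1r ler_wpM2l// ltW.
    apply: ler_wpM2r; first by rewrite mulr_ge0// ltW.
    by rewrite exprn_ile1 ?(ltW a0)// (le_trans ae)// (le_trans ea)// ler_pdivrMr// mul1r ler1n.
  have E2 : V T u 1 ^+ M <= 2 * eps * V T u M.
    have := vint_exp2 T0 vc (M - 2) T2; rewrite -[(M - 2).+2]addn2 subnK// => /le_trans; apply.
    by rewrite ler_wpM2r// ler_wpM2l.
  have e0 : 0 <= a * eps by rewrite mulr_ge0// ltW.
  have e1 : 0 <= eps * V T u M by rewrite mulr_ge0// ltW.
  have := mulr_ge0 gM e1; lra.
have vM1 : `|v| ^+ M.+1 <= `|v| ^+ M by exact: (v_exp_le tr).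
have VM1 : V T u M.+1 <= eps * V T u M by exact: vint_le.
have vx : K4 * (`|v| * (a * `|gv|) + `|v| ^+ M) <= K4 * `|gv| * (a * eps) + K4 * `|v| ^+ M.
  have : `|v| * (a * `|gv|) <= eps * (a * `|gv|) by rewrite ler_wpM2r// mulr_ge0// ltW.
  by move/(ler_wpM2l K40); lra.
have S' : K3 * (`|v| ^+ M.+1 + V T u M.+1) <= K3 * `|v| ^+ M + K3 * (eps * V T u M).
  by rewrite -mulrDr ler_wpM2l// lerD.
move: S; rewrite ler_norml => /andP[S _]; move: P; rewrite ler_norml => /andP[_ P].
have vM' : (K3 + K4) * `|v| ^+ M <= (K3 + K4) * K7 * (a * eps + 2 * eps * V T u M).
  by rewrite -mulrA ler_wpM2l// addr_ge0.
have CT : C1 * (T + eps) * V T u M <= C1 * (2 * eps) * V T u M.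
  by rewrite ler_wpM2r// ler_wpM2l//; lra.
have total : V T u M / M`!%:R + a <= eps * A * V T u M + eps * B * a.
  rewrite /A /B; lra.
have HA : eps * A * V T u M <= V T u M / M`!%:R.
  rewrite [leRHS]mulrC ler_wpM2r// -[leRHS]mul1r ler_pdivlMr//.
  have : 0 <= eps * M`!%:R by rewrite mulr_ge0// ltW.
  move: ee; rewrite !mulrDr mulr1; lra.
have HB : eps * B * a <= 1 / 2 * a by rewrite ler_wpM2r ?ltW//; lra.
lra.
Qed.

End quadratic_obstruction.

(** The state bound forbids the solution from leaving the ball of radius rx
    first. *)
Lemma mild_solution_traj : 0 < rv ->
  exists2 eps, 0 < eps & forall rho T u x U, 0 < T -> T <= eps -> rho <= eps -> L1 T u ->
    (forall s, 0 <= s <= T -> `|primitive u s| <= rho) -> mild_solution f0 f1 U T u x ->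
    traj T u x.
Proof.
move=> rv0.
have [Tx [Kx [Tx0 Tx1 Kx0 xb]]] := state_bound.
have rx0 : 0 < rx by case/andP: rr.
have K1 : 0 < 2 * (Kx + 1) by lra.
exists (Num.min Tx (Num.min rv (rx / (2 * (Kx + 1))))).
  by rewrite !lt_min Tx0 rv0 divr_gt0.
move=> rho T u x U T0; rewrite !le_min => /and3P[TT _ _] /and3P[_ rhov].
rewrite ler_pdivlMr// => rhox ui vr [xc _ xE].
have x0 : x 0 = 0.
  by apply/rowP => i; rewrite xE ?lexx ?ltW// set_itv1 Rintegral_set1 mxE.
have nxc : C0 T (fun s => `|x s|).
  apply/C0_P => s sT; apply: cvg_norm; move/subspace_continuousP: xc; apply.
  by rewrite /= in_itv.
have rho0 : 0 <= rho.
  by apply: le_trans (vr 0 _); [exact: normr_ge0|rewrite lexx ltW].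
have xB : forall s, 0 <= s <= T -> `|x s| <= rx.
  apply: (first_exit (ltW T0) nxc); first by rewrite /= x0 normr0 ltW.
  move=> s /andP[s0 sT] xs.
  have vrs y : 0 <= y <= s -> `|primitive u y| <= rho.
    by move=> /andP[y0 ys]; apply: vr; rewrite y0 (le_trans ys).
  have tr : traj s u x.
    split=> //; first exact: L1_sub ui.
    - apply: continuous_subspaceW xc => y /=; rewrite !in_itv /= => /andP[-> ys].
      exact: le_trans sT.
    - by move=> y ys; split; [exact: xs|exact: le_trans (vrs y ys) _].
    by move=> y /andP[y0 ys]; apply: xE; rewrite y0 (le_trans ys).
  have ss : 0 <= s <= s by rewrite lexx s0.
  have V1 : vint (primitive u) s 1 <= rho.
    apply: le_trans (vint1_le s0 (v_C0 tr) vrs) _; rewrite ler_piMr//.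
    by have := le_trans sT TT; lra.
  apply: le_lt_trans (xb s u x tr (le_trans sT TT) s ss) _.
  have := ler_wpM2l Kx0 (lerD (vrs s ss) V1); move: rhox; rewrite mulrC mulrDr => rhox H.
  apply: le_lt_trans H _.
  have [->|rhoN] := eqVneq rho 0; first by rewrite addr0 mulr0.
  have : 0 < rho by rewrite lt_neqAle eq_sym rhoN.
  by lra.
split=> //; first exact: ltW.
by move=> s sT; split; [exact: xB|exact: le_trans (vr s sT) _].
Qed.

End estimates.

(** * The necessary condition *)

Lemma traj_weak rv rv' T u x : rv <= rv' -> traj rv T u x -> traj rv' T u x.
Proof.
move=> rvv [T0 ui xc xB xE]; split=> // s /xB[xs vs]; split=> //.
exact: le_trans rvv.
Qed.

(** The targets - a g with a > 0 small cannot be reached. *)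
Theorem obstruction_not_STLC M phi i (U : set 'rV[R]_d) : (2 <= M)%N -> ~~ odd M ->
  vanishing M phi -> lie r (ad f1 M f0) phi 0 = 1 -> f1 0 0 i != 0 ->
  ~ Wm1oo_STLC f0 f1 U.
Proof.
move=> M2 Meven phiv phi1 f1i stlc.
have [rv' rv'0 pd'] := transport_estimate.
pose rv := Num.min 1 rv'.
have rv0 : 0 < rv by rewrite lt_min ltr01.
have rv1 : rv <= 1 by rewrite ge_min lexx.
have rvv : rv <= rv' by rewrite ge_min lexx orbT.
have pd h N (ha : analytic 1 h) : exists2 K, 0 <= K & forall T u x, traj rv T u x -> forall s, 0 <= s <= T ->
    `|pull N h (primitive u) x s - primitive (drift N h (primitive u) x) s| <=
    K * (`|primitive u s| ^+ N + vint (primitive u) T N).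
  by have [K K0 hK] := pd' h N ha; exists K => // T u x tr; apply: hK; exact: traj_weak tr.
have [e1 e10 sol] := mild_solution_traj pd rv0.
have phi10 : analytic 1 phi by apply: vanishing_analytic1 phiv => //; exact: ltnW.
have [e2 e20 unr] := unreachable rv1 pd M2 Meven phiv phi1 phi10 f1i rv0.
pose e := Num.min e1 e2.
have e0 : 0 < e by rewrite lt_min e10.
have ee1 : e <= e1 by rewrite ge_min lexx.
have ee2 : e <= e2 by rewrite ge_min lexx orbT.
have [del del0 reach] := stlc e e e0 e0.
set gv := ad f1 M f0 0 in unr.
have g1 : 0 < `|gv| + 1 by rewrite ltr_wpDl.
pose a := Num.min e (del / (2 * (`|gv| + 1))).
have a0 : 0 < a by rewrite lt_min e0 divr_gt0// mulr_gt0.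
have ae : a <= e by rewrite ge_min lexx.
have [|u [ui un [x xsol xT]]] := reach (- a *: gv).
  rewrite -ball_normE /= sub0r normrN normrZ normrN gtr0_norm//.
  have : a <= del / (2 * (`|gv| + 1)) by rewrite ge_min lexx orbT.
  rewrite ler_pdivlMr ?mulr_gt0// => H.
  have := mulr_ge0 (ltW a0) (normr_ge0 gv); lra.
have uL := L1_open ui.
have ub := Wm1oo_bound e0 uL un.
have tr := sol e e u x U e0 ee1 ee1 uL ub xsol.
apply: (unr e u x a tr ee2 (fun s sT => le_trans (ub s sT) ee2) _ xT).
by rewrite a0 (le_trans ae).
Qed.

End trajectories.

End system.

Definition ad_word k : Br := iter k (Bracket Defs.X1) Defs.X0.

Lemma ad_wordE {R : realType} {d : nat} (f0 f1 : 'rV[R]_d -> 'rV[R]_d) k : eval_bracket f0 f1 (ad_word k) = ad f1 k f0.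
Proof. by elim: k => //= k ->. Qed.

Theorem theorem1p10 (R : realType) (d : nat) (hd : (1 <= d)%N)
    (U : set 'rV[R]_d) (hU : open U) (hU0 : U 0)
    (f0 f1 : 'rV[R]_d -> 'rV[R]_d)
    (hf0 : real_analytic_on U f0) (hf1 : real_analytic_on U f1)
    (hf00 : f0 0 = 0)
    (hSTLC : Wm1oo_STLC f0 f1 U) :
  forall k : nat, (1 <= k)%N ->
    S_ [pred m : nat | (1 <= m <= 2 * k - 1)%N] f0 f1 (ad f1 (2 * k) f0 0).
Proof.
move=> k k1.
have [f1z|/eqP/rowP f1n] := eqVneq (f1 0) 0.
  exists [::] => //=; rewrite -ad_wordE.
  by have := fb_f1_0 hf00 (ad_word (2 * k)) f1z; rewrite /fb => ->; exact: mem0v.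
have [i f1i] : exists i, f1 0 0 i != 0.
  by apply/not_existsP => H; apply: f1n => i; rewrite mxE; apply/eqP; apply: contra_notT (H i).
apply: contrapT => notS.
have [ra ra0 f0a] := real_analytic_vanalytic (hf0 0 hU0).
have [rb rb0 f1a] := real_analytic_vanalytic (hf1 0 hU0).
pose r := Num.min ra rb.
have r0 : 0 < r by rewrite lt_min ra0.
have {}f0a : vanalytic r f0 by move=> j; apply: analytic_radius (f0a j); rewrite ge_min lexx.
have {}f1a : vanalytic r f1 by move=> j; apply: analytic_radius (f1a j); rewrite ge_min lexx orbT.
have [|phi [phi10 phi0 phi1]] := @obstruction_function R d r f0 f1 r0 f0a f1a hf00 (2 * k - 1) (ad_word (2 * k)).
  move=> bs bsW; apply/negP => H; apply: notS; exists bs => //.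
  by rewrite -ad_wordE.
have rr : 0 < r / 2 < r by lra.
have phiv : vanishing r f0 f1 (2 * k) phi.
  split=> [|B BW]; first exact: analytic_weak phi10.
  by apply: phi0; lia.
apply: (obstruction_not_STLC r0 f0a f1a hf00 rr _ _ phiv _ f1i hSTLC); first lia.
  by rewrite mul2n odd_double.
by rewrite -ad_wordE.
Qed.
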